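(* Consider the linear time-invariant $n_r\times n_t$ MIMO channel with additive stationary non-Gaussian noise (LNGMC) $$\mathbf Y[i]=\sum_{\tau=0}^{m}\mathsf G[\tau]\,\mathbf X[i-\tau]+\mathbf W[i],\qquad i\in\{0,1,\ldots,l-1\},$$ with input subject to the time-averaged power constraint $\frac1l\sum_{i=0}^{l-1}\mathbb E\{\|\mathbf X[i]\|^2\}\le P$. Its capacity $C_{\rm L}$ satisfies $$C_{\rm L}\le C_{\rm G}+\bar H_{G,\mathbf W}-\bar H_{\mathbf W}.$$
   Context: All signals are real-valued and in discrete time; logarithms are base 2. For a sequence $\mathbf y[i]$, $\mathbf y_{a}^{b}$ is the column vector stacking $\mathbf y[a],\ldots,\mathbf y[b]$, and $\mathbf y^{b}=\mathbf y_0^b$. $h(\cdot)$ is differential entropy, $|\cdot|$ applied to a matrix is the determinant, $a^+=\max\{0,a\}$. Channel. $m\ge0$ is an integer and $\mathsf G[\tau]\in\mathbb R^{n_r\times n_t}$, $0\le\tau\le m$. The noise $\mathbf W[i]\in\mathbb R^{n_r}$ is a zero-mean strict-sense stationary (non-Gaussian) process having joint PDFs, finite second moments and finite differential entropies of blocks, independent of the transmitted message, such that $\mathbf W_{i_1}^{i_1+l_1}$ and $\mathbf W_{i_2}^{i_2+l_2}$ are independent whenever $i_2>i_1+l_1+m$. The initial state is $\mathbf S_0=[(\mathbf X_{-m}^{-1})^T,(\mathbf W_{-m}^{-1})^T]^T$. Capacity. An $[R,l]$ code consists of a message set $\mathcal U=\{1,\ldots,2^{lR}\}$, an encoder mapping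 each $u\in\mathcal U$ to a codeword $(\mathbf x_{(u)}[0],\ldots,\mathbf x_{(u)}[l-1])$, and a decoder $d_l$ mapping the $l$ outputs to a message; neither depends on $\mathbf S_0$. With the message $U$ uniform on $\mathcal U$, the codewords must satisfy the power constraint. The error probability is $P_e^l(\mathbf s_0)=2^{-lR}\sum_{u}\Pr(d_l(\mathbf Y^{l-1})\ne u\mid U=u,\mathbf S_0=\mathbf s_0)$. A rate $R_c$ is achievable if for every $\epsilon_1,\epsilon_2>0$ there is $l_0>0$ such that for all integers $l>l_0$ there is an $[R,l]$ code with $\sup_{\mathbf s_0\in\mathcal S_0}P_e^l(\mathbf s_0)<\epsilon_1$ and $R\ge R_c-\epsilon_2$, where $\mathcal S_0$ is the set of initial states. Capacity is the supremum of achievable rates. Quantities in the bound. $\mathsf C_{\mathbf W}[\tau]=\mathbb E\{\mathbf W[i+\tau]\mathbf W[i]^T\}$, $\mathsf G'(\omega)=\sum_{\tau=0}^m\mathsf G[\tau]e^{-j\omega\tau}$, $\mathsf C'_{\mathbf W}(\omega)=\sum_{\tau=-m}^m\mathsf C_{\mathbf W}[\tau]e^{-j\omega\tau}$ (taken to be invertible). - $\bar H_{\mathbf W}=\lim_{l\to\infty}\frac1l h(\mathbf W^{l-1})$ is the entropy rate of $\mathbf W$. - $\bar H_{G,\mathbf W}$ is the entropy rate of a zero-mean $n_r$-variate Gaussian process with autocorrelation $\mathsf C_{\mathbf W}[\tau]$, i.e. $\bar H_{G,\mathbf W}=\frac1{4\pi}\int_{-\pi}^{\pi}\log|2\pi e\,\mathsf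 C'_{\mathbf W}(\omega)|\,d\omega$. - $C_{\rm G}$ is the capacity of the same channel (same $\mathsf G[\tau]$, same power constraint, with $\mathbf X_{-m}^{-1}=\mathbf 0$) when the noise is replaced by a zero-mean stationary Gaussian process with autocorrelation $\mathsf C_{\mathbf W}[\tau]$. It is given by $C_{\rm G}=\frac1{4\pi}\sum_k\int_{-\pi}^{\pi}(\log(\Delta'\lambda'_k(\omega)))^+d\omega$, where $\lambda'_k(\omega)$ are the eigenvalues of $(\mathsf G'(\omega))^H(\mathsf C'_{\mathbf W}(\omega))^{-1}\mathsf G'(\omega)$ and $\Delta'$ is chosen so that $\frac1{2\pi}\sum_k\int_{-\pi}^{\pi}(\Delta'-(\lambda'_k(\omega))^{-1})^+d\omega=P$ (zero eigenvalues contribute $0$ to both sums). *)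

(* Defs.v *)
From HB Require Import structures.
From mathcomp Require Import all_boot all_order all_algebra.
From mathcomp Require Import complex.
From mathcomp Require Import all_classical all_reals all_analysis.

Set Implicit Arguments.
Unset Strict Implicit.
Unset Printing Implicit Defensive.

Import Order.TTheory GRing.Theory Num.Theory.
Import numFieldNormedType.Exports.

Local Open Scope classical_set_scope.
Local Open Scope ring_scope.

Section tuple_measure.
Context d (T : measurableType d) (R : realType).
Variable mu : {sigma_finite_measure set T -> \bar R}.

Definition cons_pair n (x : T * n.-tuple T) : n.+1.-tuple T :=
  [tuple of x.1 :: x.2].

Lemma measurable_cons_pair n : measurable_fun [set: T * n.-tuple T] (@cons_pair n).
Proof. exact: measurable_cons measurable_fst measurable_snd. Qed.

Section step.
Variables (n : nat) (nu : {sigma_finite_measure set (n.-tuple T) -> \bar R}).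

Definition tuple_measureS : set (n.+1.-tuple T) -> \bar R :=
  pushforward (mu \x nu)%E (@cons_pair n).

Let tuple_measureS0 : tuple_measureS set0 = 0%E.
Proof. by rewrite /tuple_measureS /pushforward preimage_set0 measure0. Qed.

Let tuple_measureS_ge0 A : (0 <= tuple_measureS A)%E.
Proof. exact: (measure_ge0 (mu \x nu)%E). Qed.

Let tuple_measureS_sigma_additive : semi_sigma_additive tuple_measureS.
Proof.
move=> F mF tF mUF; rewrite /tuple_measureS /pushforward preimage_bigcup.
apply: measure_semi_sigma_additive.
- by move=> k; rewrite -[X in measurable X]setTI; exact: measurable_cons_pair.
- apply/trivIsetP => /= i j _ _ ij; rewrite -preimage_setI.
  by move/trivIsetP : tF => /(_ _ _ _ _ ij) ->//; rewrite preimage_set0.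
- rewrite -preimage_bigcup -[X in measurable X]setTI.
  exact: measurable_cons_pair.
Qed.

HB.instance Definition _ := isMeasure.Build _ _ _ tuple_measureS
  tuple_measureS0 tuple_measureS_ge0 tuple_measureS_sigma_additive.

Let tuple_measureS_sigma_finite : sigma_finite setT tuple_measureS.
Proof.
have /sigma_finiteP[F [TF ndF Foo]] := sigma_finiteT mu.
have /sigma_finiteP[G [TG ndG Goo]] := sigma_finiteT nu.
pose g (t : n.+1.-tuple T) : T * n.-tuple T := (thead t, [tuple of behead t]).
have mg : measurable_fun setT g.
  apply/measurable_fun_pairP; split; last exact: measurable_behead.
  exact: (@measurable_tnth _ T n.+1 ord0).
have gK x : g (@cons_pair n x) = x.
  by case: x => x t; rewrite /g /=; congr (_, _); apply/val_inj.
exists (fun k => g @^-1` (F k `*` G k)).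
  apply/esym; rewrite -preimage_bigcup -subTset => t _ /=.
  have : (\bigcup_k F k) (g t).1 by rewrite -TF.
  have : (\bigcup_k G k) (g t).2 by rewrite -TG.
  move=> [j _ Gj] [i _ Fi]; exists (maxn i j) => //; split.
  - by move: Fi; exact/subsetPset/ndF/leq_maxl.
  - by move: Gj; exact/subsetPset/ndG/leq_maxr.
move=> k; have [mF Fk] := Foo k; have [mG Gk] := Goo k.
have mFG : measurable (F k `*` G k) by exact: measurableX.
split; first by rewrite -[X in measurable X]setTI; exact: mg.
rewrite /tuple_measureS /pushforward.
have -> : @cons_pair n @^-1` (g @^-1` (F k `*` G k)) = F k `*` G k.
  by apply/seteqP; split => x; rewrite /preimage /mkset gK.
by rewrite product_measure1E// lte_mul_pinfty// ge0_fin_numE.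
Qed.

HB.instance Definition _ := Measure_isSigmaFinite.Build _ _ _ tuple_measureS
  tuple_measureS_sigma_finite.

End step.

Fixpoint tuple_measure n : {sigma_finite_measure set (n.-tuple T) -> \bar R} :=
  match n with
  | 0 => \d_([tuple] : 0.-tuple T)
  | n'.+1 => tuple_measureS (tuple_measure n')
  end.

End tuple_measure.


Notation vec R n := (n.-tuple (measurableTypeR R)).
(* k consecutive samples of an n-variate signal *)
Notation block R n k := (k.-tuple (vec R n)).

Definition log2 {R : realType} (x : R) : R := ln x / ln 2.

Definition leb_block (R : realType) (n k : nat) :
    {sigma_finite_measure set (block R n k) -> \bar R} :=
  tuple_measure (tuple_measure (@lebesgue_measure R) n) k.

(* The argument f of the definitions below is a family of joint PDFs: f k is  *)
(* the density of k consecutive noise samples. By stationarity one family     *)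
(* serves all starting times.                                                 *)
Definition entropy (R : realType) n k (f : block R n k -> R) : \bar R :=
  (- \int[leb_block R n k]_w (f w * log2 (f w))%:E)%E.

Definition entropy_rate (R : realType) n (f : forall k, block R n k -> R) :
    \bar R :=
  limn (fun l : nat => ((l%:R^-1)%:E * entropy (@f l))%E).

Section noise.
Context d (Omega : measurableType d) (R : realType) (P : probability Omega R).
Context (n : nat) (W : int -> {RV P >-> vec R n}).

(* the samples W[a], ..., W[a + k - 1] *)
Definition noise_block (a : int) k (t : Omega) : block R n k :=
  [tuple W (a + i%:Z) t | i < k].

Definition noise_coord (i : int) (r : 'I_n) (t : Omega) : R := tnth (W i t) r.

Definition autocorr (tau : int) : 'M[R]_n :=
  \matrix_(r, s) fine ('E_P[noise_coord tau r \* noise_coord 0 s]).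

Record noise_process (m : nat) (f : forall k, block R n k -> R) : Prop := {
  noise_stationary : forall (a b : int) k (A : set (block R n k)),
    measurable A ->
    P (noise_block a k @^-1` A) = P (noise_block b k @^-1` A) ;
  noise_pdf_measurable : forall k, measurable_fun setT (f k) ;
  noise_pdf_ge0 : forall k w, 0 <= f k w ;
  noise_pdfE : forall k (A : set (block R n k)), measurable A ->
    P (noise_block 0 k @^-1` A) = (\int[leb_block R n k]_(w in A) (f k w)%:E)%E ;
  noise_mean0 : forall i r, ('E_P[noise_coord i r] = 0)%E ;
  noise_moment2 : forall i r,
    ('E_P[fun t => (noise_coord i r t ^+ 2)%R] < +oo)%E ;
  noise_entropy_fin : forall k,
    (leb_block R n k).-integrable setT
      (fun w => (f k w * log2 (f k w))%:E) ;
  noise_mdep : forall (i1 i2 : int) (l1 l2 : nat),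
    i1 + l1%:Z + m%:Z < i2 ->
    forall (A1 : set (block R n l1.+1)) (A2 : set (block R n l2.+1)),
    measurable A1 -> measurable A2 ->
    P ((noise_block i1 l1.+1 @^-1` A1) `&` (noise_block i2 l2.+1 @^-1` A2)) =
    (P (noise_block i1 l1.+1 @^-1` A1) * P (noise_block i2 l2.+1 @^-1` A2))%E }.

End noise.

Record code (R : realType) (nr nt l : nat) := Code {
  nmsg : nat ;
  enc : 'I_nmsg -> l.-tuple 'cV[R]_nt ;
  dec : block R nr l -> 'I_nmsg ;
  nmsg_gt0 : (0 < nmsg)%N ;
  dec_measurable : forall u, measurable (dec @^-1` [set u]) }.

Arguments enc {R nr nt l} c u.

Section channel.
Context (R : realType) (nr nt m : nat) (G : 'I_m.+1 -> 'M[R]_(nr, nt)).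

(* Y[0], ..., Y[l - 1]; the state x0 lists X[-m], ..., X[-1], so that         *)
(* X[i - tau] is entry m + i - tau of x0 ++ x.                                *)
Definition output l (x0 : m.-tuple 'cV[R]_nt) (x : l.-tuple 'cV[R]_nt)
    (w : block R nr l) : block R nr l :=
  [tuple [tuple
      (\sum_(tau < m.+1) G tau *m nth 0 (x0 ++ x) (m + i - tau)) r ord0
        + tnth (tnth w i) r | r < nr] | i < l].

(* the number of messages is 2^(lr) *)
Definition has_rate l (c : code R nr nt l) (r : R) : Prop :=
  (nmsg c)%:R = 2 `^ (l%:R * r).

Definition power l (c : code R nr nt l) : R :=
  l%:R^-1 * \sum_(i < l) ((nmsg c)%:R^-1 *
    \sum_(u < nmsg c) \sum_(j < nt) (tnth (enc c u) i) j ord0 ^+ 2).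

Definition state : Type := m.-tuple 'cV[R]_nt * block R nr m.

Context (f : forall k, block R nr k -> R).

(* density of W[0], ..., W[l - 1] given that W[-m], ..., W[-1] is w0 *)
Definition cond_pdf l (w0 : block R nr m) (w : block R nr l) : R :=
  f [tuple of w0 ++ w] / f w0.

(* the initial states on which one can condition *)
Definition states : set state := [set s | 0 < f s.2].

(* The noise being independent of the message, the event of a wrong decision  *)
(* given U = u and S_0 = s is governed by the density cond_pdf s.2.           *)
Definition err_prob l (c : code R nr nt l) (s : state) : \bar R :=
  (((nmsg c)%:R^-1)%:E * \sum_(u < nmsg c)
    \int[leb_block R nr l]_(w in [set w | dec c (output s.1 (enc c u) w) <> u])
      (cond_pdf s.2 w)%:E)%E.

Definition achievable (P Rc : R) : Prop :=
  forall e1 e2 : R, 0 < e1 -> 0 < e2 ->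
  exists2 l0 : nat, (0 < l0)%N & forall l : nat, (l0 < l)%N ->
  exists (c : code R nr nt l) (r : R),
    [/\ has_rate c r, power c <= P,
        (ereal_sup [set err_prob c s | s in states] < e1%:E)%E & Rc - e2 <= r].

Definition capacity (P : R) : \bar R :=
  ereal_sup [set Rc%:E | Rc in achievable P].

End channel.

Section spectral_quantities.
Context (R : realType) (nr nt m : nat).
Context (G : 'I_m.+1 -> 'M[R]_(nr, nt)) (C : int -> 'M[R]_nr).
Local Open Scope complex_scope.
Local Open Scope sesquilinear_scope.

(* e^{-jx} *)
Definition cis_neg (x : R) : R[i] := cos x -i* sin x.

Definition Gfreq (w : R) : 'M[R[i]]_(nr, nt) :=
  \sum_(tau < m.+1) cis_neg (w * tau%:R) *: map_mx (real_complex R) (G tau).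

Definition Cfreq (w : R) : 'M[R[i]]_nr :=
  \sum_(k < m.*2.+1) let tau := k%:Z - m%:Z in
    cis_neg (w * tau%:~R) *: map_mx (real_complex R) (C tau).

(* The matrix is Hermitian, so Re only changes the type of its eigenvalues;   *)
(* likewise for the determinant in gauss_entropy_rate.                        *)
Definition lambda (w : R) (k : 'I_nt) : R :=
  complex.Re (spectral_diag ((Gfreq w)^t* *m invmx (Cfreq w) *m Gfreq w) ord0 k).

(* Both integrands sum over the eigenvalues at a fixed frequency, because     *)
(* spectral_diag lists them in no particular order: only symmetric functions  *)
(* of them are known to be measurable in w.                                   *)
Definition waterfill_power (D : R) : R :=
  (2 * pi)^-1 * \int[lebesgue_measure]_(w in `[- pi, pi])
    \sum_(k < nt) if lambda w k == 0 then 0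
                  else Num.max 0 (D - (lambda w k)^-1).

(* With D a water level for the power P, this is the capacity of the channel  *)
(* whose noise is the Gaussian process with autocorrelation C and whose       *)
(* inputs before time 0 vanish.                                               *)
Definition waterfill_rate (D : R) : R :=
  (4 * pi)^-1 * \int[lebesgue_measure]_(w in `[- pi, pi])
    \sum_(k < nt) if lambda w k == 0 then 0
                  else Num.max 0 (log2 (D * lambda w k)).

(* The second alternative covers a channel whose eigenvalues all vanish, for  *)
(* which the power equation has no solution and every level gives rate 0.     *)
Definition water_level (P D : R) : Prop :=
  waterfill_power D = P \/ forall w k, lambda w k = 0.

(* entropy rate of the Gaussian process with autocorrelation C *)
Definition gauss_entropy_rate : R :=
  (4 * pi)^-1 * \int[lebesgue_measure]_(w in `[- pi, pi])
    log2 (complex.Re (\det ((2 * pi * expR 1)%:C *: Cfreq w))).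

End spectral_quantities.

(* Main.v *)
Require Import Defs.
From HB Require Import structures.
From mathcomp Require Import all_boot all_order all_algebra.
From mathcomp Require Import complex.
From mathcomp Require Import all_classical all_reals all_analysis.
From mathcomp Require Import measurable_realfun.
From mathcomp Require Import ring lra zify.

Set Implicit Arguments.
Unset Strict Implicit.
Unset Printing Implicit Defensive.

Import Order.TTheory GRing.Theory Num.Theory.
Import numFieldNormedType.Exports.

Local Open Scope classical_set_scope.
Local Open Scope ring_scope.

(* Instead of mutual information and asymptotic eigenvalue distributions, one
   test density does all the work. For a code of length l put N = m + l, prefix
   every codeword with m zeros, and add the corresponding signal to the noise
   density f_N; compare the result with a centred Gaussian density g on N
   samples. As the decoding sets are disjoint, the translates of g restricted to
   them have total mass at most 1, and ln x <= x - 1 gives a Fano inequality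
     (1 - P_e) ln M <= 1 - h(f_N) - E ln g(signal + noise),
   where the expectation also averages over the messages.
   The covariance of g is block circulant, with symbol K + H S H^* at each DFT
   frequency, where K is the noise spectrum, H the channel, and S the
   waterfilling spectrum; since the signal starts with m zeros it is a circular
   convolution. At the water level D the quadratic form of the precision matrix
   costs at most 1/D per unit of input energy, and the trace against K returns
   1/D times the power constraint, so both cancel. What is left is
   the sum over DFT frequencies of ln det K and of the waterfilling rates. These
   are Lipschitz functions of the frequency, so their Riemann sums are the
   integrals up to a bounded error, and the entropy rate is at most h(f_N)/N
   by Fekete's lemma. *)

(** * Hermitian forms *)

(** A circulant matrix is diagonalised exactly by the DFT at every finite N, whereas the noise
    covariance is only Toeplitz. Because the noise is m-dependent, replacing one by the other
    changes only about m diagonals near the borders, and this costs a constant that vanishes after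
    division by l. The obstacle is the wrap-around of circular convolution, which falsifies the
    first m samples. These belong to the initial state and the decoder never sees them, so the
    signal added there can be chosen freely. The zero input state is one of those in the supremum
    defining the error, and averaging the conditional error over the noise state leaves a statement
    about f_N alone. The frequencies 2 pi j / N - pi form a grid of the interval of integration, but
    are N-periodic only for even N; achievability speaks of all large l, so m + l can be taken even.
    The constant 1 in the Fano inequality is the bound on the mass of the restricted translates. The
    precision matrix is treated as complex Hermitian without showing that it is real: on real
    vectors its Gaussian integral is at most the usual value, and mass at most 1 is all that the
    argument asks of g. *)

Section hermitian_forms.
Context (C : numClosedFieldType).
Local Open Scope sesquilinear_scope.

Lemma trCM m n p (A : 'M[C]_(m, n)) (B : 'M[C]_(n, p)) :
  (A *m B)^t* = B^t* *m A^t*.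
Proof. by rewrite trmx_mul map_mxM. Qed.

Lemma trCD m n (A B : 'M[C]_(m, n)) : (A + B)^t* = A^t* + B^t*.
Proof. by rewrite linearD/= map_mxD. Qed.

Lemma trCN m n (A : 'M[C]_(m, n)) : (- A)^t* = - A^t*.
Proof. by rewrite linearN/= map_mxN. Qed.

Lemma trCB m n (A B : 'M[C]_(m, n)) : (A - B)^t* = A^t* - B^t*.
Proof. by rewrite trCD trCN. Qed.

Definition hform n (Q : 'M[C]_n) (u : 'rV[C]_n) : C := (u *m Q *m u^t*) 0 0.

Definition pdmx n (Q : 'M[C]_n) : Prop :=
  Q^t* = Q /\ forall u, u != 0 -> 0 < hform Q u.

Lemma hform_congr m n (A : 'M[C]_(m, n)) (Q : 'M[C]_n) (u : 'rV[C]_m) :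
  hform (A *m Q *m A^t*) u = hform Q (u *m A).
Proof. by rewrite /hform trCM !mulmxA. Qed.

Lemma hformD n (A B : 'M[C]_n) u : hform (A + B) u = hform A u + hform B u.
Proof. by rewrite /hform mulmxDr mulmxDl mxE. Qed.

Lemma hform_diag n (d u : 'rV[C]_n) :
  hform (diag_mx d) u = \sum_i d 0 i * `|u 0 i| ^+ 2.
Proof.
rewrite /hform mul_mx_diag mxE; apply: eq_bigr => i _; rewrite !mxE.
by rewrite normCK mulrAC mulrC mulrA.
Qed.

Lemma hform1 n (u : 'rV[C]_n) : hform 1%:M u = \sum_i `|u 0 i| ^+ 2.
Proof.
rewrite -diag_const_mx hform_diag; apply: eq_bigr => i _.
by rewrite mxE mul1r.
Qed.

Lemma hermitian_spectral n (A : 'M[C]_n) : A^t* = A ->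
  A = (spectralmx A)^t* *m diag_mx (spectral_diag A) *m spectralmx A.
Proof.
move=> hA; rewrite -invmx_unitary ?spectral_unitarymx//.
apply/orthomx_spectralP/hermitian_normalmx/is_hermitianmxP.
by rewrite expr0 scale1r hA.
Qed.

Lemma unitary_trCmul n (P : 'M[C]_n) : P \is unitarymx -> P^t* *m P = 1%:M.
Proof.
by move=> uP; rewrite -invmx_unitary// mulVmx//; exact: unitarymx_unit.
Qed.

Lemma det_unitary_conj n (P D : 'M[C]_n) : P \is unitarymx ->
  \det (P^t* *m D *m P) = \det D.
Proof.
move=> /unitary_trCmul h.
by rewrite !det_mulmx mulrAC -det_mulmx h det1 mul1r.
Qed.

Lemma mxtrace_unitary_conj n (P D : 'M[C]_n) : P \is unitarymx ->
  \tr (P^t* *m D *m P) = \tr D.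
Proof.
by move=> /unitarymxP h; rewrite mxtrace_mulC mulmxA h mul1mx.
Qed.

(** Each eigenvalue is the value of the form at the corresponding row of the unitary [spectralmx A],
    a nonzero vector. *)
Lemma pdmx_spectral_gt0 n (A : 'M[C]_n) i : pdmx A -> 0 < spectral_diag A 0 i.
Proof.
move=> [hA pA]; set P := spectralmx A; set d := spectral_diag A.
have uP : P \is unitarymx := spectral_unitarymx A.
have AE := hermitian_spectral hA; rewrite -/P -/d in AE.
have dE : hform A (row i P) = d 0 i.
  rewrite AE -[X in _ *m X]trmxCK hform_congr -row_mul (unitarymxP uP).
  rewrite row1 hform_diag (bigD1 i)//= mxE !eqxx normr1 expr1n mulr1.
  rewrite big1 ?addr0// => j ji.
  by rewrite mxE eqxx/= (negbTE ji) normr0 expr0n mulr0.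
rewrite -dE; apply: pA; apply/eqP => r0.
have := congr1 (fun X => (X *m P^t*) 0 i) r0.
rewrite -row_mul (unitarymxP uP) mul0mx row1 !mxE !eqxx => /eqP.
by rewrite oner_eq0.
Qed.

Lemma pdmx_det_gt0 n (A : 'M[C]_n) : pdmx A -> 0 < \det A.
Proof.
move=> pA; rewrite (hermitian_spectral pA.1) det_unitary_conj; last first.
  exact: spectral_unitarymx.
by rewrite det_diag; apply: prodr_gt0 => i _; exact: pdmx_spectral_gt0.
Qed.

Lemma pdmx_unit n (A : 'M[C]_n) : pdmx A -> A \in unitmx.
Proof. by move/pdmx_det_gt0/gt_eqF; rewrite unitmxE unitfE => ->. Qed.

Lemma invmx_trC n (A : 'M[C]_n) : (invmx A)^t* = invmx (A^t*).
Proof. by rewrite trmx_inv map_invmx. Qed.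

Lemma pdmx_congr m n (A : 'M[C]_(m, n)) (Q : 'M[C]_n) :
  (forall u : 'rV_m, u *m A = 0 -> u = 0) -> pdmx Q ->
  pdmx (A *m Q *m A^t*).
Proof.
move=> injA [hQ pQ]; split; first by rewrite !trCM trmxCK hQ mulmxA.
move=> u u0; rewrite hform_congr; apply: pQ.
by apply: contra_neq u0 => /injA.
Qed.

Lemma pdmx_inv n (A : 'M[C]_n) : pdmx A -> pdmx (invmx A).
Proof.
move=> pA; have uA := pdmx_unit pA.
(* The inverse is a congruence of [A] by its own inverse, so [pdmx_congr] applies. *)
have <- : invmx A *m A *m (invmx A)^t* = invmx A.
  by rewrite invmx_trC pA.1 mulVmx// mul1mx.
apply: pdmx_congr => // u /(congr1 (mulmx^~ A)).
by rewrite mulmxKV// mul0mx.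
Qed.

Lemma pdmx_diag n (d : 'rV[C]_n) : (forall i, 0 < d 0 i) -> pdmx (diag_mx d).
Proof.
move=> d0; split.
  rewrite tr_diag_mx map_diag_mx; congr diag_mx; apply/rowP => i.
  by rewrite mxE/= geC0_conj// ltW.
move=> u u0; rewrite hform_diag lt0r; apply/andP; split; last first.
  by apply: sumr_ge0 => i _; rewrite mulr_ge0 ?exprn_ge0// ltW.
apply: contraNneq u0 => /eqP; rewrite psumr_eq0 => [/allP h|i _]; last first.
  by rewrite mulr_ge0 ?exprn_ge0// ltW.
apply/eqP/rowP => i; have := h i (mem_index_enum _).
by rewrite mulf_eq0 gt_eqF//= expf_eq0/= normr_eq0 mxE => /eqP.
Qed.

(** * Schur complements *)

Section schur.
Context (n1 n2 : nat) (A : 'M[C]_n1) (B : 'M[C]_(n1, n2)) (D : 'M[C]_n2).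
Hypothesis hQ : pdmx (block_mx A B (B^t*) D).

Definition schur_compl := D - B^t* *m invmx A *m B.

Lemma pdmx_block : A^t* = A /\ D^t* = D.
Proof.
have := hQ.1; rewrite tr_block_mx map_block_mx/= => /eq_block_mx[].
by [].
Qed.

Lemma pdmx_ulblock : pdmx A.
Proof.
split; first by have [] := pdmx_block.
move=> u u0; have : row_mx u (0 : 'rV_n2) != 0.
  by apply: contra_neq u0; rewrite -row_mx0 => /eq_row_mx[].
move=> /hQ.2; rewrite /hform mul_row_block tr_row_mx map_col_mx mul_row_col.
by rewrite !mul0mx !addr0 linear0 map_mx0 mulmx0 addr0.
Qed.

Let uA := pdmx_unit pdmx_ulblock.

(** Completing the square in the first block. This is what lets a Gaussian integral be computed one
    block of variables at a time. *)
Lemma schur_form (u1 : 'rV[C]_n1) (u2 : 'rV[C]_n2) :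
  hform (block_mx A B (B^t*) D) (row_mx u1 u2) =
  hform A (u1 + u2 *m B^t* *m invmx A) + hform schur_compl u2.
Proof.
rewrite /hform mul_row_block tr_row_mx map_col_mx mul_row_col.
rewrite /schur_compl !(mulmxDl, mulmxDr, mulNmx, mulmxN) !trCD !trCM.
rewrite invmx_trC pdmx_block.1 trmxCK !mulmxDr !mulmxA !mulmxKV// !mulmxK//.
rewrite !mxE; ring.
Qed.

Lemma schur_pd : pdmx schur_compl.
Proof.
split; first by rewrite /schur_compl trCB !trCM invmx_trC trmxCK pdmx_block.1 pdmx_block.2 mulmxA.
(* The first block is chosen to annihilate the completed square, leaving only the form of the Schur
   complement. *)
move=> u u0; have := hQ.2 (row_mx (- (u *m B^t* *m invmx A)) u).
rewrite schur_form addNr /hform !mul0mx mxE add0r; apply.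
by apply: contra_neq u0; rewrite -row_mx0 => /eq_row_mx[].
Qed.

Lemma schur_det :
  \det (block_mx A B (B^t*) D) = \det A * \det schur_compl.
Proof.
rewrite -(det_ublock A B).
have -> : block_mx A B (B^t*) D = block_mx 1%:M 0 (B^t* *m invmx A) 1%:M *m
    block_mx A B 0 schur_compl.
  rewrite mulmx_block !mul1mx !mul0mx !addr0 mulmxKV//.
  by rewrite /schur_compl addrC subrK.
by rewrite det_mulmx det_lblock !det1 !mul1r.
Qed.

End schur.

End hermitian_forms.

(** * Gaussian integrals over blocks *)

Section tuple_integral.
Context d (T : measurableType d) (R : realType).
Variable mu : {sigma_finite_measure set T -> \bar R}.
Local Open Scope ereal_scope.

Lemma ge0_integral_tuple_prod n (F : n.+1.-tuple T -> \bar R) :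
  measurable_fun [set: n.+1.-tuple T] F -> (forall w, 0 <= F w) ->
  \int[tuple_measure mu n.+1]_w F w =
  \int[mu \x tuple_measure mu n]_x F (cons_pair x).
Proof.
move=> mF F0.
have := @ge0_integral_pushforward _ _ _ _ R (@cons_pair _ T n) (@measurable_cons_pair _ T n)
  (mu \x tuple_measure mu n) setT F measurableT mF (fun x _ => F0 x).
rewrite preimage_setT => <-.
by apply: eq_measure_integral; first exact: measurable_cons_pair.
Qed.

Lemma ge0_integral_tuple n (F : n.+1.-tuple T -> \bar R) :
  measurable_fun [set: n.+1.-tuple T] F -> (forall w, 0 <= F w) ->
  \int[tuple_measure mu n.+1]_w F w =
  \int[mu]_x \int[tuple_measure mu n]_t F (cons_pair (x, t)).
Proof.
move=> mF F0; rewrite ge0_integral_tuple_prod//.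
rewrite (@fubini_tonelli1 _ _ _ _ _ _ _ (fun x => F (cons_pair x)))//.
apply: measurableT_comp => //; exact: measurable_cons_pair.
Qed.

Lemma measurable_cat_tuple d' (X : measurableType d') a b
    (f : X -> a.-tuple T) (g : X -> b.-tuple T) :
  measurable_fun [set: X] f -> measurable_fun [set: X] g ->
  measurable_fun [set: X] (fun x => [tuple of f x ++ g x]).
Proof.
move=> /measurable_fun_tnthP mf /measurable_fun_tnthP mg.
apply/measurable_fun_tnthP => i.
have [j ->|j ->] := split_ordP i.
  by apply: eq_measurable_fun (mf j) => x _ /=; rewrite tnth_lshift.
by apply: eq_measurable_fun (mg j) => x _ /=; rewrite tnth_rshift.
Qed.

(** Tonelli for a concatenation, by peeling off the first coordinate. It will separate the noise
    before time 0 from the noise during transmission. *)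
Lemma ge0_integral_tuple_cat a b (F : (a + b).-tuple T -> \bar R) :
  measurable_fun [set: (a + b).-tuple T] F -> (forall w, 0 <= F w) ->
  \int[tuple_measure mu (a + b)]_w F w =
  \int[tuple_measure mu a]_u \int[tuple_measure mu b]_v F [tuple of u ++ v].
Proof.
elim: a F => [|a IH] F mF F0.
  rewrite [RHS]integral_dirac//=.
    rewrite diracE mem_set// mul1e.
    by apply: eq_integral => w _; congr F; exact/val_inj.
  apply: (@eq_measurable_fun _ _ _ _ _
    (cst (\int[tuple_measure mu b]_v F [tuple of [tuple] ++ v]))) => // x _.
  by rewrite (tuple0 x).
have mcons (x : T) n : measurable_fun [set: n.-tuple T] (fun t => cons_pair (x, t)).
  by apply: (measurable_cons (f := cst x) (g := id)); [exact: measurable_cst|exact: measurable_id].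
have mG : measurable_fun [set: a.+1.-tuple T]
    (fun u => \int[tuple_measure mu b]_v F [tuple of u ++ v]).
  apply: (@measurable_fun_fubini_tonelli_F _ _ _ _ _ (tuple_measure mu b)
    (fun uv : a.+1.-tuple T * b.-tuple T => F [tuple of uv.1 ++ uv.2])) => //.
  by apply: measurableT_comp => //; exact: measurable_cat_tuple.
rewrite [RHS]ge0_integral_tuple//; last by move=> u; exact: integral_ge0.
have mF' : measurable_fun [set: (a + b).+1.-tuple T] F := mF.
rewrite (ge0_integral_tuple mF' F0); apply: eq_integral => x _.
rewrite (IH (fun t => F (cons_pair (x, t)))) => [| |t]; last exact: F0.
  2: exact: (measurableT_comp mF' (mcons x (a + b)%N)).
apply: eq_integral => u _; apply: eq_integral => v _; congr F; exact/val_inj.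
Qed.

End tuple_integral.

(** Phrased through integrals of nonnegative functions rather than measures of sets: in this form
    the property passes from one coordinate to a tuple by Tonelli. *)
Definition shift_invariant d (X : measurableType d) (R : realType)
    (mu : {measure set X -> \bar R}) (s : X -> X) : Prop :=
  measurable_fun [set: X] s /\
  forall F : X -> \bar R, measurable_fun [set: X] F -> (forall x, 0 <= F x)%E ->
  (\int[mu]_x F (s x) = \int[mu]_x F x)%E.

Lemma shift_invariant_tuple d (T : measurableType d) (R : realType)
    (mu : {sigma_finite_measure set T -> \bar R}) n (s : 'I_n -> T -> T) :
  (forall i, shift_invariant mu (s i)) ->
  shift_invariant (tuple_measure mu n)
    (fun w => [tuple s i (tnth w i) | i < n]).
Proof.
elim: n s => [|n IH] s hs; (split; first by
  apply/measurable_fun_tnthP => i; apply: (@eq_measurable_fun _ _ _ _ _ (s i \o @tnth _ T ^~ i));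
  [by move=> x _; rewrite /= tnth_mktuple | apply: measurableT_comp => //; [exact: (hs i).1|exact: measurable_tnth]]) => F mF F0.
  by apply: eq_integral => x _; congr F; rewrite [LHS]tuple0 [RHS]tuple0.
have [mS hS] := IH (fun i => s (lift ord0 i)) (fun i => hs _).
set S := (fun w : n.-tuple T => _) in mS hS.
have sE x t : [tuple s i (tnth (cons_pair (x, t)) i) | i < n.+1] =
    cons_pair (s ord0 x, S t).
  apply: eq_from_tnth => i; rewrite tnth_mktuple.
  have [j ->|->] := unliftP ord0 i; last by [].
  by rewrite /cons_pair !tnthS tnth_mktuple.
have mSS : measurable_fun [set: n.+1.-tuple T]
    (fun w => [tuple s i (tnth w i) | i < n.+1]).
  apply/measurable_fun_tnthP => i.
  apply: (@eq_measurable_fun _ _ _ _ _ (s i \o @tnth _ T ^~ i)).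
    by move=> x _; rewrite /= tnth_mktuple.
  by apply: measurableT_comp => //; [exact: (hs i).1|exact: measurable_tnth].
rewrite (ge0_integral_tuple _ (measurableT_comp mF mSS))//= [RHS]ge0_integral_tuple//.
have mcons (x : T) : measurable_fun [set: n.-tuple T] (fun t => cons_pair (x, t)).
  by apply: (measurable_cons (f := cst x) (g := id)); [exact: measurable_cst|exact: measurable_id].
rewrite -[RHS](hs ord0).2/=; last 2 first.
- apply: (@measurable_fun_fubini_tonelli_F _ _ _ _ _ (tuple_measure mu n)
    (fun xt => F (cons_pair xt))) => //.
  by apply: measurableT_comp => //; exact: measurable_cons_pair.
- by move=> x; exact: integral_ge0.
apply: eq_integral => x _; rewrite -[RHS](hS (fun t => F (cons_pair (s ord0 x, t))))//; last first.
  exact: (measurableT_comp mF (mcons _)).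
by apply: eq_integral => t _; rewrite sE.
Qed.

Lemma shift_invariant_lebesgue (R : realType) (a : R) :
  shift_invariant (@lebesgue_measure R) (fun x : measurableTypeR R => x + a).
Proof.
have ms : measurable_fun [set: measurableTypeR R] (fun x : measurableTypeR R => (x + a)%R : measurableTypeR R).
  by apply: measurable_funD.
split=> // F mF F0.
have := @ge0_integral_pushforward _ _ _ _ R _ ms
  (@lebesgue_measure R) setT F measurableT mF (fun x _ => F0 x).
rewrite preimage_setT => <-.
apply: eq_measure_integral => A mA _.
(* It is enough to compare the image measure with length on half-open intervals. *)
apply/esym/lebesgue_measure_unique => // X [[x y] _ <-].
rewrite /= /pushforward lebesgue_measure_itv/=.
have -> : (fun z : measurableTypeR R => z + a)%R @^-1` [set` `]x, y]] = [set` `]x - a, y - a]].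
  by apply/seteqP; split => z; rewrite /= !in_itv/= ltrBlDr lerBrDr.
rewrite lebesgue_measure_itv/= !lte_fin ltrD2r.
by case: ifPn => // _; rewrite -!EFinD; congr EFin; ring.
Qed.

Section gaussian_bound.
Context (R : realType).
Local Open Scope sesquilinear_scope.
Local Open Scope complex_scope.
Local Notation C := R[i].

Lemma ReD (x y : C) : complex.Re (x + y) = complex.Re x + complex.Re y.
Proof. by case: x y => ? ? []. Qed.

Lemma Re_sum I (r : seq I) (P : pred I) (F : I -> C) :
  complex.Re (\sum_(i <- r | P i) F i) = \sum_(i <- r | P i) complex.Re (F i).
Proof. by apply: (big_morph (@complex.Re R) ReD). Qed.

Definition rvec K (v : 'rV[R]_K) : 'rV[C]_K := map_mx (real_complex R) v.

(** The centre [c] is complex because integrating out one block recentres the other by a complex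
    matrix, even if the data started real. *)
Definition qre K (Q : 'M[C]_K) (c : 'rV[C]_K) (v : 'rV[R]_K) : R :=
  complex.Re (hform Q (rvec v - c)).

Definition measurable_coord d (X : measurableType d) K (phi : X -> 'rV[R]_K) :=
  forall j, measurable_fun [set: X] (fun x => phi x 0 j).

Lemma hformE K (Q : 'M[C]_K) u :
  hform Q u = \sum_j \sum_i u 0 i * Q i j * ((u 0 j)^*)%R.
Proof.
rewrite /hform mxE; apply: eq_bigr => j _; rewrite !mxE mulr_suml.
by apply: eq_bigr.
Qed.

Lemma measurable_qre d (X : measurableType d) K (Q : 'M[C]_K) c
    (phi : X -> 'rV[R]_K) : measurable_coord phi ->
  measurable_fun [set: X] (fun x => qre Q c (phi x)).
Proof.
move=> mphi; rewrite /qre.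
under eq_fun do rewrite hformE Re_sum.
apply: measurable_sum => j; under eq_fun do rewrite Re_sum.
apply: measurable_sum => i; under eq_fun do rewrite !mxE.
case: (c 0 i) (c 0 j) (Q i j) => [a a'] [b b'] [q q'] /=.
have mi := mphi i; have mj := mphi j.
by do ![apply: measurable_funB => //|apply: measurable_funM => //|apply: measurable_funD => //|apply: measurableT_comp => //].
Qed.

(** Only an inequality can be expected: on real vectors the quadratic part is that of Re Q, whose
    determinant is at least det Q, and a complex centre leaves a nonnegative minimum of the form. *)
Definition gauss_bound d (X : measurableType d) (mu : {measure set X -> \bar R})
    K (phi : X -> 'rV[R]_K) : Prop :=
  measurable_coord phi /\
  forall (Q : 'M[C]_K) (c : 'rV[C]_K), pdmx Q ->
  (\int[mu]_x (expR (- (2^-1 * qre Q c (phi x))))%:E <=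
   (Num.sqrt ((2 * pi) ^+ K / complex.Re (\det Q)))%:E)%E.

Lemma gauss_bound_dirac d (X : measurableType d) (x0 : X) (phi : X -> 'rV[R]_0) :
  gauss_bound \d_x0 phi.
Proof.
split=> [|Q c pQ]; first by case.
rewrite integral_dirac//=; last first.
  apply/measurable_EFinP; apply: measurableT_comp => //.
  apply: measurableT_comp => //; apply: measurable_funM => //.
  by apply: measurable_qre; case.
rewrite diracE mem_set// mul1e lee_fin expr0 det_mx00 divr1 sqrtr1.
rewrite /qre (_ : hform _ _ = 0) ?mulr0 ?oppr0 ?expR0//.
by rewrite /hform mxE big_ord0.
Qed.

Lemma gauss_bound_lebesgue : gauss_bound (@lebesgue_measure R)
  (fun x : measurableTypeR R => x%:M : 'rV[R]_1).
Proof.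
split=> [j|Q c pQ].
  by apply: (@eq_measurable_fun _ _ _ _ _ id) => // x _; rewrite !ord1 mxE.
have [q q0 QE] : exists2 q : R, 0 < q & Q = (q%:C)%:M.
  have := pQ.2 1%:M; rewrite /hform mul1mx trmx1 map_mx1 mulmx1.
  have /[swap]/[apply] : (1%:M : 'rV[C]_1) != 0.
    by apply/eqP => /matrixP/(_ 0 0); rewrite !mxE; exact/eqP/oner_neq0.
  rewrite ltcE/= => /andP[/eqP h1 h2]; exists (complex.Re (Q 0 0)) => //.
  apply/matrixP => i j; rewrite !ord1 mxE eqxx mulr1n.
  by case: (Q 0 0) h1 => a b /= ->.
set c1 := complex.Re (c 0 0).
(* With standard deviation [s] and mean Re c the exponent of the normal density is half of q (x - Re
   c)^2. *)
pose s := (Num.sqrt q)^-1.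
have s0 : s != 0 by rewrite invr_eq0 gt_eqF// sqrtr_gt0.
have s2 : s ^+ 2 = q^-1 by rewrite exprVn sqr_sqrtr// ltW.
have mf : measurable_fun [set: measurableTypeR R] (fun x => (normal_fun c1 s x)%:E).
  by apply/measurable_EFinP; exact: measurable_normal_fun.
(* The imaginary part b of the centre adds q b^2, which only lowers the integrand. *)
have qE (x : R) : q * (x - c1) ^+ 2 <= qre Q c x%:M.
  rewrite /qre QE /hform mul_mx_scalar -scalemxAl !mxE big_ord1 !mxE eqxx mulr1n.
  rewrite /c1; case: (c 0 0) => a b /=.
  rewrite !(mul0r, sub0r, subr0, addr0) /=.
  by rewrite ler_pM2l//; nra.
apply: (@le_trans _ _ (\int[lebesgue_measure]_x (normal_fun c1 s x)%:E)%E).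
  apply: ge0_le_integral => //.
  - apply/measurable_EFinP; apply: measurableT_comp => //.
    apply: measurableT_comp => //; apply: measurable_funM => //.
    apply: measurable_qre => j.
    by apply: (@eq_measurable_fun _ _ _ _ _ id) => // x _; rewrite !ord1 mxE.
  move=> x _; rewrite lee_fin ler_expR mulNr lerN2 s2 -mulr_natr invfM invrK.
  have -> : (x - c1) ^+ 2 * (q * 2^-1) = 2^-1 * (q * (x - c1) ^+ 2) by ring.
  by rewrite ler_pM2l ?qE.
have p0 := normal_peak_gt0 s0.
have := integral_normal_pdf c1 s; rewrite normal_pdfE//.
under eq_integral do rewrite EFinM.
rewrite ge0_integralZl//; last 2 first.
- by move=> x _; rewrite lee_fin normal_fun_ge0.
- by rewrite lee_fin ltW.
rewrite QE det_scalar1 /= => h.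
have -> : Num.sqrt ((2 * pi) ^+ 1 / q) = (normal_peak s)^-1 :> R.
  rewrite /normal_peak invrK expr1 s2; congr Num.sqrt.
  by rewrite -mulr_natr; ring.
rewrite le_eqVlt; apply/orP; left; apply/eqP.
have := congr1 (mule (normal_peak s)^-1%:E) h.
by rewrite muleA -EFinM mulVf ?gt_eqF// mul1e mule1.
Qed.

(** With the second block fixed, the first is a Gaussian integral with matrix [A] and a displaced
    centre, whose bound does not depend on that centre. What remains is a Gaussian in the second
    block with the Schur complement, and determinants multiply by [schur_det]. *)
Lemma gauss_bound_prod d1 d2 (X1 : measurableType d1) (X2 : measurableType d2)
    (mu1 : {sigma_finite_measure set X1 -> \bar R})
    (mu2 : {sigma_finite_measure set X2 -> \bar R}) K1 K2
    (phi1 : X1 -> 'rV[R]_K1) (phi2 : X2 -> 'rV[R]_K2) :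
  gauss_bound mu1 phi1 -> gauss_bound mu2 phi2 ->
  gauss_bound (mu1 \x mu2)%E (fun x => row_mx (phi1 x.1) (phi2 x.2)).
Proof.
move=> [m1 g1] [m2 g2].
have mphi : measurable_coord (fun x : X1 * X2 => row_mx (phi1 x.1) (phi2 x.2)).
  move=> j; have [i ->|i ->] := split_ordP j.
    apply: (@eq_measurable_fun _ _ _ _ _ ((fun x => phi1 x 0 i) \o fst)) => [x _|].
      by rewrite /= row_mxEl.
    exact: measurableT_comp.
  apply: (@eq_measurable_fun _ _ _ _ _ ((fun x => phi2 x 0 i) \o snd)) => [x _|].
    by rewrite /= row_mxEr.
  exact: measurableT_comp.
split=> // Q c pQ.
have mexp dd (Y : measurableType dd) k (f : Y -> 'rV[R]_k) q a : measurable_coord f ->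
    measurable_fun [set: Y] (fun x => (expR (- (2^-1 * qre q a (f x))))%:E).
  move=> mf; apply/measurable_EFinP; apply: measurableT_comp => //.
  apply: measurableT_comp => //; apply: measurable_funM => //.
  exact: measurable_qre.
rewrite fubini_tonelli2//; last exact: (mexp _ _ _ _ Q c mphi).
rewrite /fubini_G /=.
pose A := ulsubmx Q; pose B := ursubmx Q; pose D := drsubmx Q.
have QE : Q = block_mx A B (B^t*) D.
  rewrite -[LHS]submxK; congr block_mx.
  by rewrite -[in LHS]pQ.1 -(submxK Q) tr_block_mx map_block_mx block_mxKdl.
have pB : pdmx (block_mx A B (B^t*) D) by rewrite -QE.
have pA := pdmx_ulblock pB; have pS := schur_pd pB.
set S := schur_compl A B D in pS.
pose c1 := lsubmx c; pose c2 := rsubmx c.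
(* The point where the completed square of [schur_form] vanishes, as a function of the second
   block. *)
pose cc y := c1 - (rvec (phi2 y) - c2) *m B^t* *m invmx A.
have qE x y : qre Q c (row_mx (phi1 x) (phi2 y)) =
    qre A (cc y) (phi1 x) + qre S c2 (phi2 y).
  rewrite /qre QE /rvec map_row_mx -(hsubmxK c) -/c1 -/c2 opp_row_mx add_row_mx.
  rewrite (schur_form pB) ReD; congr (complex.Re (hform _ _) + _).
  by rewrite /cc opprB [RHS]addrA addrAC.
have detE : complex.Re (\det Q) = complex.Re (\det A) * complex.Re (\det S).
  rewrite QE (schur_det pB).
  have := pdmx_det_gt0 pA; have := pdmx_det_gt0 pS.
  case: (\det A) => a a'; case: (\det _) => b b'.
  by rewrite !ltcE /= => /andP[/eqP -> _] /andP[/eqP -> _]; rewrite mulr0 subr0.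
have d0 K' (M : 'M[C]_K') : pdmx M -> 0 < complex.Re (\det M).
  by move/pdmx_det_gt0; rewrite ltcE => /andP[].
have sqrtE : Num.sqrt ((2 * pi) ^+ (K1 + K2) / complex.Re (\det Q)) =
    Num.sqrt ((2 * pi) ^+ K1 / complex.Re (\det A)) *
    Num.sqrt ((2 * pi) ^+ K2 / complex.Re (\det S)) :> R.
  rewrite -sqrtrM; last by rewrite divr_ge0 ?exprn_ge0 ?mulr_ge0 ?pi_ge0// ltW// d0.
  by rewrite detE exprD invfM mulrACA.
apply: (@le_trans _ _ (\int[mu2]_y
    ((Num.sqrt ((2 * pi) ^+ K1 / complex.Re (\det A)))%:E *
     (expR (- (2^-1 * qre S c2 (phi2 y))))%:E))%E).
  apply: ge0_le_integral => //.
  - by move=> y _; apply: integral_ge0 => x _; rewrite lee_fin expR_ge0.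
  - apply: (@measurable_fun_fubini_tonelli_G _ _ _ _ _ mu1
      (fun xy => (expR (- (2^-1 * qre Q c (row_mx (phi1 xy.1) (phi2 xy.2)))))%:E)).
      exact: (mexp _ _ _ _ Q c mphi).
    by move=> x; rewrite lee_fin expR_ge0.
  - by apply: emeasurable_funM => //; exact: mexp.
  move=> y _.
  under eq_integral => x _.
    rewrite qE mulrDr opprD expRD EFinM; over.
  rewrite ge0_integralZr//; last exact: mexp.
  by rewrite lee_wpmul2r ?lee_fin ?expR_ge0// g1.
rewrite ge0_integralZl//; last exact: mexp.
by rewrite sqrtE EFinM lee_wpmul2l// ?lee_fin// g2.
Qed.

Lemma gauss_bound_tuple d (X : measurableType d)
    (mu : {sigma_finite_measure set X -> \bar R}) K (phi : X -> 'rV[R]_K)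
    (Phi : forall n, n.-tuple X -> 'rV[R]_(n * K)) :
  (forall n x t, Phi n.+1 (cons_pair (x, t)) = row_mx (phi x) (Phi n t)) ->
  gauss_bound mu phi -> forall n, gauss_bound (tuple_measure mu n) (Phi n).
Proof.
move=> PhiS g; elim => [|n IH]; first exact: gauss_bound_dirac.
have [mP gP] := gauss_bound_prod g IH.
pose uncons (w : n.+1.-tuple X) := (thead w, [tuple of behead w]).
have mPhi : measurable_coord (Phi n.+1).
  move=> j; have mt : measurable_fun [set: n.+1.-tuple X] uncons.
    apply/measurable_fun_pairP; split; last exact: measurable_behead.
    exact: (@measurable_tnth _ X n.+1 ord0).
  apply: (@eq_measurable_fun _ _ _ _ _
    ((fun x => row_mx (phi x.1) (Phi n x.2) 0 j) \o uncons)).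
    by move=> w _ /=; rewrite -PhiS; congr (Phi _ _ _ _); apply/val_inj; case/tupleP: w.
  exact: (measurableT_comp (mP j) mt).
split=> // Q c pQ.
rewrite ge0_integral_tuple_prod//; last first.
  apply/measurable_EFinP; apply: measurableT_comp => //.
  apply: measurableT_comp => //; apply: measurable_funM => //.
  exact: measurable_qre.
apply: le_trans (gP Q c pQ); rewrite le_eqVlt; apply/orP; left; apply/eqP.
by apply: eq_integral => -[x t] _; rewrite PhiS.
Qed.

End gaussian_bound.

(** * Flattening a block of N vectors into one row, time index first *)

Section block_index.
Context (N n : nat).

Fact block_of_subproof (p : 'I_(N * n)) : (p %/ n < N)%N.
Proof.
case: n p => [|k] [p hp] /=; first by rewrite muln0 in hp.
by rewrite ltn_divLR.
Qed.

Fact offset_of_subproof (p : 'I_(N * n)) : (p %% n < n)%N.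
Proof.
case: n p => [|k] [p hp] /=; first by rewrite muln0 in hp.
by rewrite ltn_mod.
Qed.

Fact flat_index_subproof (i : 'I_N) (r : 'I_n) : (i * n + r < N * n)%N.
Proof.
apply: (@leq_trans (i.+1 * n)); first by rewrite mulSn addnC ltn_add2r.
by rewrite leq_mul2r ltn_ord orbT.
Qed.

Definition block_of (p : 'I_(N * n)) : 'I_N := Ordinal (block_of_subproof p).
Definition offset_of (p : 'I_(N * n)) : 'I_n := Ordinal (offset_of_subproof p).
Definition flat_index (i : 'I_N) (r : 'I_n) : 'I_(N * n) :=
  Ordinal (flat_index_subproof i r).

Lemma block_of_flat i r : block_of (flat_index i r) = i.
Proof.
apply/val_inj; rewrite /= divnMDl ?divn_small ?addn0//.
exact: leq_ltn_trans (ltn_ord r).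
Qed.

Lemma offset_of_flat i r : offset_of (flat_index i r) = r.
Proof. by apply/val_inj => /=; rewrite modnMDl modn_small. Qed.

Lemma flat_indexK p : flat_index (block_of p) (offset_of p) = p.
Proof. by apply/val_inj => /=; rewrite -divn_eq. Qed.

Lemma big_flat (T : Type) (idx : T) (op : Monoid.com_law idx)
    (F : 'I_(N * n) -> T) :
  \big[op/idx]_p F p = \big[op/idx]_i \big[op/idx]_r F (flat_index i r).
Proof.
rewrite pair_big /= (reindex (fun q => flat_index q.1 q.2))//.
exists (fun p => (block_of p, offset_of p)) => [[i r]|p] _ /=.
  by rewrite block_of_flat offset_of_flat.
exact: flat_indexK.
Qed.

End block_index.

Arguments block_of : simpl never.
Arguments offset_of : simpl never.
Arguments flat_index : simpl never.

Section block_gaussian.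
Context (R : realType).

Lemma gauss_bound_cast d (X : measurableType d) (mu : {measure set X -> \bar R})
    K K' (e : K = K') (phi : X -> 'rV[R]_K) :
  gauss_bound mu phi -> gauss_bound mu (fun x => castmx (erefl, e) (phi x)).
Proof.
case: K' / e => g.
by rewrite (_ : (fun x => _) = phi)//; apply/funext => x; rewrite castmx_id.
Qed.

Definition vrow n (t : vec R n) : 'rV[R]_n := \row_i tnth t i.

Definition brow n k (w : block R n k) : 'rV[R]_(k * n) :=
  \row_p tnth (tnth w (block_of p)) (offset_of p).

Lemma gauss_bound_vec n :
  gauss_bound (tuple_measure (@lebesgue_measure R) n) (@vrow n).
Proof.
(* The tuple step produces rows of length [n * 1]; the cast to [n] is done once at the end. *)
pose Phi n (t : vec R n) : 'rV[R]_(n * 1) :=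
  \row_p tnth t (cast_ord (muln1 n) p).
have g : gauss_bound (tuple_measure (@lebesgue_measure R) n) (@Phi n).
  apply: (gauss_bound_tuple _ (gauss_bound_lebesgue R)) => k x t.
  apply/rowP => p; rewrite [LHS]mxE.
  have [j -> |j ->] := @split_ordP 1 (k * 1) p.
    by apply: etrans (esym (row_mxEl _ (Phi k t) 0 j)); rewrite !ord1 mxE eqxx mulr1n.
  apply: etrans (esym (row_mxEr _ (Phi k t) 0 j)); rewrite mxE.
  have -> : cast_ord (muln1 k.+1) (rshift 1 j) = lift ord0 (cast_ord (muln1 k) j).
    exact/val_inj.
  by rewrite tnthS.
have := gauss_bound_cast (muln1 n) g; congr gauss_bound.
by apply/funext => t; apply/rowP => j; rewrite castmxE !mxE/= cast_ordKV.
Qed.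

Lemma gauss_bound_block n k : gauss_bound (leb_block R n k) (@brow n k).
Proof.
apply: (gauss_bound_tuple _ (gauss_bound_vec n)) => l x t.
apply/rowP => p; rewrite mxE.
have [j -> |j ->] := @split_ordP n (l * n) p.
  rewrite row_mxEl mxE; set b := block_of _; set o := offset_of _.
  have -> : o = j by apply/val_inj; rewrite /= modn_small.
  by have -> : b = ord0 by apply/val_inj; rewrite /= divn_small.
rewrite row_mxEr mxE.
have n0 : (0 < n)%N by case: (n) j => // -[j hj]; exfalso; rewrite muln0 in hj.
have -> : block_of (rshift n j : 'I_(l.+1 * n)) = lift ord0 (block_of j).
  by apply/val_inj; rewrite /= divnDl// divnn n0.
have -> : offset_of (rshift n j : 'I_(l.+1 * n)) = offset_of j.
  by apply/val_inj; rewrite /= modnDl.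
by rewrite tnthS.
Qed.

Lemma ge0_integral_block_cat n a b (F : block R n (a + b) -> \bar R) :
  measurable_fun [set: block R n (a + b)] F -> (forall w, 0 <= F w)%E ->
  (\int[leb_block R n (a + b)]_w F w =
   \int[leb_block R n a]_u \int[leb_block R n b]_v F [tuple of u ++ v])%E.
Proof. exact: ge0_integral_tuple_cat. Qed.

Definition bshift n k (a : 'I_k -> 'I_n -> R) (w : block R n k) : block R n k :=
  [tuple [tuple tnth (tnth w i) r + a i r | r < n] | i < k].

Lemma shift_invariant_block n k (a : 'I_k -> 'I_n -> R) :
  shift_invariant (leb_block R n k) (bshift a).
Proof.
apply: (@shift_invariant_tuple _ _ _ (tuple_measure lebesgue_measure n) k
  (fun i v => [tuple tnth v r + a i r | r < n])) => i.
apply: (@shift_invariant_tuple _ _ _ lebesgue_measure n (fun r x => x + a i r)) => r.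
exact: shift_invariant_lebesgue.
Qed.

Lemma brow_bshift n k (a : 'I_k -> 'I_n -> R) (w : block R n k) :
  brow (bshift a w) = brow w + \row_p a (block_of p) (offset_of p).
Proof. by apply/rowP => p; rewrite !mxE !tnth_mktuple. Qed.

End block_gaussian.

Lemma integral_indicM d (X : measurableType d) (R : realType)
    (mu : {measure set X -> \bar R}) (A : set X) (g : X -> \bar R) :
  (\int[mu]_(x in A) g x = \int[mu]_x (g x * (\1_A x)%:E))%E.
Proof.
rewrite integral_mkcond; apply: eq_integral => x _.
by rewrite patchE indicE; case: ifPn => _; rewrite ?mule1 ?mule0.
Qed.

(** * The law of the noise *)

Section density.
Context d (X : measurableType d) (R : realType).
Context (mu nu : {measure set X -> \bar R}) (f : X -> R).
Hypothesis mf : measurable_fun [set: X] f.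
Hypothesis f0 : forall x, 0 <= f x.
Hypothesis nuE : forall A, measurable A -> nu A = (\int[mu]_(x in A) (f x)%:E)%E.
Local Open Scope ereal_scope.
Import HBNNSimple.

(** For indicators this is [nuE]; simple functions follow by linearity, and the general case by
    monotone convergence under both measures along the same approximating sequence. *)
Lemma ge0_integral_density (g : X -> \bar R) :
  measurable_fun [set: X] g -> (forall x, 0 <= g x) ->
  \int[nu]_x g x = \int[mu]_x (g x * (f x)%:E).
Proof.
move=> mg g0; pose h := nnsfun_approx measurableT mg.
have hg x : limn (fun n => (h n x)%:E) = g x.
  by apply/cvg_lim => //; apply: cvg_nnsfun_approx => // y _; exact: g0.
have mEf : measurable_fun [set: X] (fun x => (f x)%:E) by exact/measurable_EFinP.
have Ef0 x : 0 <= (f x)%:E by rewrite lee_fin.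
transitivity (limn (fun n => \int[nu]_x (h n x)%:E)).
  rewrite -monotone_convergence//.
  - by apply: eq_integral => x _; rewrite hg.
  - by move=> n; exact/measurable_EFinP.
  - by move=> n x _; rewrite lee_fin.
  - by move=> x _ a b ab; rewrite lee_fin; exact/lefP/nd_nnsfun_approx.
transitivity (limn (fun n => \int[mu]_x ((h n x)%:E * (f x)%:E))); last first.
  rewrite -monotone_convergence//.
  - apply: eq_integral => x _.
    under eq_fun do rewrite muleC.
    rewrite limeMl ?hg//; first exact: muleC.
    by apply: cvg_nnsfun_approx => // y _; exact: g0.
  - by move=> n; apply: emeasurable_funM => //; exact/measurable_EFinP.
  - by move=> n x _; rewrite mule_ge0// lee_fin.
  - move=> x _ a b ab; apply: lee_wpmul2r => //.
    by rewrite lee_fin; exact/lefP/nd_nnsfun_approx.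
congr (limn _); apply/funext => n.
under eq_integral do rewrite fimfunE -fsumEFin//.
rewrite ge0_integral_fsum//; last 2 first.
  - by move=> y; exact/measurable_EFinP/measurable_funM.
  - by move=> y x _; rewrite nnfun_muleindic_ge0.
transitivity (\sum_(k \in range (h n))
    \int[mu]_x ((k * \1_(h n @^-1` [set k]) x)%:E * (f x)%:E)).
  apply: eq_fsbigr => k /[!inE] -[x0 _ hk].
  have k0 : (0 <= k)%R by rewrite -hk.
  rewrite integralZl_indic_nnsfun// integral_indic//= setIT nuE//.
  under [RHS]eq_integral do rewrite EFinM -muleA (muleC (\1_ _ _)%:E).
  rewrite [RHS]ge0_integralZl//.
  - by rewrite -integral_indicM.
  - by apply: emeasurable_funM => //; exact/measurable_EFinP.
  - by move=> x _; rewrite mule_ge0// lee_fin.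
rewrite -ge0_integral_fsum//.
- apply: eq_integral => x _.
  rewrite fimfunE -fsumEFin// ge0_mule_fsuml// => k.
  by rewrite nnfun_muleindic_ge0.
- move=> k; apply: emeasurable_funM => //.
  exact/measurable_EFinP/measurable_funM.
- by move=> k x _; rewrite mule_ge0// nnfun_muleindic_ge0.
Qed.

Lemma integrable_density (g : X -> R) : measurable_fun [set: X] g ->
  nu.-integrable [set: X] (EFin \o g) <->
  mu.-integrable [set: X] (fun x => (f x * g x)%:E).
Proof.
move=> mg.
have E : \int[nu]_x `|(g x)%:E| = \int[mu]_x `|(f x * g x)%:E|.
  rewrite ge0_integral_density//; last first.
    by apply: measurableT_comp => //; exact/measurable_EFinP.
  apply: eq_integral => x _.
  by rewrite /= -EFinM normrM (ger0_norm (f0 x)) mulrC.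
split=> /integrableP[m1 lt]; apply/integrableP; split.
- by apply/measurable_EFinP; exact: measurable_funM.
- by rewrite -E.
- exact/measurable_EFinP.
- by rewrite E.
Qed.

Lemma integral_density (g : X -> R) : measurable_fun [set: X] g ->
  nu.-integrable [set: X] (EFin \o g) ->
  \int[nu]_x (g x)%:E = \int[mu]_x (f x * g x)%:E.
Proof.
move=> mg ig; have mEg : measurable_fun [set: X] (EFin \o g).
  exact/measurable_EFinP.
have ifg := (integrable_density mg).1 ig.
rewrite integralE [RHS]integralE; congr (_ - _).
  rewrite ge0_integral_density//; last exact: measurable_funepos.
  apply: eq_integral => x _; rewrite !funeposE /= -!EFin_max -EFinM.
  by congr EFin; rewrite mulrC maxr_pMr// mulr0.
rewrite ge0_integral_density//; last exact: measurable_funeneg.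
apply: eq_integral => x _; rewrite !funenegE /= -!EFin_max -EFinM.
by congr EFin; rewrite mulrC maxr_pMr// mulr0 mulrN.
Qed.

End density.

Section independence.
Context d (T : measurableType d) (R : realType) (P : probability T R).
Local Open Scope ereal_scope.

(** Independence identifies the joint law with the product of the marginals, by uniqueness of the
    product measure. Fubini then integrates over Y first, which gives x times the mean of Y. *)
Lemma integral_indep_mul0 (X Y : {RV P >-> measurableTypeR R}) :
  (forall A B, measurable A -> measurable B ->
    P ((X @^-1` A) `&` (Y @^-1` B)) = P (X @^-1` A) * P (Y @^-1` B)) ->
  P.-integrable setT (fun t => (Y t)%:E) ->
  P.-integrable setT (fun t => (X t * Y t)%:E) ->
  \int[P]_t (Y t)%:E = 0 ->
  \int[P]_t (X t * Y t)%:E = 0.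
Proof.
move=> ind iY iXY EY0.
have mXY : measurable_fun [set: T] (fun t => (X t, Y t)).
  by apply/measurable_fun_pairP; split; exact: measurable_funPT.
pose XY : {RV P >-> (measurableTypeR R * measurableTypeR R)%type} :=
  HB.pack (fun t => (X t, Y t)) (isMeasurableFun.Build _ _ _ _ _ mXY).
have mmul : measurable_fun [set: measurableTypeR R * measurableTypeR R]
    (fun z : measurableTypeR R * measurableTypeR R => (z.1 * z.2)%:E).
  by apply/measurable_EFinP; apply: measurable_funM.
have mid : measurable_fun [set: measurableTypeR R] (fun y : measurableTypeR R => y%:E).
  exact/measurable_EFinP.
pose m1 := distribution P X; pose m2 := distribution P Y.
have lawE (h : measurableTypeR R * measurableTypeR R -> \bar R) :
    \int[m1 \x m2]_z h z = \int[distribution P XY]_z h z.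
  by apply: eq_measure_integral => Z mZ _; apply: product_measure_unique.
have h1 := integral_distribution (X := XY) mmul iXY.
rewrite -[LHS]h1 -lawE -integral12_prod_meas1; last first.
  apply/integrableP; split => //.
  rewrite lawE (ge0_integral_distribution XY)//; last exact: measurableT_comp.
  by move/integrableP: iXY => [].
apply: integral0_eq => x _ /=.
rewrite /fubini_F; under eq_integral do rewrite EFinM.
rewrite integralZl//; last first.
  apply/integrableP; split => //.
  rewrite (ge0_integral_distribution Y)//; last exact: measurableT_comp.
  by move/integrableP: iY => [].
have h2 := integral_distribution (X := Y) mid iY.
by rewrite [X in _ * X]h2 EY0 mule0.
Qed.


End independence.

Section noise_law.
Context d (Omega : measurableType d) (R : realType) (P : probability Omega R).
Context (n : nat) (W : int -> {RV P >-> vec R n}).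

Lemma measurable_noise_block a k : measurable_fun setT (noise_block W a k).
Proof.
apply/measurable_fun_tnthP => i.
apply: (@eq_measurable_fun _ _ _ _ _ (W (a + i%:Z))) => [t _|].
  by rewrite /= tnth_mktuple.
exact: measurable_funPT.
Qed.

HB.instance Definition _ a k := isMeasurableFun.Build _ _ _ _ (noise_block W a k)
  (@measurable_noise_block a k).

Lemma measurable_noise_coord i r : measurable_fun setT (noise_coord W i r).
Proof.
apply: (measurableT_comp (@measurable_tnth _ (measurableTypeR R) n r)).
exact: measurable_funPT.
Qed.

HB.instance Definition _ i r := isMeasurableFun.Build _ _ _ _
  (noise_coord W i r : Omega -> measurableTypeR R) (@measurable_noise_coord i r).

Context (m : nat) (f : forall k, block R n k -> R).
Hypothesis hW : noise_process W m f.

Local Open Scope ereal_scope.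

Lemma integral_noise_stationary a b k (g : block R n k -> R) :
  measurable_fun setT g ->
  P.-integrable setT (fun t => (g (noise_block W a k t))%:E) ->
  P.-integrable setT (fun t => (g (noise_block W b k t))%:E) /\
  \int[P]_t (g (noise_block W a k t))%:E = \int[P]_t (g (noise_block W b k t))%:E.
Proof.
move=> mg ia.
have mEg : measurable_fun setT (EFin \o g) by exact/measurable_EFinP.
have E (h : block R n k -> \bar R) : \int[distribution P (noise_block W a k)]_w h w =
    \int[distribution P (noise_block W b k)]_w h w.
  by apply: eq_measure_integral => A mA _; exact: (noise_stationary hW).
have ib : P.-integrable setT (fun t => (g (noise_block W b k t))%:E).
  move/integrableP: ia => [_ lt]; apply/integrableP; split.
    apply/measurable_EFinP; apply: (measurableT_comp mg).
    exact: measurable_noise_block.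
  have mabs : measurable_fun setT (fun w => `|(g w)%:E|).
    exact: measurableT_comp.
  rewrite -(ge0_integral_distribution (noise_block W b k) mabs) // -E.
  by rewrite ge0_integral_distribution.
split=> //.
rewrite -(integral_distribution (X := noise_block W a k) mEg ia) E.
by rewrite integral_distribution.
Qed.

(** With [integral_noise], the dictionary between expectations under [P] and Lebesgue integrals
    against [f], passing through the law of the block at time 0. *)
Lemma noise_integrableP k (g : block R n k -> R) : measurable_fun setT g ->
  P.-integrable setT (fun t => (g (noise_block W 0 k t))%:E) <->
  (leb_block R n k).-integrable setT (fun w => (f w * g w)%:E).
Proof.
move=> mg.
have mEg : measurable_fun setT (EFin \o g) by exact/measurable_EFinP.
rewrite -(@integrable_density _ _ _ (leb_block R n k)
  (distribution P (noise_block W 0 k)) (@f k) (noise_pdf_measurable hW (k := k))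
  (noise_pdf_ge0 hW (k := k)) (noise_pdfE hW (k := k)))//.
have mabs : measurable_fun setT (fun w => `|(g w)%:E|).
  exact: measurableT_comp.
have E := ge0_integral_distribution (noise_block W 0 k) mabs (fun=> abse_ge0 _).
split=> /integrableP[m1 lt]; apply/integrableP; split => //.
- by rewrite [X in X < _]E.
- apply/measurable_EFinP; apply: (measurableT_comp mg).
  exact: measurable_noise_block.
- by rewrite -[X in X < _]E.
Qed.

Lemma integral_noise k (g : block R n k -> R) : measurable_fun setT g ->
  P.-integrable setT (fun t => (g (noise_block W 0 k t))%:E) ->
  \int[leb_block R n k]_w (f w * g w)%:E = \int[P]_t (g (noise_block W 0 k t))%:E.
Proof.
move=> mg ig.
have mEg : measurable_fun setT (EFin \o g) by exact/measurable_EFinP.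
rewrite -(integral_distribution (X := noise_block W 0 k) mEg ig).
rewrite (@integral_density _ _ _ (leb_block R n k)
  (distribution P (noise_block W 0 k)) (@f k) (noise_pdf_measurable hW (k := k))
  (noise_pdf_ge0 hW (k := k)) (noise_pdfE hW (k := k)))//.
exact: (@integrable_density _ _ _ (leb_block R n k)
  (distribution P (noise_block W 0 k)) (@f k) (noise_pdf_measurable hW (k := k))
  (noise_pdf_ge0 hW (k := k)) (noise_pdfE hW (k := k)) g mg).2
  ((noise_integrableP mg).1 ig).
Qed.

Lemma integrable_noise_coord2 i r :
  P.-integrable setT (fun t => (noise_coord W i r t ^+ 2)%:E).
Proof.
apply/integrableP; split.
  by apply/measurable_EFinP; apply: measurable_funX; exact: measurable_noise_coord.
have := noise_moment2 hW i r; rewrite unlock; congr (_ < _).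
by apply: eq_integral => t _; rewrite /= ger0_norm// sqr_ge0.
Qed.

Lemma integrable_noise_coord i r :
  P.-integrable setT (fun t => (noise_coord W i r t)%:E).
Proof.
have i2 : P.-integrable setT (fun t => (1 + noise_coord W i r t ^+ 2)%:E).
  apply: (@eq_integrable _ _ _ _ _ measurableT
    (fun t => 1%:E + (noise_coord W i r t ^+ 2)%:E)) => //.
  by apply: integrableD => //; [exact: finite_measure_integrable_cst|exact: integrable_noise_coord2].
apply: le_integrable i2 => //.
  by apply/measurable_EFinP; exact: measurable_noise_coord.
move=> t _; rewrite lee_fin /=; set x := noise_coord _ _ _ _.
rewrite [leRHS]ger0_norm ?addr_ge0 ?sqr_ge0//.
by rewrite ler_norml; apply/andP; split; nra.
Qed.

Lemma integrable_noise_coordM i j r s :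
  P.-integrable setT (fun t => (noise_coord W i r t * noise_coord W j s t)%:E).
Proof.
have i2 : P.-integrable setT
    (fun t => (noise_coord W i r t ^+ 2 + noise_coord W j s t ^+ 2)%:E).
  apply: (@eq_integrable _ _ _ _ _ measurableT
    (fun t => (noise_coord W i r t ^+ 2)%:E + (noise_coord W j s t ^+ 2)%:E)) => //.
  by apply: integrableD => //; exact: integrable_noise_coord2.
apply: le_integrable i2 => //.
  by apply/measurable_EFinP; apply: measurable_funM; exact: measurable_noise_coord.
move=> t _; rewrite lee_fin /=; set x := noise_coord _ _ _ _; set y := noise_coord _ _ _ _.
rewrite [leRHS]ger0_norm ?addr_ge0 ?sqr_ge0//.
by rewrite ler_norml; apply/andP; split; nra.
Qed.

Lemma noise_cov_shift a b (p q : nat) r s :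
  \int[P]_t (noise_coord W (a + p%:Z) r t * noise_coord W (a + q%:Z) s t)%:E =
  \int[P]_t (noise_coord W (b + p%:Z) r t * noise_coord W (b + q%:Z) s t)%:E.
Proof.
(* A block of p + q + 1 samples contains both offsets whichever is larger, so stationarity of that
   one block is enough. *)
have hp : (p < (p + q).+1)%N by lia.
have hq : (q < (p + q).+1)%N by lia.
pose g (w : block R n (p + q).+1) : R :=
  (tnth (tnth w (Ordinal hp)) r * tnth (tnth w (Ordinal hq)) s)%R.
have mg : measurable_fun setT g.
  apply: measurable_funM.
    exact: (measurableT_comp (@measurable_tnth _ (measurableTypeR R) n r) (@measurable_tnth _ (vec R n) _ _)).
  exact: (measurableT_comp (@measurable_tnth _ (measurableTypeR R) n s) (@measurable_tnth _ (vec R n) _ _)).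
have gE c t : g (noise_block W c _ t) =
    (noise_coord W (c + p%:Z) r t * noise_coord W (c + q%:Z) s t)%R.
  by rewrite /g !tnth_mktuple.
have ia : P.-integrable setT (fun t => (g (noise_block W a _ t))%:E).
  under eq_fun do rewrite gE; exact: integrable_noise_coordM.
have [_] := integral_noise_stationary b mg ia.
by under eq_integral do rewrite gE; under [RHS]eq_integral do rewrite gE.
Qed.

Lemma noise_covE i j r s :
  \int[P]_t (noise_coord W i r t * noise_coord W j s t)%:E =
  (autocorr W (i - j) r s)%:E.
Proof.
rewrite mxE fineK; last first.
  rewrite unlock; apply: integrable_fin_num => //; exact: integrable_noise_coordM.
rewrite unlock /=.
(* Offsets inside a block are natural numbers, so the block has to start at the earlier of the two
   times. *)
have [ij|ij] := leP j i.
  have [k ->] : exists k : nat, i = (j + k%:Z)%R by exists `|i - j|%N; lia.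
  have := noise_cov_shift j 0 k 0 r s.
  by rewrite !addr0 add0r (_ : j + k%:Z - j = k%:Z)%R//; lia.
have [k ->] : exists k : nat, j = (i + k%:Z)%R by exists `|j - i|%N; lia.
have := noise_cov_shift i (- k%:Z) 0 k r s.
by rewrite !addr0 addNr (_ : i - (i + k%:Z) = - k%:Z)%R//; lia.
Qed.

Lemma autocorr_sym tau r s : autocorr W (- tau) r s = autocorr W tau s r.
Proof.
apply: EFin_inj; rewrite -[in RHS](subr0 tau) -[X in autocorr W X](sub0r tau) -!noise_covE.
by apply: eq_integral => t _; rewrite mulrC.
Qed.

Lemma autocorr_far (i j : int) r s : (i + m%:Z < j)%R ->
  \int[P]_t (noise_coord W i r t * noise_coord W j s t)%:E = 0.
Proof.
move=> hij.
apply: (@integral_indep_mul0 _ _ _ P (noise_coord W i r) (noise_coord W j s)).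
- move=> A B mA mB.
  pose C k (x : 'I_n) (A : set (measurableTypeR R)) :=
    [set w : block R n k.+1 | A (tnth (tnth w ord0) x)].
  have mC k x D : measurable D -> measurable (C k x D).
    move=> mD; rewrite -[X in measurable X]setTI.
    have := measurableT_comp (@measurable_tnth _ (measurableTypeR R) n x)
      (@measurable_tnth _ (vec R n) k.+1 ord0).
    by apply.
  (* Parameters 0 denote blocks of one sample each. *)
  have := noise_mdep hW (i1 := i) (i2 := j) (l1 := 0%N) (l2 := 0%N).
  rewrite addr0 => /(_ hij _ _ (mC 0%N r A mA) (mC 0%N s B mB)).
  have CE c x D : noise_block W c 1 @^-1` C 0%N x D = noise_coord W c x @^-1` D.
    have tE t : tnth (noise_block W c 1 t) ord0 = W c t.
      by rewrite tnth_mktuple addr0.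
    by apply/seteqP; split => t; rewrite /C /preimage /mkset tE.
  by rewrite !CE.
- exact: integrable_noise_coord.
- exact: integrable_noise_coordM.
- by have := noise_mean0 hW j s; rewrite unlock.
Qed.

Lemma autocorr_eq0 tau r s : (m%:Z < `|tau|)%R -> autocorr W tau r s = 0%R.
Proof.
move=> h; have [t0|t0] := leP 0%R tau.
  apply: EFin_inj; rewrite -(subr0 tau) -noise_covE.
  under eq_integral do rewrite mulrC; apply: autocorr_far; lia.
by apply: EFin_inj; rewrite -(subr0 tau) -noise_covE; apply: autocorr_far; lia.
Qed.

End noise_law.

(** * Linearity of real-valued integrals *)

Section Rintegral_linear.
Context d (X : measurableType d) (R : realType) (mu : {measure set X -> \bar R}).

Definition rintegrable (g : X -> R) := mu.-integrable [set: X] (EFin \o g).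

Lemma rintegrableD g h : rintegrable g -> rintegrable h ->
  rintegrable (fun x => g x + h x).
Proof. by move=> ig ih; exact: (integrableD measurableT ig ih). Qed.

Lemma rintegrableB g h : rintegrable g -> rintegrable h ->
  rintegrable (fun x => g x - h x).
Proof. by move=> ig ih; exact: (integrableB measurableT ig ih). Qed.

Lemma rintegrableZl k g : rintegrable g -> rintegrable (fun x => k * g x).
Proof. by move=> ig; exact: (integrableZl measurableT k ig). Qed.

Lemma rintegrable_sum I (s : seq I) (g : I -> X -> R) :
  (forall i, rintegrable (g i)) -> rintegrable (fun x => \sum_(i <- s) g i x).
Proof.
move=> ig; apply: (@eq_integrable _ _ _ _ _ measurableT
  (fun x => (\sum_(i <- s) (g i x)%:E)%E)) => [x _|].
  by rewrite /= sumEFin.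
by apply: integrable_sum => // i _; exact: ig.
Qed.

Lemma Rintegral_sum I (s : seq I) (g : I -> X -> R) :
  (forall i, rintegrable (g i)) ->
  \int[mu]_x (\sum_(i <- s) g i x) = \sum_(i <- s) \int[mu]_x g i x.
Proof.
move=> ig; elim: s => [|i s IH].
  by rewrite big_nil; under eq_Rintegral do rewrite big_nil; rewrite /Rintegral integral0.
rewrite big_cons -IH -RintegralD//; last 2 first.
- exact: ig.
- exact: rintegrable_sum.
by apply: eq_Rintegral => x _; rewrite big_cons.
Qed.

Lemma rintegrable_indic (A : set X) (g : X -> R) : measurable A -> rintegrable g ->
  rintegrable (fun x => g x * \1_A x).
Proof.
move=> mA ig; have /measurable_EFinP mg := measurable_int _ ig.
apply: le_integrable ig => //.
  by apply/measurable_EFinP; exact: measurable_funM.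
move=> x _; rewrite /= lee_fin normrM indicE.
by case: (_ \in _); rewrite ?normr1 ?mulr1// normr0 mulr0.
Qed.

Lemma rintegrable_ge0_lty (g : X -> R) : measurable_fun [set: X] g -> (forall x, 0 <= g x) ->
  (\int[mu]_x (g x)%:E < +oo)%E -> rintegrable g.
Proof.
move=> mg g0 lt; apply/integrableP; split; first exact/measurable_EFinP.
move: lt; congr (_ < _)%E; apply: eq_integral => x _.
by rewrite /= ger0_norm.
Qed.

Lemma EFin_Rintegral g : rintegrable g ->
  (\int[mu]_x g x)%:E = (\int[mu]_x (g x)%:E)%E.
Proof. by move=> ig; rewrite /Rintegral fineK//; exact: integrable_fin_num. Qed.

End Rintegral_linear.

(** * The converse for one code *)

Section gibbs_fano.
Context d (X : measurableType d) (R : realType) (mu : {measure set X -> \bar R}).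

(** The inequality ln x <= x - 1 at x = q t / p. The factor [t] is a free boost of the test density;
    it will be the number of messages on a decoding set and 1 elsewhere. *)
Lemma gibbs_pointwise (p q t : R) : 0 <= p -> 0 < q -> 0 < t ->
  p * ln t + p - q * t <= p * ln p - p * ln q.
Proof.
move=> p0 q0 t0; have [->|pn0] := eqVneq p 0.
  by rewrite !mul0r add0r sub0r subr0 oppr_le0 mulr_ge0// ltW.
have {}p0 : 0 < p by rewrite lt0r pn0.
have x0 : 0 < q * t / p by rewrite divr_gt0// mulr_gt0.
have := le_ln1Dx (x := q * t / p - 1); rewrite ltrBrDl subrr => /(_ x0).
rewrite addrC subrK ln_div ?posrE ?mulr_gt0// lnM ?posrE// => h.
have := ler_wpM2l (ltW p0) h.
have -> : p * (q * t / p - 1) = q * t - p by field.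
by lra.
Qed.

(** Boosting [q u] by M on [E u] gains ln M for each correct decision, while its mass grows to at
    most 1 + M times the mass on [E u]. Averaged over [u], the extra mass is at most 1 by the last
    hypothesis, which is the additive constant of the conclusion. *)
Lemma gibbs_fano (p : X -> R) (M : nat) (q : 'I_M -> X -> R) (E : 'I_M -> set X) :
  (0 < M)%N ->
  (forall x, 0 <= p x) -> (forall u x, 0 < q u x) ->
  (forall u, measurable (E u)) ->
  rintegrable mu p -> \int[mu]_x p x = 1 ->
  rintegrable mu (fun x => p x * ln (p x)) ->
  (forall u, rintegrable mu (q u)) ->
  (forall u, rintegrable mu (fun x => p x * ln (q u x))) ->
  (forall u, \int[mu]_x q u x <= 1) ->
  \sum_u \int[mu]_x (q u x * \1_(E u) x) <= 1 ->
  ln M%:R * (M%:R^-1 * \sum_u \int[mu]_x (p x * \1_(E u) x)) <=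
  1 + \int[mu]_x (p x * ln (p x)) - M%:R^-1 * \sum_u \int[mu]_x (p x * ln (q u x)).
Proof.
move=> M0 p0 q0 mE ip p1 ipl iq ipq q1 qE.
have M0R : 0 < M%:R :> R by rewrite ltr0n.
have main u : ln M%:R * \int[mu]_x (p x * \1_(E u) x) + 1
    - (1 + M%:R * \int[mu]_x (q u x * \1_(E u) x)) <=
    \int[mu]_x (p x * ln (p x)) - \int[mu]_x (p x * ln (q u x)).
  have ip1 := rintegrable_indic (mE u) ip.
  have iq1 := rintegrable_indic (mE u) (iq u).
  have i1 : rintegrable mu (fun x => ln M%:R * (p x * \1_(E u) x) + p x).
    by apply: rintegrableD => //; exact: rintegrableZl.
  have i2 : rintegrable mu (fun x => q u x + M%:R * (q u x * \1_(E u) x)).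
    by apply: rintegrableD => //; exact: rintegrableZl.
  (* The mass is counted as q + M q on [E u], slightly more than the boost M q, so that one formula
     covers [E u] and its complement. *)
  apply: (@le_trans _ _ (\int[mu]_x ((ln M%:R * (p x * \1_(E u) x) + p x) -
    (q u x + M%:R * (q u x * \1_(E u) x))))).
    have -> : \int[mu]_x ((ln M%:R * (p x * \1_(E u) x) + p x) -
        (q u x + M%:R * (q u x * \1_(E u) x))) =
        \int[mu]_x (ln M%:R * (p x * \1_(E u) x) + p x) -
        \int[mu]_x (q u x + M%:R * (q u x * \1_(E u) x)) by rewrite RintegralB.
    have -> : \int[mu]_x (ln M%:R * (p x * \1_(E u) x) + p x) =
        ln M%:R * \int[mu]_x (p x * \1_(E u) x) + 1.
      rewrite RintegralD//; last exact: rintegrableZl.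
      by rewrite RintegralZl// p1.
    have -> : \int[mu]_x (q u x + M%:R * (q u x * \1_(E u) x)) =
        \int[mu]_x q u x + M%:R * \int[mu]_x (q u x * \1_(E u) x).
      rewrite RintegralD//; [by rewrite RintegralZl|exact: iq|exact: rintegrableZl].
    by have := q1 u; lra.
  rewrite -RintegralB//; last exact: ipq.
  apply: le_Rintegral => //.
  - exact: rintegrableB.
  - exact: rintegrableB.
  move=> x _; rewrite indicE; case: (x \in E u) => /=.
    have := gibbs_pointwise (p0 x) (q0 u x) M0R.
    by have := q0 u x; rewrite !mulr1; lra.
  have := gibbs_pointwise (p0 x) (q0 u x) (@ltr01 R).
  by rewrite ln1 !mulr0 addr0 mulr1 add0r.
have := ler_sum (index_enum 'I_M) (fun u (_ : true) => main u).
rewrite !big_split/= -!mulr_sumr !sumrN !big_split/= -!mulr_sumr !sumr_const.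
rewrite card_ord.
set S1 := \sum_u \int[mu]_x (p x * \1_(E u) x).
set S2 := \sum_u \int[mu]_x (q u x * _) in qE *.
set S3 := \sum_u \int[mu]_x (p x * ln _); set H := \int[mu]_x _ => h.
have h' : ln M%:R * S1 <= M%:R * (1 + H) - S3.
  have := ler_wpM2l (ltW M0R) qE; rewrite -(mulr_natl H) in h.
  by rewrite mulrDr mulr1; lra.
have := ler_wpM2l (ltW (_ : 0 < M%:R^-1)) h'; rewrite invr_gt0 => /(_ M0R).
have -> : M%:R^-1 * (M%:R * (1 + H) - S3) = 1 + H - M%:R^-1 * S3.
  by field; rewrite gt_eqF.
by rewrite mulrCA.
Qed.

End gibbs_fano.

(** * Quadratic forms of the noise and the Gaussian test density *)

Section real_quadratic.
Context (R : realType).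
Local Notation C := R[i].

Definition qr K (Q : 'M[C]_K) (v : 'rV[R]_K) : R := complex.Re (hform Q (rvec v)).

Lemma qrE K (Q : 'M[C]_K) v :
  qr Q v = \sum_j \sum_i complex.Re (Q i j) * (v 0 i * v 0 j).
Proof.
rewrite /qr hformE Re_sum; apply: eq_bigr => j _; rewrite Re_sum.
apply: eq_bigr => i _; rewrite !mxE; case: (Q i j) => a b /=.
by ring.
Qed.

Lemma qre0 K (Q : 'M[C]_K) v : qre Q 0 v = qr Q v.
Proof. by rewrite /qre subr0. Qed.

End real_quadratic.

Section noise_quadratic.
Context d (Omega : measurableType d) (R : realType) (P : probability Omega R).
Context (n : nat) (W : int -> {RV P >-> vec R n}).
Context (m : nat) (f : forall k, block R n k -> R).
Hypothesis hW : noise_process W m f.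
Local Notation C := R[i].

Definition block_cov k (p q : 'I_(k * n)) : R :=
  autocorr W ((block_of p : nat)%:Z - (block_of q : nat)%:Z)
    (offset_of p) (offset_of q).

Lemma measurable_brow k (p : 'I_(k * n)) :
  measurable_fun [set: block R n k] (fun w => brow w 0 p).
Proof. exact: (gauss_bound_block R n k).1. Qed.

Lemma brow_noise_block k (p : 'I_(k * n)) t :
  brow (noise_block W 0 k t) 0 p = noise_coord W (block_of p : nat)%:Z (offset_of p) t.
Proof. by rewrite mxE tnth_mktuple add0r. Qed.

Lemma measurable_qr_shift k (Q : 'M[C]_(k * n)) (a : 'rV[R]_(k * n)) :
  measurable_fun [set: block R n k] (fun w => qr Q (brow w + a)).
Proof.
under eq_fun do rewrite qrE.
apply: measurable_sum => j; apply: measurable_sum => i.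
apply: measurable_funM => //.
apply: measurable_funM; under eq_fun do rewrite mxE;
  by apply: measurable_funD => //; exact: measurable_brow.
Qed.

(** The cross terms between noise and signal vanish because the noise has mean zero. Real parts of
    the entries suffice since the vector is real. *)
Lemma noise_quad k (Q : 'M[C]_(k * n)) (a : 'rV[R]_(k * n)) :
  rintegrable P (fun t => qr Q (brow (noise_block W 0 k t) + a)) /\
  \int[P]_t qr Q (brow (noise_block W 0 k t) + a) =
  \sum_j \sum_i complex.Re (Q i j) * (block_cov i j + a 0 i * a 0 j).
Proof.
pose x (p : 'I_(k * n)) t := noise_coord W (block_of p : nat)%:Z (offset_of p) t.
have ix p : rintegrable P (x p) by exact: (integrable_noise_coord hW).
have ixx p q : rintegrable P (fun t => x p t * x q t).
  exact: (integrable_noise_coordM hW).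
have ic (c : R) : rintegrable P (fun=> c) by exact: finite_measure_integrable_cst.
have Ex p : \int[P]_t x p t = 0.
  by have := noise_mean0 hW (block_of p : nat)%:Z (offset_of p);
    rewrite unlock /Rintegral => ->.
have Exx p q : \int[P]_t (x p t * x q t) = block_cov p q.
  by rewrite /Rintegral (noise_covE hW).
have iz p q c e : rintegrable P (fun t => x p t * x q t + (c * x p t + (e * x q t + c * e))).
  apply: rintegrableD => //; apply: rintegrableD; first exact: rintegrableZl.
  by apply: rintegrableD => //; exact: rintegrableZl.
have Ez p q c e : \int[P]_t (x p t * x q t + (c * x p t + (e * x q t + c * e))) =
    block_cov p q + c * e.
  have i1 : rintegrable P (fun t => e * x q t + c * e).
    by apply: rintegrableD => //; exact: rintegrableZl.
  have i2 := rintegrableZl c (ix p); have i3 := rintegrableZl e (ix q).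
  rewrite RintegralD; [|by []|exact: ixx|exact: rintegrableD].
  rewrite RintegralD; [|by []|exact: i2|exact: i1].
  rewrite RintegralD; [|by []|exact: i3|exact: ic].
  rewrite RintegralZl; [|by []|exact: ix].
  rewrite RintegralZl; [|by []|exact: ix].
  rewrite Exx !Ex Rintegral_cst//. have -> : fine (P [set: Omega]) = 1 by rewrite [X in fine X](_ : _ = 1%E)//; exact: probability_setT.
  by rewrite !mulr0 !add0r mulr1.
have qE t : qr Q (brow (noise_block W 0 k t) + a) =
    \sum_j \sum_i complex.Re (Q i j) *
      (x i t * x j t + (a 0 j * x i t + (a 0 i * x j t + a 0 j * a 0 i))).
  rewrite qrE; apply: eq_bigr => j _; apply: eq_bigr => i _.
  rewrite ![(brow _ + a) _ _]mxE !brow_noise_block -/(x i t) -/(x j t).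
  by ring.
have iz' i j : rintegrable P (fun t =>
    x i t * x j t + (a 0 j * x i t + (a 0 i * x j t + a 0 j * a 0 i))).
  exact: iz.
split.
  under eq_fun do rewrite qE.
  by apply: rintegrable_sum => j; apply: rintegrable_sum => i; exact: rintegrableZl.
under eq_Rintegral do rewrite qE.
rewrite Rintegral_sum; last first.
  by move=> j; apply: rintegrable_sum => i; exact: rintegrableZl.
apply: eq_bigr => j _; rewrite Rintegral_sum; last by move=> i; exact: rintegrableZl.
apply: eq_bigr => i _; rewrite RintegralZl; [|by []|exact: iz'].
by congr (_ * _); rewrite Ez (mulrC (a 0 j)).
Qed.


Lemma rintegrable_pdf k : rintegrable (leb_block R n k) (@f k).
Proof.
apply: rintegrable_ge0_lty => [||].
- exact: (noise_pdf_measurable hW).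
- exact: (noise_pdf_ge0 hW).
- by rewrite -(noise_pdfE hW)// preimage_setT probability_setT ltry.
Qed.

Lemma Rintegral_pdf k : \int[leb_block R n k]_w f w = 1.
Proof.
by rewrite /Rintegral -(noise_pdfE hW)// preimage_setT probability_setT.
Qed.

Definition gauss_const K (Q : 'M[C]_K) : R :=
  (Num.sqrt ((2 * pi) ^+ K / complex.Re (\det Q)))^-1.

(** [Q] is the precision matrix, not the covariance. For complex [Q] the mass is only known to be at
    most 1. *)
Definition gauss_density k (Q : 'M[C]_(k * n)) (w : block R n k) : R :=
  gauss_const Q * expR (- (2^-1 * qr Q (brow w))).

Lemma gauss_const_gt0 K (Q : 'M[C]_K) : pdmx Q -> 0 < gauss_const Q.
Proof.
move=> /pdmx_det_gt0; rewrite ltcE/= => /andP[_ d0].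
by rewrite invr_gt0 sqrtr_gt0 divr_gt0// exprn_gt0// mulr_gt0// pi_gt0.
Qed.

Lemma gauss_density_gt0 k (Q : 'M[C]_(k * n)) w : pdmx Q -> 0 < gauss_density Q w.
Proof. by move=> pQ; rewrite mulr_gt0 ?expR_gt0// gauss_const_gt0. Qed.

Lemma measurable_gauss_density k (Q : 'M[C]_(k * n)) :
  measurable_fun [set: block R n k] (gauss_density Q).
Proof.
apply: measurable_funM => //; apply: measurableT_comp => //.
apply: measurableT_comp => //; apply: measurable_funM => //.
have := measurable_qr_shift Q 0; apply: eq_measurable_fun => w _.
by rewrite addr0.
Qed.

Lemma integral_gauss_density k (Q : 'M[C]_(k * n)) : pdmx Q ->
  (\int[leb_block R n k]_w (gauss_density Q w)%:E <= 1)%E.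
Proof.
move=> pQ; have c0 := gauss_const_gt0 pQ.
under eq_integral do rewrite EFinM.
rewrite ge0_integralZl//; last 2 first.
- apply/measurable_EFinP; apply: measurableT_comp => //.
  apply: measurableT_comp => //; apply: measurable_funM => //.
  have := measurable_qr_shift Q 0; apply: eq_measurable_fun => w _.
  by rewrite addr0.
- by rewrite lee_fin ltW.
have : (\int[leb_block R n k]_w (expR (- (2^-1 * qr Q (brow w))))%:E <=
    ((gauss_const Q)^-1)%:E)%E.
  rewrite /gauss_const invrK; apply: le_trans ((gauss_bound_block R n k).2 Q 0 pQ).
  by rewrite le_eqVlt; apply/orP; left; apply/eqP/eq_integral => w _; rewrite qre0.
move/(lee_wpmul2l (x := (gauss_const Q)%:E)); rewrite lee_fin ltW// => /(_ isT).
move/le_trans; apply; rewrite -EFinM lee_fin mulfV//.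
by rewrite gt_eqF.
Qed.

Lemma gauss_converse k (M : nat) (dc : block R n k -> 'I_M)
    (a : 'I_M -> 'I_k -> 'I_n -> R) (Q : 'M[C]_(k * n)) :
  (0 < M)%N -> (forall u, measurable (dc @^-1` [set u])) -> pdmx Q ->
  ln M%:R * (M%:R^-1 * \sum_u \int[leb_block R n k]_w
    (f w * \1_(dc @^-1` [set u]) (bshift (a u) w))) <=
  1 + \int[leb_block R n k]_w (f w * ln (f w)) - ln (gauss_const Q)
  + 2^-1 * (\sum_j \sum_i complex.Re (Q i j) * block_cov i j +
     M%:R^-1 * \sum_u qr Q (\row_p a u (block_of p) (offset_of p))).
Proof.
move=> M0 mdc pQ; have M0R : 0 < M%:R :> R by rewrite ltr0n.
pose av u : 'rV[R]_(k * n) := \row_p a u (block_of p) (offset_of p).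
(* The translation is put on the test density and the decoding sets, so that one noise density [f]
   serves all messages. *)
pose q u w := gauss_density Q (bshift (a u) w).
have msh u := (shift_invariant_block (a u)).1.
have mg := measurable_gauss_density Q.
have mq u : measurable_fun [set: block R n k] (q u) by exact: measurableT_comp.
have q0 u w : 0 < q u w by exact: gauss_density_gt0.
have g0 w : (0 <= (gauss_density Q w)%:E)%E by rewrite lee_fin ltW// gauss_density_gt0.
have mEg : measurable_fun [set: block R n k] (fun w => (gauss_density Q w)%:E).
  exact/measurable_EFinP.
have intq u : (\int[leb_block R n k]_w (q u w)%:E <= 1)%E.
  apply: le_trans (integral_gauss_density pQ); rewrite le_eqVlt; apply/orP; left.
  exact/eqP/((shift_invariant_block (a u)).2 (fun w => (gauss_density Q w)%:E) mEg g0).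
have iq u : rintegrable (leb_block R n k) (q u).
  apply: (rintegrable_ge0_lty (mq u) (fun w => ltW (q0 u w))).
  by apply: le_lt_trans (intq u) _; rewrite ltry.
pose E u := bshift (a u) @^-1` (dc @^-1` [set u]).
have mE u : measurable (E u).
  by rewrite -[X in measurable X]setTI; exact: msh.
have quad u := noise_quad Q (av u).
have mqr u : measurable_fun [set: block R n k] (fun w => qr Q (brow w + av u)).
  exact: measurable_qr_shift.
have iquad u : rintegrable (leb_block R n k) (fun w => f w * qr Q (brow w + av u)).
  exact: (noise_integrableP hW (mqr u)).1 (quad u).1.
have lnq u w : f w * ln (q u w) =
    ln (gauss_const Q) * f w - 2^-1 * (f w * qr Q (brow w + av u)).
  rewrite /q /gauss_density lnM ?posrE ?expR_gt0 ?gauss_const_gt0// expRK.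
  by rewrite brow_bshift; ring.
have ipq u : rintegrable (leb_block R n k) (fun w => f w * ln (q u w)).
  under eq_fun do rewrite lnq.
  apply: rintegrableB; apply: rintegrableZl => //; exact: rintegrable_pdf.
have Epq u : \int[leb_block R n k]_w (f w * ln (q u w)) =
    ln (gauss_const Q) -
    2^-1 * (\sum_j \sum_i complex.Re (Q i j) * block_cov i j + qr Q (av u)).
  under eq_Rintegral do rewrite lnq.
  have i1 := rintegrableZl (ln (gauss_const Q)) (@rintegrable_pdf k).
  have i2 := rintegrableZl 2^-1 (iquad u).
  rewrite RintegralB; [|by []|exact: i1|exact: i2].
  rewrite RintegralZl; [|by []|exact: rintegrable_pdf].
  rewrite RintegralZl; [|by []|exact: iquad].
  rewrite Rintegral_pdf mulr1; congr (_ - _ * _).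
  rewrite {1}/Rintegral (integral_noise hW (mqr u) (quad u).1) -/(Rintegral _ _ _).
  rewrite (quad u).2 qrE -big_split; apply: eq_bigr => j _.
  by rewrite -big_split; apply: eq_bigr => i _; rewrite mulrDr.
have ipl : rintegrable (leb_block R n k) (fun w => f w * ln (f w)).
  have ln2 : ln 2 != 0 :> R by rewrite gt_eqF// ln_gt0// ltr1n.
  have h := rintegrableZl (ln 2) (noise_entropy_fin hW k).
  apply: (@eq_integrable _ _ _ _ _ measurableT _ _ _ h) => w _ /=.
  by congr EFin; rewrite /log2; field.
(* Undoing each translation turns the terms into integrals of the same [gauss_density Q] over the
   sets of a partition, hence into its total mass. *)
have sumq : \sum_u \int[leb_block R n k]_w (q u w * \1_(E u) w) <= 1.
  have ig : rintegrable (leb_block R n k) (gauss_density Q).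
    apply: (rintegrable_ge0_lty mg) => [w|]; first by rewrite -lee_fin.
    by apply: le_lt_trans (integral_gauss_density pQ) _; rewrite ltry.
  pose F u y := gauss_density Q y * \1_(dc @^-1` [set u]) y.
  have iF u : rintegrable (leb_block R n k) (F u) by exact: rintegrable_indic.
  have mF u : measurable_fun [set: block R n k] (fun w => (F u w)%:E).
    by case/integrableP: (iF u).
  have F0 u w : (0 <= (F u w)%:E)%E.
    by rewrite lee_fin mulr_ge0// -lee_fin.
  have -> : \sum_u \int[leb_block R n k]_w (q u w * \1_(E u) w) =
      \sum_u \int[leb_block R n k]_w F u w.
    apply: eq_bigr => u _; congr fine.
    exact: ((shift_invariant_block (a u)).2 (fun w => (F u w)%:E) (mF u) (F0 u)).
  rewrite -Rintegral_sum//.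
  have -> : \int[leb_block R n k]_w (\sum_u F u w) =
      \int[leb_block R n k]_w gauss_density Q w.
    apply: eq_Rintegral => w _; rewrite /F (bigD1 (dc w))//= indicE mem_set//.
    rewrite mulr1 big1 ?addr0// => u uw; rewrite indicE memNset ?mulr0//=.
    by move=> e; rewrite -e eqxx in uw.
  rewrite -lee_fin EFin_Rintegral//; exact: integral_gauss_density.
have q1 u : \int[leb_block R n k]_w q u w <= 1.
  by rewrite -lee_fin EFin_Rintegral.
have := gibbs_fano M0 (noise_pdf_ge0 hW (k := k)) q0 mE (@rintegrable_pdf k)
  (Rintegral_pdf k) ipl iq ipq q1 sumq.
have -> : \sum_u \int[leb_block R n k]_w (f w * \1_(E u) w) = \sum_u \int[leb_block R n k]_w
    (f w * \1_(dc @^-1` [set u]) (bshift (a u) w)).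
  by apply: eq_bigr => u _; apply: eq_Rintegral.
move/le_trans; apply.
rewrite (eq_bigr _ (fun u _ => Epq u)).
set A := \sum_j _; set L := ln (gauss_const Q); rewrite -/(av _).
have -> : \sum_(u < M) (L - 2^-1 * (A + qr Q (av u))) =
    M%:R * L - 2^-1 * (M%:R * A + \sum_u qr Q (av u)).
  rewrite big_split/= sumr_const card_ord sumrN -mulr_sumr big_split/=.
  by rewrite sumr_const card_ord (mulr_natl L) (mulr_natl A).
rewrite le_eqVlt; apply/orP; left; apply/eqP.
by field; rewrite gt_eqF.
Qed.

End noise_quadratic.

(** * From the error probability given the state to the unconditional one *)

Section code_converse.
Context d (Omega : measurableType d) (R : realType) (P : probability Omega R).
Context (nr nt m : nat) (G : 'I_m.+1 -> 'M[R]_(nr, nt)).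
Context (W : int -> {RV P >-> vec R nr}) (f : forall k, block R nr k -> R).
Hypothesis hW : noise_process W m f.

Definition btail a b (w : block R nr (a + b)) : block R nr b :=
  [tuple tnth w (rshift a i) | i < b].

Lemma btail_cat a b (u : block R nr a) (v : block R nr b) :
  btail [tuple of u ++ v] = v.
Proof. by apply: eq_from_tnth => i; rewrite tnth_mktuple tnth_rshift. Qed.

Lemma measurable_btail a b : measurable_fun [set: block R nr (a + b)] (@btail a b).
Proof.
apply/measurable_fun_tnthP => i.
apply: (@eq_measurable_fun _ _ _ _ _ (@tnth _ _ ^~ (rshift a i))) => [t _|].
  by rewrite /= tnth_mktuple.
exact: measurable_tnth.
Qed.

Definition bhead a b (w : block R nr (a + b)) : block R nr a :=
  [tuple tnth w (lshift b i) | i < a].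

Lemma bhead_cat a b (u : block R nr a) (v : block R nr b) :
  bhead [tuple of u ++ v] = u.
Proof. by apply: eq_from_tnth => i; rewrite tnth_mktuple tnth_lshift. Qed.

Lemma measurable_bhead a b : measurable_fun [set: block R nr (a + b)] (@bhead a b).
Proof.
apply/measurable_fun_tnthP => i.
apply: (@eq_measurable_fun _ _ _ _ _ (@tnth _ _ ^~ (lshift b i))) => [t _|].
  by rewrite /= tnth_mktuple.
exact: measurable_tnth.
Qed.

Definition signal l (x0 : m.-tuple 'cV[R]_nt) (x : l.-tuple 'cV[R]_nt)
    (i : 'I_l) (r : 'I_nr) : R :=
  (\sum_(tau < m.+1) G tau *m nth 0 (x0 ++ x) (m + i - tau)) r ord0.

Lemma outputE l x0 (x : l.-tuple 'cV[R]_nt) w :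
  output G x0 x w = bshift (signal x0 x) w.
Proof.
apply: eq_from_tnth => i; apply: eq_from_tnth => r.
by rewrite !tnth_mktuple addrC.
Qed.

Lemma measurable_output l x0 (x : l.-tuple 'cV[R]_nt) :
  measurable_fun [set: block R nr l] (output G x0 x).
Proof.
have := (shift_invariant_block (signal x0 x)).1.
by apply: eq_measurable_fun => w _; rewrite outputE.
Qed.

Section error.
Context (l : nat) (c : Defs.code R nr nt l) (x0 : m.-tuple 'cV[R]_nt).
Let M := nmsg c.
Let bad (u : 'I_M) := [set w : block R nr l | dec c (output G x0 (enc c u) w) <> u].

Let measurable_bad u : measurable (bad u).
Proof.
have := measurable_output x0 (enc c u) measurableT (@dec_measurable _ _ _ _ c u).
rewrite setTI => /measurableC; congr (measurable _).
Qed.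

(** The probability, over the uniform message alone, that the noise [w] leads to a wrong
    decision. *)
Let phi w : R := M%:R^-1 * \sum_u \1_(bad u) w.

Let M_gt0 : 0 < M%:R :> R.
Proof. by rewrite ltr0n; exact: nmsg_gt0. Qed.

Let phi_ge0 w : 0 <= phi w.
Proof. by rewrite mulr_ge0 ?invr_ge0 ?(ltW M_gt0)// sumr_ge0. Qed.

Let phi_le1 w : phi w <= 1.
Proof.
rewrite /phi mulrC ler_pdivrMr// mul1r.
apply: (@le_trans _ _ (\sum_(u < M) 1)); last by rewrite sumr_const card_ord.
by apply: ler_sum => u _; rewrite indicE; case: (_ \in _).
Qed.

Let measurable_phi : measurable_fun [set: block R nr l] phi.
Proof.
apply: measurable_funM => //; apply: measurable_sum => u.
apply: measurable_indic; exact: measurable_bad.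
Qed.

Let measurable_pdf k : measurable_fun [set: block R nr k] (@f k).
Proof. exact: (noise_pdf_measurable hW). Qed.

Let pdf_ge0 k w : 0 <= f (k := k) w.
Proof. exact: (noise_pdf_ge0 hW). Qed.

Local Open Scope ereal_scope.

(** The weight [f w0] cancels the denominator of [cond_pdf], leaving an integral of the joint
    density, ready to be integrated over the noise state. *)
Lemma err_probE w0 : (0 < f w0)%R ->
  (f w0)%:E * err_prob G f c (x0, w0) =
  \int[leb_block R nr l]_w (f [tuple of w0 ++ w] * phi w)%:E.
Proof.
move=> f0; have mcat : measurable_fun [set: block R nr l]
    (fun w : block R nr l => f [tuple of w0 ++ w]).
  apply: (measurableT_comp (measurable_pdf (k := m + l))).
  by apply: (measurable_cat_tuple (f := cst w0) (g := id)).
have mc : measurable_fun [set: block R nr l] (fun w : block R nr l => cond_pdf f w0 w).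
  by apply: measurable_funM.
rewrite /err_prob /=.
have c0 w : (0 <= cond_pdf f w0 w :> R)%R by rewrite divr_ge0// ltW.
under eq_bigr do rewrite integral_indicM.
have mci u : measurable_fun [set: block R nr l]
    (fun x => (cond_pdf f w0 x)%:E * (\1_(bad u) x)%:E).
  by apply: emeasurable_funM; apply/measurable_EFinP => //; apply: measurable_indic; exact: measurable_bad.
rewrite -ge0_integral_sum//; last by move=> u w _; rewrite mule_ge0// lee_fin.
rewrite -!ge0_integralZl//=.
- apply: eq_integral => w _; rewrite /phi /cond_pdf.
  under eq_bigr do rewrite -EFinM.
  rewrite sumEFin -!EFinM -mulr_sumr; congr EFin.
  by rewrite -/M; field; rewrite !gt_eqF.
- by apply: emeasurable_funM => //; exact: emeasurable_sum.
- move=> w _; rewrite mule_ge0 ?lee_fin ?invr_ge0 ?(ltW M_gt0)// sume_ge0// => u _.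
  by rewrite mule_ge0// lee_fin.
- by rewrite lee_fin ltW.
- exact: emeasurable_sum.
- by move=> w _; rewrite sume_ge0// => u _; rewrite mule_ge0// lee_fin.
Qed.

(* Initial states outside the support of f carry no noise density, so the bound on
   the states in the support controls the average over all initial states. *)
Lemma pdf_zero_prefix :
  \int[leb_block R nr m]_w0 ((\int[leb_block R nr l]_w (f [tuple of w0 ++ w])%:E)
     * (\1_[set w0 | f w0 = 0%R] w0)%:E) = 0.
Proof.
set A := [set w0 : block R nr m | _].
have mA : measurable A.
  rewrite (_ : A = setT `&` (@f m) @^-1` [set 0%R]); last by rewrite setTI.
  exact: measurable_pdf.
pose B := [set w : block R nr (m + l) | A (bhead w)].
have mB : measurable B.
  rewrite -[X in measurable X]setTI.
  exact: (measurable_bhead measurableT mA).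
have PB : P (noise_block W 0 (m + l) @^-1` B) = 0.
  have -> : noise_block W 0 (m + l) @^-1` B = noise_block W 0 m @^-1` A.
    apply/seteqP; split => t; rewrite /B /preimage /mkset; congr (A _);
      by apply: eq_from_tnth => i; rewrite !tnth_mktuple.
  rewrite (noise_pdfE hW)//; apply: integral0_eq => w Aw.
  by rewrite Aw.
rewrite -[RHS]PB (noise_pdfE hW)// [RHS]integral_indicM [RHS]ge0_integral_block_cat//; last 2 first.
- by apply: emeasurable_funM; apply/measurable_EFinP; [exact: measurable_pdf|exact: measurable_indic].
- by move=> w; rewrite mule_ge0// lee_fin.
apply: eq_integral => w0 _.
rewrite -ge0_integralZr//; last 2 first.
- apply/measurable_EFinP; apply: (measurableT_comp (measurable_pdf (k := m + l))).
  by apply: (measurable_cat_tuple (f := cst w0) (g := id)).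
- by move=> w _; rewrite lee_fin.
apply: eq_integral => w _; congr (_ * _%:E).
rewrite !indicE; have -> : (w0 \in A) = ([tuple of w0 ++ w] \in B) => //.
by apply/idP/idP; rewrite !inE /B /mkset bhead_cat.
Qed.

(** States of positive density are bounded by the supremum; the others contribute nothing by
    [pdf_zero_prefix]. Integrating over the noise state uses that [f] has mass 1. *)
Lemma avg_error_le e1 :
  ereal_sup [set err_prob G f c s | s in states f] < e1%:E ->
  \int[leb_block R nr (m + l)]_w (f w * phi (btail w))%:E <= e1%:E.
Proof.
move=> he.
have mfull : measurable_fun [set: block R nr (m + l)] (fun w => (f w * phi (btail w))%:E).
  apply/measurable_EFinP; apply: measurable_funM; first exact: measurable_pdf.
  exact: (measurableT_comp measurable_phi (@measurable_btail m l)).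
rewrite ge0_integral_block_cat//; last by move=> w; rewrite lee_fin mulr_ge0.
pose J (w0 : block R nr m) := \int[leb_block R nr l]_w (f [tuple of w0 ++ w])%:E.
(* Error probabilities are nonnegative, so a negative [e1] would mean that no state has positive
   density, against total mass 1. *)
have e10 : (0 <= e1)%R.
  rewrite leNgt; apply/negP => e1lt0.
  have noneg w0 : ~ (0 < f (k := m) w0)%R.
    move=> f0; have : err_prob G f c (x0, w0) < 0.
      apply: le_lt_trans (lt_trans he _); last by rewrite lte_fin.
      by apply: ereal_sup_ubound; exists (x0, w0).
    apply/negP; rewrite -leNgt mule_ge0 ?lee_fin ?invr_ge0 ?(ltW M_gt0)//.
    apply: sume_ge0 => u _; apply: integral_ge0 => w _.
    by rewrite lee_fin divr_ge0// ltW.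
  have := probability_setT P; rewrite -(preimage_setT (noise_block W 0 m)).
  rewrite (noise_pdfE hW)// integral0_eq => [/eqP|w0 _].
    by rewrite eq_sym; apply/negP; rewrite onee_eq0.
  by congr EFin; apply/eqP; rewrite eq_le pdf_ge0 andbT leNgt; apply/negP/noneg.
have mpair : measurable_fun [set: block R nr m * block R nr l]
    (fun uv : block R nr m * block R nr l => [tuple of uv.1 ++ uv.2]).
  exact: measurable_cat_tuple.
have mJ : measurable_fun [set: block R nr m] J.
  apply: (@measurable_fun_fubini_tonelli_F _ _ _ _ _ (leb_block R nr l)
    (fun uv : block R nr m * block R nr l => (f [tuple of uv.1 ++ uv.2])%:E)).
    apply/measurable_EFinP; exact: (measurableT_comp (measurable_pdf (k := m + l))).
  by move=> uv; rewrite lee_fin.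
have mA : measurable [set w0 : block R nr m | f w0 = 0%R].
  rewrite (_ : [set _ | _] = setT `&` (@f m) @^-1` [set 0%R]); last by rewrite setTI.
  exact: measurable_pdf.
apply: (@le_trans _ _ (\int[leb_block R nr m]_w0
   (e1%:E * (f w0)%:E + J w0 * (\1_[set w0 | f w0 = 0%R] w0)%:E))).
  apply: ge0_le_integral => //.
  - by move=> w0 _; apply: integral_ge0 => w _; rewrite lee_fin mulr_ge0.
  - apply: (@measurable_fun_fubini_tonelli_F _ _ _ _ _ (leb_block R nr l)
      (fun uv : block R nr m * block R nr l => (f [tuple of uv.1 ++ uv.2] * phi (btail [tuple of uv.1 ++ uv.2]))%:E)).
      exact: (measurableT_comp mfull mpair).
    by move=> uv; rewrite lee_fin mulr_ge0.
  - apply: emeasurable_funD; apply: emeasurable_funM => //; apply/measurable_EFinP => //.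
    exact: measurable_pdf.
  move=> w0 _; under eq_integral do rewrite btail_cat.
  have [f0|f0] := ltP 0%R (f w0).
    rewrite -err_probE// muleC.
    rewrite indicE memNset ?mule0 ?adde0; last by move=> /= e; rewrite e ltxx in f0.
    rewrite lee_wpmul2r ?lee_fin// ltW// (le_lt_trans _ he)//.
    by apply: ereal_sup_ubound; exists (x0, w0).
  have {}f0 : f w0 = 0%R by apply/eqP; rewrite eq_le f0 pdf_ge0.
  rewrite indicE mem_set// mule1 f0 mule0 add0e.
  apply: ge0_le_integral => //.
  - by move=> w _; rewrite lee_fin mulr_ge0.
  - apply/measurable_EFinP; apply: measurable_funM => //.
    apply: (measurableT_comp (measurable_pdf (k := m + l))).
    by apply: (measurable_cat_tuple (f := cst w0) (g := id)).
  - apply/measurable_EFinP; apply: (measurableT_comp (measurable_pdf (k := m + l))).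
    by apply: (measurable_cat_tuple (f := cst w0) (g := id)).
  - by move=> w _; rewrite lee_fin ler_piMr.
rewrite ge0_integralD//; last 4 first.
- by move=> w _; rewrite mule_ge0// lee_fin.
- by apply: emeasurable_funM => //; apply/measurable_EFinP; exact: measurable_pdf.
- by move=> w _; rewrite mule_ge0// ?lee_fin//; apply: integral_ge0 => ? _; rewrite lee_fin.
- by apply: emeasurable_funM => //; apply/measurable_EFinP; exact: measurable_indic.
rewrite pdf_zero_prefix adde0 ge0_integralZl//; last 2 first.
- by apply/measurable_EFinP; exact: measurable_pdf.
- by move=> w _; rewrite lee_fin.
by rewrite -(noise_pdfE hW)// preimage_setT probability_setT mule1.
Qed.

Local Close Scope ereal_scope.

(** The signal [a] is tied to the channel only on the last [l] samples, because the decoder reads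
    only [btail]. The freedom on the first [m] samples is what admits a circular convolution. *)
Lemma code_converse (a : 'I_M -> 'I_(m + l) -> 'I_nr -> R)
    (Q : 'M[R[i]]_((m + l) * nr)) (e1 : R) :
  (forall u i r, a u (rshift m i) r = signal x0 (enc c u) i r) ->
  (ereal_sup [set err_prob G f c s | s in states f] < e1%:E)%E ->
  pdmx Q ->
  (1 - e1) * ln M%:R <=
  1 + \int[leb_block R nr (m + l)]_w (f w * ln (f w)) - ln (gauss_const Q)
  + 2^-1 * (\sum_j \sum_i complex.Re (Q i j) * block_cov W i j +
     M%:R^-1 * \sum_u qr Q (\row_p a u (block_of p) (offset_of p))).
Proof.
move=> ha he pQ.
pose dc (w : block R nr (m + l)) := dec c (btail w).
have mdc u : measurable (dc @^-1` [set u]).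
  rewrite -[X in measurable X]setTI.
  exact: (@measurable_btail m l measurableT _ (@dec_measurable _ _ _ _ c u)).
apply: le_trans (gauss_converse hW a (nmsg_gt0 c) mdc pQ).
rewrite mulrC ler_wpM2l//; first by rewrite ln_ge0// ler1n nmsg_gt0.
have ip := rintegrable_pdf hW (m + l).
have tE u w : btail (bshift (a u) w) = output G x0 (enc c u) (btail w).
  rewrite outputE; apply: eq_from_tnth => i; apply: eq_from_tnth => r.
  by rewrite !tnth_mktuple ha.
have sE u w : \1_(dc @^-1` [set u]) (bshift (a u) w) = 1 - \1_(bad u) (btail w) :> R.
  rewrite !indicE; have [e|e] := eqVneq (dec c (output G x0 (enc c u) (btail w))) u.
    rewrite mem_set/=; last by rewrite /dc tE.
    by rewrite memNset ?subr0// /bad /mkset.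
  rewrite memNset/=; last by rewrite /dc tE; exact/eqP.
  by rewrite mem_set ?subrr// /bad /mkset; exact/eqP.
have mbb u : measurable (@btail m l @^-1` bad u).
  by rewrite -[X in measurable X]setTI; exact: (measurable_btail measurableT (measurable_bad u)).
have ib u : rintegrable (leb_block R nr (m + l)) (fun w => f w * \1_(bad u) (btail w)).
  exact: (rintegrable_indic (mbb u) ip).
have E1 u : \int[leb_block R nr (m + l)]_w (f w * \1_(dc @^-1` [set u]) (bshift (a u) w)) =
    1 - \int[leb_block R nr (m + l)]_w (f w * \1_(bad u) (btail w)).
  under eq_Rintegral do rewrite sE mulrBr mulr1.
  by rewrite RintegralB; [rewrite (Rintegral_pdf hW)|by []|exact: ip|exact: ib].
rewrite (eq_bigr _ (fun u _ => E1 u)) big_split/= sumr_const card_ord sumrN.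
rewrite -Rintegral_sum// mulrBr mulVf ?gt_eqF// lerD2l lerN2.
have iS : rintegrable (leb_block R nr (m + l)) (fun w => \sum_u f w * \1_(bad u) (btail w)).
  exact: rintegrable_sum.
rewrite -RintegralZl// -lee_fin EFin_Rintegral; last exact: rintegrableZl.
apply: le_trans (avg_error_le he); rewrite le_eqVlt; apply/orP; left; apply/eqP.
by apply: eq_integral => w _; rewrite /phi -mulr_sumr mulrCA.
Qed.


End error.
End code_converse.

(** * The entropy rate *)

Section fekete.
Context (R : realType) (a : nat -> R).
Hypothesis a_subadd : forall p q, a (p + q)%N <= a p + a q.

Let u n : \bar R := (n%:R^-1 * a n)%:E.

Lemma subadd_mul_add k q r : a (q * k + r)%N <= q%:R * a k + a r.
Proof.
elim: q => [|q IH]; first by rewrite mul0n add0n mul0r add0r.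
rewrite mulSn -addnA; apply: le_trans (a_subadd _ _) _.
rewrite -natr1 mulrDl mul1r; lra.
Qed.

(** Write n = q k + r with r < k. Replacing q by n / k and dropping the remainder costs at most [B],
    which does not depend on n and so falls below e n. *)
Lemma subadd_eventually_le k e : (0 < k)%N -> 0 < e ->
  \forall n \near \oo, n%:R^-1 * a n <= k%:R^-1 * a k + e.
Proof.
move=> k0 e0; pose B := `|a k| + \sum_(r < k) `|a r|.
have B0 : 0 <= B by rewrite addr_ge0// sumr_ge0.
near=> n.
have n0 : 0 < n%:R :> R by rewrite ltr0n; near: n; exact: nbhs_infty_gt.
have kR : 0 < k%:R :> R by rewrite ltr0n.
have Bn : B <= e * n%:R.
  by rewrite -ler_pdivrMl// mulrC; near: n; exact: nbhs_infty_ger.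
have rk : (n %% k < k)%N by rewrite ltn_mod.
have := subadd_mul_add k (n %/ k) (n %% k); rewrite -divn_eq.
have nE : n%:R = (n %/ k)%:R * k%:R + (n %% k)%:R :> R.
  by rewrite -natrM -natrD -divn_eq.
have ar : a (n %% k)%N <= \sum_(r < k) `|a r|.
  apply: le_trans (ler_norm _) _; rewrite (bigD1 (Ordinal rk))//= lerDl.
  exact: sumr_ge0.
have r1 : (n %% k)%:R <= k%:R :> R by rewrite ler_nat ltnW.
have r0 : 0 <= (n %% k)%:R :> R by [].
set q := (n %/ k)%:R in nE *; set r := (n %% k)%:R in nE r1 r0 *.
move=> h; rewrite ler_pdivrMl//.
have qE : q * a k = n%:R * (k%:R^-1 * a k) - r * (k%:R^-1 * a k).
  by rewrite nE; field; rewrite gt_eqF.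
have ra : - (r * (k%:R^-1 * a k)) <= `|a k|.
  apply: le_trans (ler_norm _) _; rewrite normrN !normrM.
  rewrite (ger0_norm r0) ger0_norm ?invr_ge0 ?(ltW kR)// mulrA ler_piMl//.
  by rewrite ler_pdivrMr// mul1r.
by rewrite /B in Bn; nra.
Unshelve. all: by end_near. Qed.

Lemma fekete : cvgn u /\ forall k, (0 < k)%N -> (limn u <= u k)%E.
Proof.
(* The index is shifted because [u 0] is 0, by the convention on the inverse of 0, and does not
   belong in the infimum. *)
pose L := ereal_inf (range (fun k => u k.+1)).
have Lle k : (0 < k)%N -> (L <= u k)%E.
  by case: k => // k _; apply: ereal_inf_lbound; exists k.
suff h : u @ \oo --> L.
  by split; [apply/cvg_ex; exists L|move=> k k0; rewrite (cvg_lim _ h)//; exact: Lle].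
have ev x : (L < x%:E)%E -> \forall n \near \oo, (u n <= x%:E)%E.
  move=> /ereal_inf_lt[_ [k _ <-]]; rewrite /u lte_fin => ux.
  have e0 : 0 < x - k.+1%:R^-1 * a k.+1 by rewrite subr_gt0.
  have := subadd_eventually_le (ltn0Sn k) e0.
  by apply: filterS => n; rewrite /u lee_fin addrC subrK.
(* The infimum may be -oo; the value +oo is excluded since [u 1] is finite. *)
move: Lle ev; case: L => [r| |] Lle ev.
- apply: cvg_EFin; first by near=> n.
  apply/cvgrPdist_le => e e0.
  have := ev (r + e); rewrite lte_fin ltrDl => /(_ e0) evn.
  near=> n; have n0 : (0 < n)%N by near: n; exact: nbhs_infty_gt.
  have := Lle _ n0; have : (u n <= (r + e)%:E)%E by near: n.
  rewrite /u !lee_fin /= => h1 h2.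
  by rewrite ler_norml; apply/andP; split; lra.
- by have := Lle 1%N isT; rewrite leye_eq.
- by apply/cvgeNyPler => A _; apply: ev; rewrite ltNyr.
Unshelve. all: by end_near. Qed.

End fekete.

Section entropy_rate.
Context d (Omega : measurableType d) (R : realType) (P : probability Omega R).
Context (n m : nat) (W : int -> {RV P >-> vec R n}) (f : forall k, block R n k -> R).
Hypothesis hW : noise_process W m f.

Let h k := - \int[leb_block R n k]_w (f w * ln (f w)).

Let measurable_pdf k : measurable_fun [set: block R n k] (@f k).
Proof. exact: (noise_pdf_measurable hW). Qed.

Let pdf_ge0 k w : 0 <= f (k := k) w.
Proof. exact: (noise_pdf_ge0 hW). Qed.

Lemma rintegrable_entropy k :
  rintegrable (leb_block R n k) (fun w => f w * ln (f w)).
Proof.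
have ln2 : ln 2 != 0 :> R by rewrite gt_eqF// ln_gt0// ltr1n.
have hh := rintegrableZl (ln 2) (noise_entropy_fin hW k).
apply: (@eq_integrable _ _ _ _ _ measurableT _ _ _ hh) => w _ /=.
by congr EFin; rewrite /log2; field.
Qed.

Lemma measurable_ln_pdf k : measurable_fun [set: block R n k] (fun w => ln (f w)).
Proof. exact: (measurableT_comp (@measurable_ln R) (measurable_pdf (k := k))). Qed.

Lemma noise_null_integral k (A : set (block R n k)) (g : block R n k -> R) :
  measurable A -> P (noise_block W 0 k @^-1` A) = 0%E ->
  measurable_fun [set: block R n k] g ->
  rintegrable (leb_block R n k) (fun w => f w * g w) ->
  \int[leb_block R n k]_w (f w * g w * \1_A w) = 0.
Proof.
move=> mA PA mg ig.
have mgA : measurable_fun [set: block R n k] (fun w => g w * \1_A w).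
  by apply: measurable_funM => //; exact: measurable_indic.
have ifgA : rintegrable (leb_block R n k) (fun w => f w * (g w * \1_A w)).
  by under eq_fun do rewrite mulrA; exact: rintegrable_indic.
under eq_Rintegral do rewrite -mulrA.
rewrite /Rintegral (integral_noise hW mgA); last exact/(noise_integrableP hW mgA).
have mB : measurable (noise_block W 0 k @^-1` A).
  by rewrite -[X in measurable X]setTI; exact: (@measurable_noise_block _ _ _ _ _ W 0 k measurableT A mA).
have -> : (\int[P]_t (g (noise_block W 0 k t) * \1_A (noise_block W 0 k t))%:E =
    \int[P]_(t in noise_block W 0 k @^-1` A) (g (noise_block W 0 k t))%:E)%E.
  rewrite [RHS]integral_indicM; apply: eq_integral => t _.
  by rewrite EFinM.
rewrite null_set_integral//; apply/measurable_EFinP.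
by apply: measurable_funTS; apply: (measurableT_comp mg); exact: measurable_noise_block.
Qed.

Lemma noise_zero_pdf k : P (noise_block W 0 k @^-1` [set w | f w = 0]) = 0%E.
Proof.
have mA : measurable [set w : block R n k | f w = 0].
  rewrite (_ : [set _ | _] = setT `&` (@f k) @^-1` [set 0]); last by rewrite setTI.
  exact: measurable_pdf.
by rewrite (noise_pdfE hW)//; apply: integral0_eq => w ->.
Qed.

Lemma noise_entropy_head a b :
  rintegrable (leb_block R n (a + b)) (fun w => f w * ln (f (bhead w))) /\
  \int[leb_block R n (a + b)]_w (f w * ln (f (bhead w))) = - h a.
Proof.
have mg : measurable_fun [set: block R n (a + b)] (fun w => ln (f (bhead w))).
  apply: (@measurableT_comp _ _ _ _ _ _ (fun w : block R n a => ln (f w))).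
    exact: measurable_ln_pdf.
  exact: measurable_bhead.
have E t : bhead (noise_block W 0 (a + b) t) = noise_block W 0 a t.
  by apply: eq_from_tnth => i; rewrite !tnth_mktuple.
have ia : P.-integrable setT (fun t => (ln (f (noise_block W 0 a t)))%:E).
  exact: (noise_integrableP hW (@measurable_ln_pdf a)).2 (rintegrable_entropy a).
have iab : P.-integrable setT (fun t => (ln (f (bhead (noise_block W 0 (a + b) t))))%:E).
  by under eq_fun do rewrite E.
split; first exact: (noise_integrableP hW mg).1 iab.
rewrite /h opprK /Rintegral (integral_noise hW mg iab).
rewrite (integral_noise hW (@measurable_ln_pdf a) ia).
by under eq_integral do rewrite E.
Qed.

(** The last [b] samples start at time [a]; stationarity moves them to time 0, where [f b] is their
    density. *)
Lemma noise_entropy_tail a b :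
  rintegrable (leb_block R n (a + b)) (fun w => f w * ln (f (btail w))) /\
  \int[leb_block R n (a + b)]_w (f w * ln (f (btail w))) = - h b.
Proof.
have mg : measurable_fun [set: block R n (a + b)] (fun w => ln (f (btail w))).
  apply: (@measurableT_comp _ _ _ _ _ _ (fun w : block R n b => ln (f w))).
    exact: measurable_ln_pdf.
  exact: measurable_btail.
have E t : btail (noise_block W 0 (a + b) t) = noise_block W a%:Z b t.
  apply: eq_from_tnth => i; rewrite !tnth_mktuple; congr (W _ t).
have ia : P.-integrable setT (fun t => (ln (f (noise_block W 0 b t)))%:E).
  exact: (noise_integrableP hW (@measurable_ln_pdf b)).2 (rintegrable_entropy b).
have [ib Eb] := integral_noise_stationary hW a%:Z (@measurable_ln_pdf b) ia.
have iab : P.-integrable setT (fun t => (ln (f (btail (noise_block W 0 (a + b) t))))%:E).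
  by under eq_fun do rewrite E.
split; first exact: (noise_integrableP hW mg).1 iab.
rewrite /h opprK /Rintegral (integral_noise hW mg iab).
rewrite (integral_noise hW (@measurable_ln_pdf b) ia) Eb.
by under eq_integral do rewrite E.
Qed.

(** Gibbs' inequality between the joint density and the product of the marginals. The obstacle is
    that a marginal may vanish, where the logarithm of the product no longer splits; this happens on
    a null set for the noise, which is cut out first. *)
Lemma entropy_subadditive a b : h (a + b)%N <= h a + h b.
Proof.
have [ia Ea] := noise_entropy_head a b; have [ib Eb] := noise_entropy_tail a b.
have iab := rintegrable_entropy (a + b).
set mu := leb_block R n (a + b) in ia Ea ib Eb iab *.
pose A1 := @bhead R n a b @^-1` [set w | f w = 0].
pose A2 := @btail R n a b @^-1` [set w | f w = 0].
have mZ k : measurable [set w : block R n k | f w = 0].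
  rewrite (_ : [set _ | _] = setT `&` (@f k) @^-1` [set 0]); last by rewrite setTI.
  exact: measurable_pdf.
have mA1 : measurable A1.
  by rewrite -[X in measurable X]setTI; exact: (measurable_bhead measurableT (mZ a)).
have mA2 : measurable A2.
  by rewrite -[X in measurable X]setTI; exact: (measurable_btail measurableT (mZ b)).
have PA1 : P (noise_block W 0 (a + b) @^-1` A1) = 0%E.
  rewrite -[RHS](noise_zero_pdf a); congr (P _); apply/seteqP; split => t;
    rewrite /A1 /preimage /mkset; congr (f _ = _);
    by apply: eq_from_tnth => i; rewrite !tnth_mktuple.
have PA2 : P (noise_block W 0 (a + b) @^-1` A2) = 0%E.
  rewrite -[RHS](noise_zero_pdf b) [RHS](noise_stationary hW 0 a%:Z)//.
  congr (P _); apply/seteqP; split => t; rewrite /A2 /preimage /mkset; congr (f _ = _);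
    by apply: eq_from_tnth => i; rewrite !tnth_mktuple; congr (W _ t).
pose A := A1 `|` A2.
have mA : measurable A by exact: measurableU.
have PA : P (noise_block W 0 (a + b) @^-1` A) = 0%E.
  rewrite preimage_setU; apply/eqP; rewrite -measure_le0.
  have mB B : measurable B -> measurable (noise_block W 0 (a + b) @^-1` B).
    by move=> mB; rewrite -[X in measurable X]setTI; exact: (@measurable_noise_block _ _ _ _ _ W 0 (a + b) measurableT B mB).
  by apply: le_trans (measureU2 _ (mB _ mA1) (mB _ mA2)) _; rewrite [X in (X + _)%E]PA1 [X in (_ + X)%E]PA2 adde0.
pose g (w : block R n (a + b)) := ln (f w) - (ln (f (bhead w)) + ln (f (btail w))).
have mga : measurable_fun [set: block R n (a + b)] (fun w => ln (f (bhead w))).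
  apply: (@measurableT_comp _ _ _ _ _ _ (fun w : block R n a => ln (f w))).
    exact: measurable_ln_pdf.
  exact: measurable_bhead.
have mgb : measurable_fun [set: block R n (a + b)] (fun w => ln (f (btail w))).
  apply: (@measurableT_comp _ _ _ _ _ _ (fun w : block R n b => ln (f w))).
    exact: measurable_ln_pdf.
  exact: measurable_btail.
have mg : measurable_fun [set: block R n (a + b)] g.
  apply: measurable_funB; first exact: measurable_ln_pdf.
  exact: measurable_funD.
have ig : rintegrable mu (fun w => f w * g w).
  under eq_fun do rewrite /g mulrBr mulrDr.
  by apply: rintegrableB => //; exact: rintegrableD.
have Eg : \int[mu]_w (f w * g w) = h a + h b - h (a + b)%N.
  under eq_Rintegral do rewrite /g mulrBr mulrDr.
  rewrite RintegralB; [|by []|exact: iab|exact: rintegrableD].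
  rewrite RintegralD; [|by []|exact: ia|exact: ib].
  by rewrite Ea Eb /h -/mu; ring.
rewrite -subr_ge0 -Eg.
pose q (w : block R n (a + b)) := f (bhead w) * f (btail w).
have mq : measurable_fun [set: block R n (a + b)] q.
  apply: measurable_funM.
    exact: (measurableT_comp (measurable_pdf (k := a)) (@measurable_bhead _ _ a b)).
  exact: (measurableT_comp (measurable_pdf (k := b)) (@measurable_btail _ _ a b)).
have intq : (\int[mu]_w (q w)%:E = 1)%E.
  rewrite ge0_integral_block_cat; [|exact/measurable_EFinP|by move=> w; rewrite lee_fin mulr_ge0].
  under eq_integral => u _.
    under eq_integral => v _ do rewrite /q bhead_cat btail_cat EFinM.
    rewrite ge0_integralZl//; last 3 first.
    - by apply/measurable_EFinP; exact: measurable_pdf.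
    - by move=> v _; rewrite lee_fin.
    - by rewrite lee_fin.
    rewrite -(noise_pdfE hW)// preimage_setT probability_setT mule1; over.
  by rewrite -(noise_pdfE hW)// preimage_setT probability_setT.
have iq : rintegrable mu q.
  apply: (rintegrable_ge0_lty mq) => [w|]; first by rewrite mulr_ge0.
  by rewrite intq ltry.
have Eq : \int[mu]_w q w = 1 by rewrite /Rintegral intq.
have ip : rintegrable mu (@f (a + b)) by exact: (rintegrable_pdf hW).
have ip1 : rintegrable mu (fun w => f w * 1) by under eq_fun do rewrite mulr1.
have m1 : measurable_fun [set: block R n (a + b)] (fun=> 1 : R) by [].
have NA1 := noise_null_integral mA PA m1 ip1.
have NAg := noise_null_integral mA PA mg ig.
(* On [B] both marginals are positive, and integrals against [f] over [B] and over the whole space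
   agree. *)
pose B := ~` A.
have mB : measurable B by exact: measurableC.
have BE w : \1_A w + \1_B w = 1 :> R.
  rewrite !indicE /B; have [wA|wA] := boolP (w \in A).
    by rewrite memNset ?addr0//= => /(_ (set_mem wA)).
  by rewrite mem_set ?add0r//= => wA'; rewrite mem_set in wA.
have iB (F : block R n (a + b) -> R) : rintegrable mu F ->
    \int[mu]_w (F w * \1_A w) = 0 -> \int[mu]_w (F w * \1_B w) = \int[mu]_w F w.
  move=> iF F0; rewrite -[LHS]add0r -F0 -RintegralD//; last 2 first.
  - exact: rintegrable_indic.
  - exact: rintegrable_indic.
  by apply: eq_Rintegral => w _; rewrite -mulrDr BE mulr1.
rewrite -(iB _ ig NAg).
have p1 : \int[mu]_w (f w * 1 * \1_B w) = 1.
  rewrite (iB _ ip1 NA1); under eq_Rintegral do rewrite mulr1.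
  exact: (Rintegral_pdf hW).
have qB : \int[mu]_w (q w * \1_B w) <= 1.
  rewrite -Eq; apply: le_Rintegral => //; first exact: rintegrable_indic.
  move=> w _; apply: ler_piMr; first by rewrite mulr_ge0.
  by rewrite indicE; case: (_ \in _).
apply: (@le_trans _ _ (\int[mu]_w (f w * 1 * \1_B w - q w * \1_B w))).
  rewrite RintegralB; [|by []|exact: (rintegrable_indic mB ip1)|exact: (rintegrable_indic mB iq)].
  by rewrite p1 subr_ge0.
apply: le_Rintegral => //.
- by apply: rintegrableB; exact: rintegrable_indic.
- exact: rintegrable_indic.
move=> w _; rewrite mulr1 -mulrBl.
have [wB|wB] := boolP (w \in B); last by rewrite indicE (negbTE wB) !mulr0.
rewrite indicE wB !mulr1.
have wAn : ~ A w by exact: set_mem wB.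
have fa : 0 < f (bhead (a := a) (b := b) w).
  by rewrite lt_neqAle pdf_ge0 andbT; apply/eqP => e; apply: wAn; left.
have fb : 0 < f (btail (a := a) (b := b) w).
  by rewrite lt_neqAle pdf_ge0 andbT; apply/eqP => e; apply: wAn; right.
have := gibbs_pointwise (pdf_ge0 w) (mulr_gt0 fa fb) ltr01.
by rewrite ln1 mulr0 add0r mulr1 /g /q lnM ?posrE// mulrBr.
Qed.

Lemma entropy_rate_le k : (0 < k)%N ->
  (entropy_rate f <= (k%:R^-1 * (h k / ln 2))%:E)%E.
Proof.
have ln2 : 0 < ln 2 :> R by rewrite ln_gt0// ltr1n.
pose a k := h k / ln 2.
have sub p q : a (p + q)%N <= a p + a q.
  by rewrite /a -mulrDl ler_pM2r ?invr_gt0// entropy_subadditive.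
have [_ le] := fekete sub.
move=> k0; apply: le_trans (le _ k0); rewrite le_eqVlt; apply/orP; left; apply/eqP.
rewrite /entropy_rate; congr (limn _); apply/funext => l.
rewrite EFinM; congr (_ * _)%E; rewrite /entropy /a /h mulNr EFinN; congr (- _)%E.
rewrite -RintegralZr//; last exact: rintegrable_entropy.
rewrite EFin_Rintegral; last by under eq_fun do rewrite mulrC; apply: rintegrableZl; exact: rintegrable_entropy.
by apply: eq_integral => w _; rewrite /log2 mulrA.
Qed.

End entropy_rate.

(** Sylvester's identity: the same two block matrices are multiplied in both orders, and each
    product is block triangular. *)
Lemma det_1addmx_mulC (F : fieldType) n1 n2 (X : 'M[F]_(n1, n2)) (Y : 'M[F]_(n2, n1)) :
  \det (1%:M + X *m Y) = \det (1%:M + Y *m X).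
Proof.
have E1 : block_mx 1%:M (- X) Y 1%:M *m block_mx 1%:M 0 (- Y) 1%:M =
    block_mx (1%:M + X *m Y) (- X) 0 1%:M.
  rewrite mulmx_block !mulmx1 !mulmx0 !mul1mx !add0r.
  by rewrite mulNmx mulmxN opprK subrr.
have E2 : block_mx 1%:M 0 (- Y) 1%:M *m block_mx 1%:M (- X) Y 1%:M =
    block_mx 1%:M (- X) 0 (1%:M + Y *m X).
  rewrite mulmx_block !mulmx1 !mul1mx !mul0mx !addr0 addNr.
  by rewrite mulNmx mulmxN opprK addrC.
have := congr1 determinant E1; have := congr1 determinant E2.
rewrite !det_mulmx !det_ublock !det_lblock !det1 !mulr1 !mul1r => -> ->.
by [].
Qed.

(** * Waterfilling at one frequency *)

Definition reig (R : realType) n (A : 'M[R[i]]_n) (k : 'I_n) : R :=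
  complex.Re (spectral_diag A 0 k).

Definition sconj (R : realType) n (A : 'M[R[i]]_n) (d : 'rV[R[i]]_n) : 'M[R[i]]_n :=
  ((spectralmx A)^t* *m diag_mx d *m spectralmx A)%sesqui.

(** Functional calculus for Hermitian matrices. It is locked so that conversion does not unfold the
    spectral decomposition. *)
HB.lock Definition fcal (R : realType) n (g : R -> R) (A : 'M[R[i]]_n) : 'M[R[i]]_n :=
  sconj A (\row_k (g (reig A k))%:C%C).

Section functional_calculus.
Context (R : realType).
Local Open Scope sesquilinear_scope.
Local Open Scope complex_scope.
Local Notation C := R[i].

Lemma spectral_diag_reig n (A : 'M[C]_n) k : A^t* = A ->
  spectral_diag A 0 k = (reig A k)%:C.
Proof.
move=> hA; have hh : A \is hermsymmx.
  by apply/is_hermitianmxP; rewrite expr0 scale1r hA.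
have /mxOverP/(_ 0 k) := hermitian_spectral_diag_real hh.
by move=> /RRe_real.
Qed.

Lemma fcal_id n (A : 'M[C]_n) : A^t* = A -> fcal id A = A.
Proof.
move=> hA; rewrite [RHS](hermitian_spectral hA) fcal.unlock -[RHS]/(sconj A (spectral_diag A)).
by congr (sconj A _); apply/rowP => k; rewrite mxE spectral_diag_reig.
Qed.

Lemma fcalM n g h (A : 'M[C]_n) :
  fcal g A *m fcal h A = fcal (fun x => g x * h x) A.
Proof.
transitivity (sconj A (\row_k ((g (reig A k))%:C * (h (reig A k))%:C))); last first.
  by rewrite fcal.unlock; congr (sconj A _); apply/rowP => k; rewrite !mxE -rmorphM.
rewrite fcal.unlock /sconj; have /unitarymxP uP := spectral_unitarymx A.
rewrite !mulmxA -[_ *m spectralmx A *m _]mulmxA uP mulmx1.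
rewrite -[_ *m diag_mx _ *m diag_mx _]mulmxA mulmx_diag.
have -> // : \row_j ((\row_k (g (reig A k))%:C) 0 j * (\row_k (h (reig A k))%:C) 0 j) =
  \row_k ((g (reig A k))%:C * (h (reig A k))%:C).
by apply/rowP => k; rewrite !mxE.
Qed.

Lemma fcalB n g h (A : 'M[C]_n) :
  fcal g A - fcal h A = fcal (fun x => g x - h x) A.
Proof.
transitivity (sconj A (\row_k (g (reig A k))%:C - \row_k (h (reig A k))%:C)).
  by rewrite fcal.unlock /sconj -mulmxBl -mulmxBr -linearB/=.
by rewrite fcal.unlock; congr (sconj A _); apply/rowP => k; rewrite !mxE -rmorphB.
Qed.

Lemma fcalD n g h (A : 'M[C]_n) :
  fcal g A + fcal h A = fcal (fun x => g x + h x) A.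
Proof.
transitivity (sconj A (\row_k (g (reig A k))%:C + \row_k (h (reig A k))%:C)).
  by rewrite fcal.unlock /sconj -mulmxDl -mulmxDr -linearD/=.
by rewrite fcal.unlock; congr (sconj A _); apply/rowP => k; rewrite !mxE -rmorphD.
Qed.

Lemma fcal1 n (A : 'M[C]_n) : fcal (fun=> 1) A = 1%:M.
Proof.
rewrite fcal.unlock (_ : \row_k _ = const_mx 1).
  rewrite /sconj diag_const_mx mulmx1.
  exact/unitary_trCmul/spectral_unitarymx.
by apply/rowP => k; rewrite !mxE.
Qed.

Lemma eq_fcal n g h (A : 'M[C]_n) : (forall k, g (reig A k) = h (reig A k)) ->
  fcal g A = fcal h A.
Proof.
move=> gh; rewrite fcal.unlock; congr (sconj A _); apply/rowP => k.
by rewrite !mxE gh.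
Qed.

Lemma fcal_trC n g (A : 'M[C]_n) : (fcal g A)^t* = fcal g A.
Proof.
transitivity (sconj A (map_mx Num.conj (\row_k (g (reig A k))%:C))).
  by rewrite fcal.unlock /sconj !trCM trmxCK mulmxA tr_diag_mx map_diag_mx.
rewrite fcal.unlock; congr (sconj A _); apply/rowP => k.
by rewrite !mxE conj_Creal// realE -[0]/(0%:C) !lecR le_total.
Qed.

Lemma tr_fcal n g (A : 'M[C]_n) : \tr (fcal g A) = (\sum_k g (reig A k))%:C.
Proof.
rewrite fcal.unlock /sconj mxtrace_unitary_conj ?spectral_unitarymx// mxtrace_diag rmorph_sum.
by apply: eq_bigr => k _; rewrite mxE.
Qed.

Lemma det_fcal n g (A : 'M[C]_n) : \det (fcal g A) = (\prod_k g (reig A k))%:C.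
Proof.
rewrite fcal.unlock /sconj det_unitary_conj ?spectral_unitarymx// det_diag rmorph_prod.
by apply: eq_bigr => k _; rewrite mxE.
Qed.

Lemma hform_fcal n g (A : 'M[C]_n) (u : 'rV[C]_n) :
  hform (fcal g A) u =
  \sum_k (g (reig A k))%:C * `|(u *m (spectralmx A)^t*) 0 k| ^+ 2.
Proof.
rewrite fcal.unlock /sconj -{2}(trmxCK (spectralmx A)) hform_congr hform_diag.
by apply: eq_bigr => k _; rewrite mxE.
Qed.

Lemma unitary_norm2 n (U : 'M[C]_n) (u : 'rV[C]_n) : U \is unitarymx ->
  \sum_k `|(u *m U^t*) 0 k| ^+ 2 = \sum_k `|u 0 k| ^+ 2.
Proof.
move=> uU; rewrite -!hform1 -hform_congr trmxCK mulmx1.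
by rewrite unitary_trCmul.
Qed.

Lemma unitary_entry_le1 n (U : 'M[C]_n) i j : U \is unitarymx -> `|U i j| <= 1.
Proof.
move=> /unitarymxP/matrixP/(_ i i); rewrite !mxE eqxx mulr1n => h.
rewrite -(@ler_pXn2r _ 2)// ?nnegrE// expr1n -h (bigD1 j)//= !mxE -normCK lerDl.
by apply: sumr_ge0 => k _; rewrite !mxE -normCK exprn_ge0.
Qed.

Lemma fcal_entry_le n g (A : 'M[C]_n) (B : R) i j :
  (forall k, `|g (reig A k)| <= B) -> `|fcal g A i j| <= (n%:R * B)%:C.
Proof.
move=> gB; rewrite fcal.unlock /sconj mxE; apply: le_trans (ler_norm_sum _ _ _) _.
have -> : (n%:R * B)%:C = \sum_(k < n) B%:C.
  by rewrite sumr_const card_ord mulr_natl rmorphMn.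
apply: ler_sum => k _.
rewrite mul_mx_diag !mxE !normrM norm_conjC.
have uP := spectral_unitarymx A.
have := unitary_entry_le1 k i uP; have := unitary_entry_le1 k j uP.
have : `|(g (reig A k))%:C| <= B%:C by rewrite normc_def/= expr0n/= addr0 sqrtr_sqr lecR.
move=> h1 h2 h3; rewrite -[B%:C]mulr1 -[B%:C * 1]mul1r mulrA.
apply: ler_pM => //; rewrite ?mulr_ge0//.
by apply: ler_pM.
Qed.

End functional_calculus.

Section waterfilling.
Context (R : realType).
Local Open Scope sesquilinear_scope.
Local Open Scope complex_scope.
Local Notation C := R[i].
Context (nr nt : nat) (K : 'M[C]_nr) (H : 'M[C]_(nr, nt)) (D : R).
Hypothesis pK : pdmx K.
Hypothesis D0 : 0 < D.

Definition wf_power (x : R) : R := if x == 0 then 0 else Num.max 0 (D - x^-1).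
(** In nats; [waterfill_rateE] converts to base 2. *)
Definition wf_rate (x : R) : R := if x == 0 then 0 else Num.max 0 (ln (D * x)).

Definition gram := H^t* *m invmx K *m H.

Lemma gram_trC : gram^t* = gram.
Proof. by rewrite /gram !trCM invmx_trC pK.1 trmxCK mulmxA. Qed.

(** The eigenvalue is the form of [gram] at a spectral row, which is the form of the positive matrix
    [invmx K] at the image of that row. *)
Lemma gram_eig_ge0 k : 0 <= reig gram k.
Proof.
have [hK1 pK1] := pdmx_inv pK.
have uP := spectral_unitarymx gram.
have E := hermitian_spectral gram_trC.
set P := spectralmx gram in uP E.
have dE : hform gram (row k P) = spectral_diag gram 0 k.
  rewrite {1}E -{2}(trmxCK P) hform_congr -row_mul (unitarymxP uP) row1 hform_diag.
  rewrite (bigD1 k)//= mxE !eqxx normr1 expr1n mulr1 big1 ?addr0// => j ji.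
  by rewrite mxE eqxx/= (negbTE ji) normr0 expr0n mulr0.
suff : 0 <= (reig gram k)%:C by rewrite lecR.
rewrite -(spectral_diag_reig _ gram_trC) -dE /gram -{2}(trmxCK H) hform_congr.
have [->|u0] := eqVneq (row k P *m H^t*) 0; last exact/ltW/pK1.
by rewrite /hform !mul0mx mxE.
Qed.

(* The output covariance for the waterfilling input; wf_prec is its inverse. *)
Definition wf_cov := K + H *m fcal wf_power gram *m H^t*.

(** The scalar of the Woodbury formula for inverting [wf_cov], on an eigenspace of [gram] with
    eigenvalue x. *)
Definition wf_gain (x : R) := wf_power x / (1 + x * wf_power x).

Definition wf_prec := invmx K - invmx K *m H *m fcal wf_gain gram *m H^t* *m invmx K.

Lemma wf_power_ge0 x : 0 <= wf_power x.
Proof. by rewrite /wf_power; case: ifP => // _; rewrite le_max lexx. Qed.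

Lemma wf_den_ge1 x : 0 <= x -> 1 <= 1 + x * wf_power x.
Proof. by move=> x0; rewrite lerDl mulr_ge0// wf_power_ge0. Qed.

Lemma wf_rateE x : 0 <= x -> wf_rate x = ln (1 + x * wf_power x).
Proof.
move=> x0; rewrite /wf_rate /wf_power; have [->|xn0] := eqVneq x 0.
  by rewrite mul0r addr0 ln1.
have {}x0 : 0 < x by rewrite lt0r xn0.
have [h|h] := leP 0 (D - x^-1).
  have Dx : 1 <= D * x by rewrite -ler_pdivrMr// div1r -subr_ge0.
  rewrite (max_idPr _); last by rewrite ln_ge0.
  by congr ln; field.
rewrite mulr0 addr0 ln1; apply/max_idPl/ln_le0.
by rewrite -ler_pdivlMr// div1r -subr_le0 ltW.
Qed.

Lemma wf_gainM x : 0 <= x -> wf_gain x * x = D^-1 * wf_power x.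
Proof.
move=> x0; rewrite /wf_gain /wf_power; have [->|xn0] := eqVneq x 0.
  by rewrite !mulr0.
have {}x0 : 0 < x by rewrite lt0r xn0.
have [h|h] := leP 0 (D - x^-1); last by rewrite !mul0r mulr0.
have -> : 1 + x * (D - x^-1) = D * x by field.
by field; rewrite xn0 gt_eqF.
Qed.

(** The optimality condition of waterfilling: a mode that receives power gives exactly 1/D, and an
    idle mode has x <= 1/D. The left-hand side is the price of a unit of input energy in the mode
    x. *)
Lemma wf_eig_le x : 0 <= x -> x - x * wf_gain x * x <= D^-1.
Proof.
move=> x0; rewrite -mulrA wf_gainM//; rewrite /wf_power.
have [->|xn0] := eqVneq x 0; first by rewrite mul0r subr0 invr_ge0 ltW.
have {}x0 : 0 < x by rewrite lt0r xn0.
have [h|h] := leP 0 (D - x^-1).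
  suff -> : x - x * (D^-1 * (D - x^-1)) = D^-1 by [].
  by field; rewrite xn0 gt_eqF.
rewrite !mulr0 subr0; move: h; rewrite subr_lt0 => h.
by rewrite -(invrK x) lef_pV2 ?posrE ?invr_gt0// ltW.
Qed.

Lemma pdmx_wf_cov : pdmx wf_cov.
Proof.
split; first by rewrite /wf_cov trCD !trCM trmxCK fcal_trC pK.1 mulmxA.
move=> u u0; rewrite /wf_cov hformD; apply: ltr_wpDr; last exact: pK.2.
rewrite hform_congr hform_fcal; apply: sumr_ge0 => k _.
by rewrite mulr_ge0 ?exprn_ge0// ler0c wf_power_ge0.
Qed.

Lemma wf_prec_cov : wf_prec *m wf_cov = 1%:M.
Proof.
have uK := pdmx_unit pK.
rewrite /wf_prec /wf_cov mulmxDr !mulmxBl mulVmx// mulmxKV//.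
have -> : invmx K *m H *m fcal wf_gain gram *m H^t* *m invmx K *m (H *m fcal wf_power gram *m H^t*)
   = invmx K *m H *m (fcal wf_gain gram *m gram *m fcal wf_power gram) *m H^t*.
  by rewrite /gram !mulmxA.
have -> : fcal wf_gain gram *m gram *m fcal wf_power gram =
    fcal (fun x => wf_gain x * x * wf_power x) gram.
  by rewrite -{2}(fcal_id gram_trC) !fcalM.
(* On eigenvalues this is s = g + g x s, which is the definition of [wf_gain] with the denominator
   cleared. *)
have E : fcal wf_power gram = fcal wf_gain gram +
    fcal (fun x => wf_gain x * x * wf_power x) gram.
  rewrite fcalD; apply: eq_fcal => k.
  have d0 := wf_den_ge1 (gram_eig_ge0 k).
  rewrite /wf_gain; field.
  by rewrite gt_eqF// (lt_le_trans ltr01).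
by rewrite {1}E !(mulmxDr, mulmxDl) !mulmxA addrK subrK.
Qed.

Lemma wf_precE : wf_prec = invmx wf_cov.
Proof.
have uS := pdmx_unit pdmx_wf_cov.
by rewrite -[LHS](mulmxK uS) wf_prec_cov mul1mx.
Qed.

Lemma pdmx_wf_prec : pdmx wf_prec.
Proof. by rewrite wf_precE; exact/pdmx_inv/pdmx_wf_cov. Qed.

Lemma det_wf_prec :
  ln (complex.Re (\det wf_prec)) =
  - (ln (complex.Re (\det K)) + \sum_k wf_rate (reig gram k)).
Proof.
have uK := pdmx_unit pK.
have dS : \det wf_cov = \det K * (\prod_k (1 + reig gram k * wf_power (reig gram k)))%:C.
  have -> : wf_cov = K *m (1%:M + invmx K *m H *m fcal wf_power gram *m H^t*).
    by rewrite /wf_cov mulmxDr mulmx1 !mulmxA mulmxV// mul1mx.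
  rewrite det_mulmx; congr (_ * _).
  (* Sylvester's identity passes from size [nr] to size [nt], where the determinant is a product
     over the eigenvalues of [gram]. *)
  rewrite -mulmxA -mulmxA mulmxA det_1addmx_mulC.
  have -> : fcal wf_power gram *m H^t* *m (invmx K *m H) =
      fcal wf_power gram *m gram by rewrite /gram !mulmxA.
  rewrite -{2}(fcal_id gram_trC) fcalM -(fcal1 gram) fcalD det_fcal.
  by congr (_%:C); apply: eq_bigr => k _; rewrite mulrC.
have := pdmx_det_gt0 pK.
case E : (\det K) => [a b]; rewrite ltcE/= => /andP[/eqP b0 a0].
set p := \prod_k _ in dS.
have p0 : 0 < p.
  by apply: prodr_gt0 => k _; apply: lt_le_trans (wf_den_ge1 (gram_eig_ge0 k)).
have -> : complex.Re (\det wf_prec) = (a * p)^-1.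
  rewrite wf_precE det_inv dS E b0 -[a +i* 0]/(a%:C) -rmorphM -fmorphV //.
rewrite lnV ?posrE ?mulr_gt0// lnM ?posrE//; congr (- (_ + _)).
rewrite /p; elim: (index_enum _) => [|k r IH]; first by rewrite !big_nil ln1.
rewrite !big_cons lnM ?posrE ?IH ?wf_rateE ?gram_eig_ge0//.
  exact: lt_le_trans (wf_den_ge1 (gram_eig_ge0 k)).
by apply: prodr_gt0 => j _; apply: lt_le_trans (wf_den_ge1 (gram_eig_ge0 j)).
Qed.

Lemma tr_wf_prec :
  complex.Re (\tr (wf_prec *m K)) = nr%:R - D^-1 * \sum_k wf_power (reig gram k).
Proof.
have uK := pdmx_unit pK.
have -> : wf_prec *m K = 1%:M - invmx K *m H *m (fcal wf_gain gram *m H^t*).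
  by rewrite /wf_prec mulmxBl mulVmx// !mulmxA mulmxKV.
rewrite linearB/= mxtrace1 mxtrace_mulC.
have -> : fcal wf_gain gram *m H^t* *m (invmx K *m H) = fcal wf_gain gram *m gram.
  by rewrite /gram !mulmxA.
rewrite -{2}(fcal_id gram_trC) fcalM tr_fcal ReD.
have -> (n : nat) : complex.Re (n%:R : C) = n%:R by rewrite -(rmorph_nat (real_complex R)).
rewrite mulr_sumr /=; congr (_ - _); apply: eq_bigr => k _.
exact: wf_gainM (gram_eig_ge0 k).
Qed.

Lemma hform_wf_prec (u : 'rV[C]_nt) :
  hform wf_prec (u *m H^t*) =
  \sum_k (reig gram k - reig gram k * wf_gain (reig gram k) * reig gram k)%:C *
     `|(u *m (spectralmx gram)^t*) 0 k| ^+ 2.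
Proof.
rewrite -(hform_fcal (fun x => x - x * wf_gain x * x)).
rewrite -(hform_congr (H^t*)) trmxCK; congr (hform _ u).
have -> : H^t* *m wf_prec *m H = gram - gram *m fcal wf_gain gram *m gram.
  by rewrite /wf_prec /gram mulmxBr mulmxBl !mulmxA.
by rewrite -{1 2 4}(fcal_id gram_trC) !fcalM fcalB.
Qed.

Lemma hform_wf_prec_le (u : 'rV[C]_nt) :
  hform wf_prec (u *m H^t*) <= D^-1%:C * \sum_k `|u 0 k| ^+ 2.
Proof.
rewrite hform_wf_prec -(unitary_norm2 u (spectral_unitarymx gram)) mulr_sumr.
apply: ler_sum => k _; rewrite ler_wpM2r ?exprn_ge0//.
by rewrite lecR wf_eig_le// gram_eig_ge0.
Qed.

(** Serves the second alternative of [water_level], where no power equation is available to pay for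
    the input. *)
Lemma hform_wf_prec_eq0 (u : 'rV[C]_nt) :
  (forall k, reig gram k = 0) -> hform wf_prec (u *m H^t*) = 0.
Proof.
move=> e0; rewrite hform_wf_prec big1// => k _.
by rewrite e0 !mulr0 subr0 mul0r.
Qed.

(** The bound is crude; what counts is that it depends on the frequency only through [B1] and [B2].
    The factor [nt%:R * D] comes from [wf_gain] being at most [D]. *)
Lemma wf_prec_entry_le (B1 B2 : R) i j :
  (forall i j, `|invmx K i j| <= B1%:C) -> (forall i j, `|H i j| <= B2%:C) ->
  `|wf_prec i j| <=
    (B1 + \sum_(s < nr) \sum_(r < nt) \sum_(q < nt) \sum_(p < nr)
       B1 * B2 * (nt%:R * D) * B2 * B1)%:C.
Proof.
move=> hB1 hB2; rewrite /wf_prec [X in `|X|]mxE.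
apply: le_trans (ler_normD _ _) _; rewrite rmorphD; apply: lerD => //.
rewrite mxE normrN mxE; apply: le_trans (ler_norm_sum _ _ _) _.
rewrite rmorph_sum; apply: ler_sum => s _.
rewrite mxE mulr_suml; apply: le_trans (ler_norm_sum _ _ _) _.
rewrite rmorph_sum; apply: ler_sum => r _.
rewrite mxE !mulr_suml; apply: le_trans (ler_norm_sum _ _ _) _.
rewrite rmorph_sum; apply: ler_sum => q _.
rewrite mxE !mulr_suml; apply: le_trans (ler_norm_sum _ _ _) _.
rewrite rmorph_sum; apply: ler_sum => p _.
rewrite !normrM !rmorphM !mxE norm_conjC.
have g0 : `|fcal wf_gain gram q r| <= (nt%:R * D)%:C.
  apply: fcal_entry_le => k; have x0 := gram_eig_ge0 k.
  have p0 := wf_power_ge0 (reig gram k); have d1 := wf_den_ge1 x0.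
  rewrite /wf_gain ger0_norm ?divr_ge0// ?(le_trans ler01)//.
  rewrite ler_pdivrMr ?(lt_le_trans ltr01)//.
  apply: (@le_trans _ _ D); last by rewrite ler_peMr// ltW.
  rewrite /wf_power; case: eqP => // _; first exact: ltW.
  by rewrite ge_max ltW//= gerBl invr_ge0.
rewrite rmorphM in g0.
by do 4 (apply: ler_pM => //; rewrite ?mulr_ge0//).
Qed.

End waterfilling.

(** * Block circulant matrices and the discrete Fourier transform *)

Section cis.
Context (R : realType).
Local Open Scope complex_scope.
Local Notation C := R[i].
Local Notation cis := (@cis_neg R).

Lemma cisD x y : cis (x + y) = cis x * cis y.
Proof.
rewrite /cis_neg cosD sinD; apply/eqP; rewrite eq_complex /=.
by apply/andP; split; apply/eqP; ring.
Qed.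

Lemma conjM (x y : C) : ((x * y)^* = (x^*) * (y^*))%R.
Proof. exact: rmorphM. Qed.

Lemma conj_sum I (r : seq I) (P : pred I) (F : I -> C) :
  ((\sum_(i <- r | P i) F i)^* = \sum_(i <- r | P i) (F i)^*)%R.
Proof. exact: rmorph_sum. Qed.

Lemma cis0 : cis 0 = 1.
Proof. by rewrite /cis_neg cos0 sin0 oppr0. Qed.

Lemma conj_cis x : ((cis x)^*)%R = cis (- x).
Proof. by rewrite /cis_neg cosN sinN. Qed.

Lemma cis_norm x : `|cis x| = 1.
Proof. by rewrite normc_def /= sqrrN cos2Dsin2 sqrtr1. Qed.

Lemma cisMn x n : cis (x * n%:R) = cis x ^+ n.
Proof.
elim: n => [|n IH]; first by rewrite mulr0 cis0.
by rewrite -natr1 mulrDr mulr1 cisD IH exprSr.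
Qed.

Lemma cis2pi : cis (2 * pi) = 1.
Proof. by rewrite /cis_neg mulr_natl cos2pi sin2pi oppr0. Qed.

Lemma cisN2pi : cis (- (2 * pi)) = 1.
Proof. by rewrite -conj_cis cis2pi conjC1. Qed.

Lemma cis2pi_int (k : int) : cis (2 * pi * k%:~R) = 1.
Proof.
case: k => k; first by rewrite cisMn cis2pi expr1n.
by rewrite NegzE rmorphN /= mulrN -mulNr cisMn cisN2pi expr1n.
Qed.

Lemma cis_neq1 x : 0 < x < 2 * pi -> cis x != 1.
Proof.
move=> /andP[x0 x1]; rewrite /cis_neg eq_complex /=; apply/nandP; left.
have -> : x = (x / 2) *+ 2 by rewrite -mulr_natr divfK.
rewrite cos_mulr2n -subr_eq0.
have s0 : 0 < sin (x / 2) by apply: sin_gt0_pi; lra.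
have := cos2Dsin2 (x / 2) => cs.
apply/eqP => h; nra.
Qed.

(** Left endpoints of the uniform partition of [-pi, pi], so that sums over j are Riemann sums of
    the spectral integrals. The shift by -pi contributes (-1)^N to [dft_freq_period], hence the
    parity condition there. *)
Definition dft_freq (N : nat) (j : nat) : R := 2 * pi * j%:R / N%:R - pi.

Lemma dft_freq_period N j : (0 < N)%N -> ~~ odd N -> cis (dft_freq N j * N%:R) = 1.
Proof.
move=> N0 evN; rewrite /dft_freq mulrBl divfK ?pnatr_eq0 ?lt0n_neq0//.
have -> : N%:R = 2 * (N./2)%:R :> R.
  by rewrite -[in LHS](odd_double_half N) (negbTE evN) add0n -muln2 natrM mulrC.
have -> : 2 * pi * j%:R - pi * (2 * (N./2)%:R) = 2 * pi * (j%:Z - (N./2)%:Z)%:~R :> R.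
  by rewrite rmorphB /=; ring.
exact: cis2pi_int.
Qed.

(** A geometric sum over an N-th root of unity. The shift by -pi cancels in the difference, so N may
    have any parity here. *)
Lemma dft_ortho N (j k : 'I_N) :
  \sum_(t < N) cis ((dft_freq N j - dft_freq N k) * t%:R) = (N * (j == k))%:R.
Proof.
have N0 : (0 < N)%N by exact: leq_ltn_trans (ltn_ord j).
have NR : N%:R != 0 :> R by rewrite pnatr_eq0 lt0n_neq0.
under eq_bigr do rewrite cisMn; have [->|jk] := eqVneq j k.
  by under eq_bigr do rewrite subrr cis0 expr1n; rewrite sumr_const card_ord muln1.
rewrite muln0; set z := cis _.
have zN : z ^+ N = 1.
  rewrite -cisMn /dft_freq.
  have -> : (2 * pi * j%:R / N%:R - pi - (2 * pi * k%:R / N%:R - pi)) * N%:R =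
      2 * pi * (j%:Z - k%:Z)%:~R :> R by rewrite rmorphB /=; field.
  exact: cis2pi_int.
have z1 : z != 1.
  have lt_cis (a b : 'I_N) : (a < b)%N -> cis (dft_freq N b - dft_freq N a) != 1.
    move=> ab; apply: cis_neq1; rewrite /dft_freq.
    have -> : 2 * pi * b%:R / N%:R - pi - (2 * pi * a%:R / N%:R - pi) =
      2 * pi * ((b%:R - a%:R) / N%:R) :> R by field.
    have p0 : 0 < 2 * pi :> R by rewrite mulr_gt0// pi_gt0.
    have Np : 0 < N%:R :> R by rewrite ltr0n.
    have aN : (b%:R : R) < N%:R by rewrite ltr_nat.
    have a0 : 0 <= (a%:R : R) by [].
    have abR : (a%:R : R) < b%:R by rewrite ltr_nat.
    rewrite pmulr_rgt0// divr_gt0 ?subr_gt0//=.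
    by rewrite gtr_pMr// ltr_pdivrMr// mul1r; lra.
  have [lt|lt|e] := ltngtP j k.
  - have := lt_cis _ _ lt; apply: contra_neq => z1.
    by rewrite -opprB -conj_cis -/z z1 conjC1.
  - exact: lt_cis lt.
  - by move/val_inj: e jk => ->; rewrite eqxx.
have : (z - 1) * \sum_(t < N) z ^+ t = 0 by rewrite -subrX1 zN subrr.
by move/eqP; rewrite mulf_eq0 subr_eq0 (negbTE z1) /= => /eqP.
Qed.

End cis.

Section block_circulant.
Context (R : realType) (N n : nat).
Local Open Scope complex_scope.
Local Open Scope sesquilinear_scope.
Local Notation C := R[i].
Local Notation cis := (@cis_neg R).
Local Notation om := (@dft_freq R N).
Context (Q : 'I_N -> 'M[C]_n).

(** The inverse DFT of the symbol [Q]. As [cis_neg] carries a minus sign, the difference q - p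
    yields the lag p - q of the convention used in [Cfreq]. *)
Definition circ_mx : 'M[C]_(N * n) := \matrix_(p, q)
  (N%:R^-1 * \sum_(j < N) cis (om j * ((block_of q)%:R - (block_of p)%:R)) *
     Q j (offset_of p) (offset_of q)).

Hypothesis pQ : forall j, pdmx (Q j).

(** With [d] and [W], an explicit unitary diagonalisation: the rows of [W] are normalised Fourier
    vectors tensored with the spectral rows of the symbol at that frequency. *)
Let s : C := (Num.sqrt N%:R)^-1%:C.
Let d : 'rV[C]_(N * n) := \row_p spectral_diag (Q (block_of p)) 0 (offset_of p).
Let W : 'M[C]_(N * n) := \matrix_(p, q)
  (s * (spectralmx (Q (block_of p)) (offset_of p) (offset_of q) *
        cis (om (block_of p) * (block_of q)%:R))).

Let sE : s * (s^*)%R = N%:R^-1.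
Proof.
rewrite conj_Creal; last by rewrite realE -[0]/(0%:C) !lecR le_total.
rewrite /s -rmorphM -invfM -expr2 sqr_sqrtr// fmorphV rmorph_nat//.
Qed.

Let W_unitary : (0 < N)%N -> W \is unitarymx.
Proof.
move=> N0; apply/unitarymxP/matrixP => p q; rewrite !mxE big_flat /=.
under eq_bigr => t _ do under eq_bigr => r _ do
  rewrite !mxE block_of_flat offset_of_flat !conjM.
set j := block_of p; set k := block_of q.
have U (a b : 'I_N) (i l : 'I_n) : a = b ->
    \sum_r spectralmx (Q a) i r * ((spectralmx (Q b) l r)^*)%R = (i == l)%:R.
  move=> ->; have /unitarymxP/matrixP/(_ i l) := spectral_unitarymx (Q b).
  by rewrite !mxE => <-; apply: eq_bigr => r _; rewrite !mxE.
transitivity ((s * (s^*)%R) * \sum_(t < N) (cis ((om j - om k) * t%:R) *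
   \sum_r spectralmx (Q j) (offset_of p) r * ((spectralmx (Q k) (offset_of q) r)^*)%R)).
  rewrite mulr_sumr; apply: eq_bigr => t _; rewrite mulr_sumr mulr_sumr.
  apply: eq_bigr => r _; rewrite conj_cis.
  have -> : (om j - om k) * t%:R = om j * t%:R - om k * t%:R by rewrite mulrBl.
  rewrite cisD.
  ring.
rewrite -mulr_suml dft_ortho sE.
have [jk|jk] := eqVneq j k.
  rewrite U// muln1 mulrA mulVf ?pnatr_eq0 ?lt0n_neq0// mul1r.
  congr (_%:R); congr nat_of_bool; apply/eqP/eqP => [e|->//].
  by rewrite -(flat_indexK p) -(flat_indexK q) e -/j -/k jk.
rewrite muln0 mul0r mulr0; case: eqP => // e.
by move: jk; rewrite /j /k e eqxx.
Qed.

Let circ_mxE : circ_mx = W^t* *m diag_mx d *m W.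
Proof.
apply/matrixP => p q; rewrite mul_mx_diag !mxE big_flat /= mulr_sumr.
apply: eq_bigr => j _.
have /matrixP/(_ (offset_of p) (offset_of q)) := hermitian_spectral (pQ j).1.
rewrite mul_mx_diag mxE => ->; rewrite -sE !mulr_sumr; apply: eq_bigr => k _.
rewrite !mxE block_of_flat offset_of_flat !conjM conj_cis mulrBr cisD.
ring.
Qed.

Lemma pdmx_circ : (0 < N)%N -> pdmx circ_mx.
Proof.
move=> N0; rewrite circ_mxE -{2}(trmxCK W); apply: pdmx_congr; last first.
  by apply: pdmx_diag => p; rewrite mxE; exact: pdmx_spectral_gt0.
move=> u /(congr1 (mulmx^~ W)); rewrite mul0mx -mulmxA unitary_trCmul ?mulmx1//.
exact: W_unitary.
Qed.

Lemma det_circ : (0 < N)%N -> \det circ_mx = \prod_j \det (Q j).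
Proof.
move=> N0; rewrite circ_mxE det_unitary_conj ?W_unitary// det_diag big_flat.
apply: eq_bigr => j _; rewrite [in RHS](hermitian_spectral (pQ j).1).
rewrite det_unitary_conj ?spectral_unitarymx// det_diag.
by apply: eq_bigr => r _; rewrite !mxE block_of_flat offset_of_flat.
Qed.

Definition dft (v : 'rV[C]_(N * n)) (j : 'I_N) : 'rV[C]_n :=
  \row_r \sum_(t < N) v 0 (flat_index t r) * cis (- (om j * t%:R)).

Lemma hform_circ v : hform circ_mx v = N%:R^-1 * \sum_j hform (Q j) (dft v j).
Proof.
have E (j : 'I_N) : hform (Q j) (dft v j) = \sum_q \sum_p
    v 0 p * (cis (om j * ((block_of q)%:R - (block_of p)%:R)) *
      Q j (offset_of p) (offset_of q)) * ((v 0 q)^*)%R.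
  rewrite hformE [RHS]big_flat exchange_big; apply: eq_bigr => l _.
  under [RHS]eq_bigr => t _ do rewrite big_flat exchange_big.
  rewrite exchange_big; apply: eq_bigr => k _.
  rewrite !mxE conj_sum mulr_sumr; apply: eq_bigr => t _.
  rewrite !mulr_suml; apply: eq_bigr => t' _.
  rewrite !block_of_flat !offset_of_flat conjM conj_cis opprK mulrBr cisD.
  ring.
rewrite (eq_bigr _ (fun j _ => E j)) hformE [in RHS]exchange_big [RHS]mulr_sumr.
apply: eq_bigr => q _; rewrite [in RHS]exchange_big [RHS]mulr_sumr; apply: eq_bigr => p _.
by rewrite mxE !mulr_sumr mulr_suml; apply: eq_bigr => j _; ring.
Qed.

End block_circulant.

(** * Circular convolution and Parseval's identity *)

Section circular_convolution.
Context (R : realType) (N nr nt m : nat).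
Local Open Scope complex_scope.
Local Open Scope sesquilinear_scope.
Local Notation C := R[i].
Local Notation cis := (@cis_neg R).
Local Notation om := (@dft_freq R N).
Context (G : 'I_m.+1 -> 'M[R]_(nr, nt)) (z : 'I_N -> 'I_nt -> R).

(* N * k - k rather than - k, to avoid truncated subtraction modulo N. *)
Definition cyc (t : 'I_N) (k : nat) : 'I_N :=
  Ordinal (ltn_pmod (t + (N * k - k)) (leq_ltn_trans (leq0n t) (ltn_ord t))).

Definition circ_conv (t : 'I_N) (r : 'I_nr) : R :=
  \sum_(tau < m.+1) \sum_k G tau r k * z (cyc t tau) k.

Definition xhat (j : 'I_N) : 'rV[C]_nt :=
  \row_k \sum_(t < N) (z t k)%:C * cis (- (om j * t%:R)).

Hypothesis N_gt0 : (0 < N)%N.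
Hypothesis evN : ~~ odd N.

Lemma cyc_cis (j t : 'I_N) k :
  cis (- (om j * t%:R)) = cis (- (om j * (cyc t k : nat)%:R)) * cis (- (om j * k%:R)).
Proof.
rewrite -!conj_cis -conjM; congr ((_^*)%R); rewrite -cisD.
have kNk : (k <= N * k)%N by rewrite leq_pmull.
(* Undoing the reduction modulo N: the wrapped index plus k differs from t by an integer multiple of
   N, which [dft_freq_period] makes invisible. *)
have e : ((t + (N * k - k)) %/ N * N + cyc t k + k = t + k * N)%N.
  by rewrite -divn_eq -addnA subnK// mulnC.
have eR : (cyc t k : nat)%:R + k%:R =
    t%:R + ((k%:Z - ((t + (N * k - k)) %/ N)%:Z)%:~R * N%:R) :> R.
  move/(congr1 (fun x : nat => x%:R : R)): e; rewrite !natrD !natrM => e.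
  by rewrite rmorphB /= mulrBl; lra.
rewrite -mulrDr eR mulrDr cisD.
have -> : cis (om j * ((k%:Z - ((t + (N * k - k)) %/ N)%:Z)%:~R * N%:R)) = 1; last by rewrite mulr1.
case: (k%:Z - _) => q; rewrite mulrCA mulrC.
  by rewrite cisMn dft_freq_period// expr1n.
rewrite NegzE rmorphN mulrN -conj_cis cisMn dft_freq_period// expr1n.
exact: conjC1.
Qed.

Lemma cyc_bij k : bijective (cyc^~ k).
Proof.
apply: injF_bij => s t /(congr1 val) /= e; apply/val_inj/eqP => /=.
move/eqP: e; rewrite eqn_modDr => /eqP.
by rewrite !modn_small// => ->.
Qed.

(** The convolution theorem. [dft] and [xhat] use the exponent +j om t on row vectors, so [Gfreq]
    enters through its conjugate transpose. *)
Lemma dft_circ_conv j :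
  dft (\row_p (circ_conv (block_of p) (offset_of p))%:C) j = xhat j *m (Gfreq G (om j))^t*.
Proof.
apply/rowP => r; rewrite !mxE.
under eq_bigr do rewrite mxE block_of_flat offset_of_flat.
under [RHS]eq_bigr => k _ do rewrite !mxE summxE conj_sum mulr_sumr.
rewrite [RHS]exchange_big.
transitivity (\sum_(t < N) \sum_(tau < m.+1) \sum_k
    (z (cyc t tau) k)%:C * cis (- (om j * (cyc t tau : nat)%:R)) *
    ((G tau r k)%:C * cis (- (om j * tau%:R)))).
  apply: eq_bigr => t _; rewrite /circ_conv rmorph_sum mulr_suml; apply: eq_bigr => tau _.
  rewrite rmorph_sum mulr_suml; apply: eq_bigr => k _.
  by rewrite (cyc_cis j t tau) rmorphM; ring.
rewrite [LHS]exchange_big; apply: eq_bigr => tau _.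
rewrite [LHS]exchange_big; apply: eq_bigr => k _.
rewrite !mxE conjM conj_cis.
have -> : (((G tau r k)%:C)^*)%R = (G tau r k)%:C.
  by rewrite conj_Creal// realE -[0]/(0%:C) !lecR le_total.
rewrite -mulr_suml (mulrC (cis _)); congr (_ * _).
by rewrite [RHS](reindex (cyc^~ tau))//; exact/onW_bij/cyc_bij.
Qed.

(** [dft_ortho] with time and frequency exchanged. The shift by -pi leaves a phase, equal to 1 on
    the diagonal and multiplied by 0 off it. *)
Lemma dft_ortho_time (t s : 'I_N) :
  \sum_(j < N) cis (om j * (s%:R - t%:R)) = (N * (t == s))%:R.
Proof.
have NR : N%:R != 0 :> R by rewrite pnatr_eq0 lt0n_neq0.
transitivity (cis (- (pi * (s%:R - t%:R))) * \sum_(j < N) cis ((om s - om t) * j%:R)).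
  rewrite mulr_sumr; apply: eq_bigr => j _; rewrite -cisD /dft_freq; congr cis.
  by field.
rewrite dft_ortho eq_sym; have [->|_] := eqVneq t s; last by rewrite muln0 mulr0.
by rewrite subrr mulr0 oppr0 cis0 mul1r.
Qed.

Lemma parseval k :
  \sum_(j < N) `|xhat j 0 k| ^+ 2 = (N%:R * \sum_(t < N) z t k ^+ 2)%:C.
Proof.
transitivity (\sum_(j < N) \sum_(t < N) \sum_(s < N)
    (z t k)%:C * (z s k)%:C * cis (om j * (s%:R - t%:R))).
  apply: eq_bigr => j _; rewrite normCK mxE conj_sum mulr_suml.
  apply: eq_bigr => t _; rewrite mulr_sumr; apply: eq_bigr => s _.
  rewrite conjM conj_cis opprK mulrBr cisD.
  have -> : (((z s k)%:C)^*)%R = (z s k)%:C.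
    by rewrite conj_Creal// realE -[0]/(0%:C) !lecR le_total.
  by ring.
rewrite exchange_big mulr_sumr rmorph_sum; apply: eq_bigr => t _.
rewrite exchange_big (bigD1 t)//= [X in _ + X]big1 => [|s st].
  by rewrite -mulr_sumr dft_ortho_time eqxx muln1 addr0 rmorphM rmorph_nat expr2 rmorphM; ring.
by rewrite -mulr_sumr dft_ortho_time eq_sym (negbTE st) muln0 mulr0.
Qed.

End circular_convolution.

(** * The noise spectrum *)

Section toeplitz.
Context (R : realType).

Lemma sum_ord_lt (N m : nat) : (\sum_(t < N) (t < m) <= m)%N.
Proof.
suff: (\sum_(t < N) (t < m) <= minn N m)%N by lia.
elim: N => [|N IH]; first by rewrite big_ord0.
rewrite big_ord_recr /=; move: IH; set x := (\sum_(i < N) _)%N.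
by case: (ltnP N m) => h /=; lia.
Qed.

(** Each of the 2m + 1 diagonals in the band has between N - 2m and N entries in the square, so
    counting N for each errs by at most 2m. *)
Lemma toeplitz_sum (c : int -> R) (m N : nat) :
  (forall tau, (m%:Z < `|tau|)%R -> c tau = 0) ->
  `|\sum_(t < N) \sum_(s < N) c (t%:Z - s%:Z)
    - N%:R * \sum_(k < m.*2.+1) c (k%:Z - m%:Z)|
  <= (m.*2)%:R * \sum_(k < m.*2.+1) `|c (k%:Z - m%:Z)|.
Proof.
move=> c0; pose b (k : 'I_m.*2.+1) (t s : 'I_N) := k%:Z - m%:Z == t%:Z - s%:Z.
have E (t s : 'I_N) : c (t%:Z - s%:Z) = \sum_(k < m.*2.+1) c (k%:Z - m%:Z) * (b k t s)%:R.
  have [h|h] := leP `|t%:Z - s%:Z|%R m%:Z; last first.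
    rewrite c0// big1// => k _; case e : (b k t s); last by rewrite mulr0.
    by move/eqP: e => ->; rewrite c0// mul0r.
  have hk : (absz (t%:Z - s%:Z + m%:Z)%R < m.*2.+1)%N by lia.
  rewrite (bigD1 (Ordinal hk))//= big1 => [|k kn].
    rewrite /b/= addr0 (_ : (absz (t%:Z - s%:Z + m%:Z))%:Z - m%:Z = t%:Z - s%:Z); last by lia.
    by rewrite eqxx mulr1.
  rewrite (_ : b k t s = false) ?mulr0//; apply/negP => /eqP e.
  by move/eqP: kn; apply; apply/val_inj => /=; lia.
pose n k := (\sum_(t < N) \sum_(s < N) b k t s)%N.
have -> : \sum_(t < N) \sum_(s < N) c (t%:Z - s%:Z) =
    \sum_(k < m.*2.+1) c (k%:Z - m%:Z) * (n k)%:R.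
  under eq_bigr do under eq_bigr do rewrite E.
  under eq_bigr do rewrite exchange_big.
  rewrite exchange_big; apply: eq_bigr => k _.
  rewrite /n natr_sum mulr_sumr; apply: eq_bigr => t _.
  by rewrite natr_sum mulr_sumr.
rewrite mulr_sumr -sumrB mulr_sumr.
apply: le_trans (ler_norm_sum _ _ _) _; apply: ler_sum => k _.
rewrite (mulrC N%:R) -mulrBr normrM mulrC ler_wpM2r//.
have row_le1 (t : 'I_N) : (\sum_(s < N) b k t s <= 1)%N.
  have [[s0 bs0]|h] := pselect (exists s, b k t s); last first.
    rewrite big1// => s _; case e : (b k t s) => //; exfalso; apply: h; by exists s.
  rewrite (bigD1 s0)//= bs0 big1// => s ss0.
  have [] := boolP (b k t s) => // bs; exfalso; move/eqP: ss0; apply; apply/val_inj => /=.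
  by move: bs bs0; rewrite /b => /eqP e1 /eqP; lia.
have n_le : (n k <= N)%N.
  rewrite -[leqRHS]card_ord -sum1_card; exact: leq_sum.
have n_ge : (N <= n k + m.*2)%N.
  (* A time at distance at least m from both ends has its partner inside the square; the two
     indicators pay for the others, at most m at each end. *)
  have tt (t : 'I_N) : (1 <= \sum_(s < N) b k t s + ((t < m) + (N <= t + m)))%N.
    have [/andP[h1 h2]|h] := boolP ((m <= t) && (t + m < N))%N; last first.
      by move: h; rewrite negb_and; lia.
    have hs : (t + m - k < N)%N by lia.
    rewrite (bigD1 (Ordinal hs))//= (_ : b k t (Ordinal hs) = true) //.
    by apply/eqP => /=; have := ltn_ord k; lia.
  have := @leq_sum _ (index_enum 'I_N) xpredT _ _ (fun t _ => tt t).
  rewrite sum1_card card_ord !big_split /= -/(n k).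
  have h1 := sum_ord_lt N m; rewrite -/(n k).
  have h2 : (\sum_(t < N) (N <= t + m) <= m)%N.
    apply: leq_trans h1; rewrite [leqRHS](reindex_inj rev_ord_inj)/=.
    by apply: leq_sum => t _; have := ltn_ord t; lia.
  move=> h; apply: leq_trans h _; rewrite leq_add2l -addnn; exact: leq_add h1 h2.
rewrite ler_norml; apply/andP; split.
  by have := n_ge; rewrite -(ler_nat R) natrD; lra.
by rewrite (@le_trans _ _ 0)// subr_le0 ler_nat.
Qed.

End toeplitz.

Section spectral_density.
Context d (Omega : measurableType d) (R : realType) (P : probability Omega R).
Context (n : nat) (W : int -> {RV P >-> vec R n}).
Context (m : nat) (f : forall k, block R n k -> R).
Hypothesis hW : noise_process W m f.
Local Open Scope complex_scope.
Local Open Scope sesquilinear_scope.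
Local Notation C := R[i].
Local Notation cis := (@cis_neg R).

Definition cmx (A : 'M[R]_n) : 'M[C]_n := map_mx (real_complex R) A.

Lemma conj_real (x : R) : ((x%:C)^*)%R = x%:C.
Proof. by rewrite conj_Creal// realE -[0]/(0%:C) !lecR le_total. Qed.

Lemma trCE n1 n2 (A : 'M[C]_(n1, n2)) i j : A^t* i j = ((A j i)^*)%R.
Proof. by rewrite !mxE. Qed.

Lemma ReZ (x : R) (z : C) : complex.Re (x%:C * z) = x * complex.Re z.
Proof. by case: z => a b /=; rewrite mul0r subr0. Qed.

Lemma CfreqE w : Cfreq m (autocorr W) w =
  \sum_(k < m.*2.+1) cis (w * (k%:Z - m%:Z)%:~R) *: cmx (autocorr W (k%:Z - m%:Z)).
Proof. by []. Qed.

Lemma Cfreq_entry w r s : Cfreq m (autocorr W) w r s =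
  \sum_(k < m.*2.+1) cis (w * (k%:Z - m%:Z)%:~R) * (autocorr W (k%:Z - m%:Z) r s)%:C.
Proof.
rewrite CfreqE summxE; apply: eq_bigr => k _.
by rewrite [LHS]mxE; congr (_ * _); rewrite /cmx [LHS]mxE.
Qed.

Lemma Cfreq_trC w : (Cfreq m (autocorr W) w)^t* = Cfreq m (autocorr W) w.
Proof.
apply/matrixP => r s; rewrite trCE !Cfreq_entry conj_sum.
rewrite [RHS](reindex_inj rev_ord_inj); apply: eq_bigr => k _.
rewrite conjM conj_cis conj_real.
have -> : (rev_ord k : nat)%:Z - m%:Z = - (k%:Z - m%:Z) by have := ltn_ord k; rewrite /=; lia.
by rewrite (autocorr_sym hW) rmorphN mulrN.
Qed.

Lemma Cfreq_entry_conj w r s : Cfreq m (autocorr W) w s r =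
  \sum_(k < m.*2.+1) cis (- (w * (k%:Z - m%:Z)%:~R)) * (autocorr W (k%:Z - m%:Z) r s)%:C.
Proof.
rewrite -Cfreq_trC trCE Cfreq_entry conj_sum; apply: eq_bigr => k _.
by rewrite conjM conj_cis conj_real.
Qed.

(** The sum is the mean of the squared modulus of a linear combination of the noise, obtained from
    [noise_quad] with a rank-one matrix. *)
Lemma rank1_cov_ge0 k (u : 'I_(k * n) -> C) :
  0 <= \sum_q \sum_p complex.Re (u p * ((u q)^*)%R) * block_cov W p q.
Proof.
pose Q : 'M[C]_(k * n) := \matrix_(p, q) (u p * ((u q)^*)%R).
have [_] := noise_quad hW Q 0.
have -> : \sum_q \sum_p complex.Re (Q p q) * (block_cov W p q +
        (0 : 'rV[R]_(k * n)) 0 p * (0 : 'rV[R]_(k * n)) 0 q) =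
    \sum_q \sum_p complex.Re (u p * ((u q)^*)%R) * block_cov W p q.
  apply: eq_bigr => q _; apply: eq_bigr => p _.
  by rewrite [Q p q]mxE [X in _ + X * _]mxE mul0r addr0.
move=> <-; apply: Rintegral_ge0 => t _; rewrite addr0.
set v := brow _; suff: 0 <= hform Q (rvec v) by rewrite /qr lecE => /andP[].
have -> : hform Q (rvec v) = `|\sum_p (rvec v) 0 p * u p| ^+ 2.
  rewrite hformE normCK conj_sum mulr_sumr; apply: eq_bigr => q _.
  rewrite mulr_suml; apply: eq_bigr => p _.
  by rewrite [Q p q]mxE conjM; ring.
by rewrite exprn_ge0.
Qed.

Let corr w (v : 'rV[C]_n) (tau : int) : R :=
  complex.Re (cis (w * tau%:~R) * hform (cmx (autocorr W tau)) v).

Lemma corr_sum_ge0 w v N :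
  0 <= \sum_(t < N) \sum_(s < N) corr w v (t%:Z - s%:Z).
Proof.
have := @rank1_cov_ge0 N (fun p => cis (w * (block_of p : nat)%:R) * v 0 (offset_of p)).
congr (0 <= _); rewrite [RHS]exchange_big [LHS]big_flat; apply: eq_bigr => s _.
rewrite [LHS]exchange_big [LHS]big_flat; apply: eq_bigr => t _.
rewrite /corr hformE mulr_sumr Re_sum exchange_big; apply: eq_bigr => r' _.
rewrite mulr_sumr Re_sum; apply: eq_bigr => r _.
rewrite /block_cov !block_of_flat !offset_of_flat conjM conj_cis.
have -> : cis (w * (t%:Z - s%:Z)%:~R) = cis (w * t%:R) * cis (- (w * s%:R)).
  by rewrite -cisD -mulrBr rmorphB.
rewrite [cmx _ _ _]mxE; set a := autocorr _ _ _ _.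
set x := cis _; set y := cis _; case: x y (v 0 r) ((v 0 r')^*)%R => [x x'] [y y'] [z z'] [q q'].
by rewrite /=; ring.
Qed.

Let corr_Cfreq w v :
  \sum_(k < m.*2.+1) corr w v (k%:Z - m%:Z) = complex.Re (hform (Cfreq m (autocorr W) w) v).
Proof.
rewrite CfreqE -Re_sum; congr complex.Re.
rewrite /hform mulmx_sumr mulmx_suml summxE; apply: eq_bigr => k _.
by rewrite -scalemxAr -scalemxAl [RHS]mxE.
Qed.

(** The mean energy of the Fourier sum of N noise samples is N times this form up to a constant, by
    [toeplitz_sum]. A negative value would make that energy negative for large N. *)
Lemma Cfreq_ge0 w v : 0 <= hform (Cfreq m (autocorr W) w) v.
Proof.
have real : hform (Cfreq m (autocorr W) w) v \is Num.real.
  rewrite CrealE; apply/eqP; rewrite /hform -trCE; congr (fun_of_matrix _ 0 0).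
  by rewrite !trCM trmxCK Cfreq_trC mulmxA.
rewrite -(RRe_real real) lecR leNgt; apply/negP => lt0.
set x := complex.Re _ in lt0.
pose B := \sum_(k < m.*2.+1) `|corr w v (k%:Z - m%:Z)|.
have B0 : 0 <= B by exact: sumr_ge0.
have key N : 0 <= N%:R * x + (m.*2)%:R * B.
  have c0 tau : (m%:Z < `|tau|)%R -> corr w v tau = 0.
    move=> h; rewrite /corr (_ : cmx _ = 0) ?/hform ?mulmx0 ?mul0mx ?mxE ?mulr0//.
    by apply/matrixP => r s; rewrite /cmx [LHS]mxE (autocorr_eq0 hW)// [RHS]mxE.
  have := toeplitz_sum N c0; rewrite corr_Cfreq -/x -/B ler_norml => /andP[_ h].
  have := corr_sum_ge0 w v N; lra.
have [N hN] : exists N : nat, (m.*2)%:R * B / - x < N%:R.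
  by exists (Num.bound ((m.*2)%:R * B / - x)); apply: archi_boundP; rewrite divr_ge0 ?mulr_ge0// oppr_ge0 ltW.
have := key N; apply/negP; rewrite -ltNge.
by move: hN; rewrite ltr_pdivrMr ?oppr_gt0//; lra.
Qed.

Lemma pdmx_Cfreq w : Cfreq m (autocorr W) w \in unitmx -> pdmx (Cfreq m (autocorr W) w).
Proof.
set K := Cfreq _ _ _ => uK; have hK : K^t* = K := Cfreq_trC w.
have uP := spectral_unitarymx K.
have E := hermitian_spectral hK.
rewrite E -{2}(trmxCK (spectralmx K)); apply: pdmx_congr.
  move=> u /(congr1 (mulmx^~ (spectralmx K))).
  by rewrite mul0mx -mulmxA unitary_trCmul// mulmx1.
apply: pdmx_diag => i.
have dE : hform K (row i (spectralmx K)) = spectral_diag K 0 i.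
  rewrite {1}E -{2}(trmxCK (spectralmx K)) hform_congr -row_mul (unitarymxP uP) row1 hform_diag.
  rewrite (bigD1 i)//= mxE !eqxx normr1 expr1n mulr1 big1 ?addr0// => j ji.
  by rewrite mxE eqxx/= (negbTE ji) normr0 expr0n mulr0.
have := Cfreq_ge0 w (row i (spectralmx K)); rewrite -/K dE le_eqVlt => /orP[/eqP d0|//].
have : \det K != 0 by rewrite -unitfE -unitmxE.
rewrite E det_unitary_conj// det_diag => /eqP; case.
by apply/eqP/prodf_eq0; exists i => //; rewrite -d0.
Qed.

(** Covariance vanishes beyond lag m, so only a band of the circulant matters. There the sum is a
    Toeplitz sum, whose main term is the trace of the symbols against the noise spectrum, with a
    border error independent of N. *)
Lemma circ_trace N (Q : 'I_N -> 'M[C]_n) (B : R) :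
  (0 < N)%N -> (forall j r s, `|Q j r s| <= B%:C) ->
  \sum_q \sum_p complex.Re (circ_mx Q p q) * block_cov W p q <=
  \sum_j complex.Re (\tr (Q j *m Cfreq m (autocorr W) (dft_freq R N j))) +
  (m.*2)%:R * \sum_(k < m.*2.+1) \sum_r \sum_s B * `|autocorr W (k%:Z - m%:Z) r s|.
Proof.
move=> N0 QB.
have NR : N%:R != 0 :> R by rewrite pnatr_eq0 lt0n_neq0.
have Np : 0 < N%:R :> R by rewrite ltr0n.
(* The contribution of one pair of times at lag tau: entries of the circulant against the
   autocorrelation. *)
pose c (tau : int) : R := N%:R^-1 * \sum_(j < N) \sum_r \sum_s
  complex.Re (cis (- (dft_freq R N j * tau%:~R)) * Q j r s) * autocorr W tau r s.
have c0 tau : (m%:Z < `|tau|)%R -> c tau = 0.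
  move=> h; rewrite /c big1 ?mulr0// => j _; rewrite big1// => r _; rewrite big1// => s _.
  by rewrite (autocorr_eq0 hW)// mulr0.
have -> : \sum_q \sum_p complex.Re (circ_mx Q p q) * block_cov W p q =
    \sum_(t < N) \sum_(s < N) c (t%:Z - s%:Z).
  rewrite [RHS]exchange_big [LHS]big_flat; apply: eq_bigr => s _.
  rewrite [LHS]exchange_big [LHS]big_flat; apply: eq_bigr => t _.
  rewrite /c mulr_sumr; under [RHS]eq_bigr do rewrite mulr_sumr.
  rewrite [RHS]exchange_big; apply: eq_bigr => r _.
  under [RHS]eq_bigr do rewrite mulr_sumr.
  rewrite [RHS]exchange_big; apply: eq_bigr => r' _.
  rewrite [circ_mx _ _ _]mxE !block_of_flat !offset_of_flat.
  have -> : (N%:R^-1 : C) = (N%:R^-1 : R)%:C by rewrite fmorphV rmorph_nat.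
  rewrite ReZ Re_sum /block_cov !block_of_flat !offset_of_flat -mulrA mulr_suml mulr_sumr.
  apply: eq_bigr => j _; congr (_ * (complex.Re (cis _ * _) * _)).
  by rewrite rmorphB /= -mulrN opprB.
have traceE : N%:R * \sum_(k < m.*2.+1) c (k%:Z - m%:Z) =
    \sum_j complex.Re (\tr (Q j *m Cfreq m (autocorr W) (dft_freq R N j))).
  rewrite /c -mulr_sumr mulrA mulfV// mul1r exchange_big; apply: eq_bigr => j _.
  rewrite exchange_big /mxtrace Re_sum; apply: eq_bigr => r _.
  rewrite exchange_big [(Q j *m _) r r]mxE Re_sum; apply: eq_bigr => s _.
  rewrite Cfreq_entry_conj mulr_sumr Re_sum; apply: eq_bigr => k _.
  by rewrite mulrA (mulrC _ (_%:C)) ReZ mulrC (mulrC (Q j r s)).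
have := toeplitz_sum N c0; rewrite traceE ler_norml => /andP[_]; rewrite lerBlDl => h.
apply: le_trans h _; rewrite lerD2l ler_wpM2l//; apply: ler_sum => k _.
rewrite /c normrM ger0_norm ?invr_ge0// ler_pdivrMl//.
apply: le_trans (ler_norm_sum _ _ _) _.
have -> : N%:R * \sum_r \sum_s B * `|autocorr W (k%:Z - m%:Z) r s| =
    \sum_(j < N) \sum_r \sum_s B * `|autocorr W (k%:Z - m%:Z) r s|.
  by rewrite sumr_const card_ord mulr_natl.
apply: ler_sum => j _; apply: le_trans (ler_norm_sum _ _ _) _; apply: ler_sum => r _.
apply: le_trans (ler_norm_sum _ _ _) _; apply: ler_sum => s _.
rewrite normrM ler_wpM2r//.
by rewrite -lecR; apply: le_trans (normc_ge_Re _) _; rewrite normrM cis_norm mul1r.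
Qed.

End spectral_density.

(** * Riemann sums of Lipschitz spectral functions *)

Section lipschitz_real.
Context (R : realType) (a b : R).
Hypothesis ab : a <= b.
Local Notation mu := (@lebesgue_measure R).

(** Lipschitz rather than merely continuous, because the Riemann error has to remain bounded after
    multiplication by N. *)
Definition lipR (F : R -> R) := exists2 K : R, 0 <= K &
  {in `[a, b] &, forall x y, `|F x - F y| <= K * `|x - y|}.

Lemma lipR_continuous F : lipR F -> {within `[a, b], continuous F}.
Proof.
case=> K K0 h; apply/subspace_continuousP => x xI.
apply/cvgrPdist_lt => e e0; near=> y.
have yI : y \in `[a, b] by near: y; exact: withinT.
apply: le_lt_trans (h x y xI yI) _.
have : `|x - y| < e / (K + 1).
  near: y; apply: cvg_within; exists (e / (K + 1)) => //=.
  by rewrite divr_gt0// ltr_wpDl.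
rewrite ltr_pdivlMr ?ltr_wpDl//; apply: le_lt_trans.
by rewrite mulrC ler_wpM2l// lerDl.
Unshelve. all: by end_near. Qed.

Lemma lipR_integrable F : lipR F -> mu.-integrable `[a, b] (EFin \o F).
Proof.
move=> /lipR_continuous cF; apply: continuous_compact_integrable cF.
exact: segment_compact.
Qed.

Lemma lipR_cst c : lipR (fun=> c).
Proof. by exists 0 => // x y _ _; rewrite subrr normr0 mul0r. Qed.

Lemma lipRD F H : lipR F -> lipR H -> lipR (fun x => F x + H x).
Proof.
move=> [K K0 hF] [L L0 hH]; exists (K + L); first exact: addr_ge0.
move=> x y xI yI; rewrite opprD addrACA mulrDl.
by apply: le_trans (ler_normD _ _) _; rewrite lerD ?hF ?hH.
Qed.

Lemma Rintegral_step F K x h : 0 <= h -> 0 <= K -> a <= x -> x + h <= b ->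
  mu.-integrable `[a, b] (EFin \o F) ->
  {in `[a, b] &, forall x y, `|F x - F y| <= K * `|x - y|} ->
  `|\int[mu]_(t in `]x, (x + h)]) F t - h * F x| <= K * h ^+ 2.
Proof.
move=> h0 K0 ax xb iF hF.
have sub : `]x, x + h] `<=` `[a, b].
  move=> t /=; rewrite !in_itv/= => /andP[xt tx].
  by rewrite (le_trans ax (ltW xt)) (le_trans tx xb).
have iFx : mu.-integrable `]x, x + h] (EFin \o F) by apply: integrableS iF.
have mux : mu `]x, x + h] = h%:E.
  rewrite lebesgue_measure_itv/= lte_fin ltrDl.
  have [h1|h1] := ltP 0 h; first by rewrite -EFinB addrC addrA addNr add0r.
  by congr (_%:E); apply/eqP; rewrite eq_le h0 h1.
have icst (c : R) : mu.-integrable `]x, x + h] (EFin \o fun=> c).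
  apply: measurable_bounded_integrable => //; first by rewrite /= mux ltry.
  by exists `|c|; split; [exact: num_real|move=> M cM t _; exact: ltW].
have -> : h * F x = \int[mu]_(t in `]x, (x + h)]) F x.
  rewrite Rintegral_cst// mulrC; congr (_ * _); exact: (congr1 fine (esym mux)).
rewrite -RintegralB//.
apply: le_trans (le_normr_Rintegral _ _) _ => //.
  by rewrite (_ : EFin \o _ = (EFin \o F) \- (EFin \o fun=> F x))%E//; exact: integrableB.
have -> : K * h ^+ 2 = \int[mu]_(t in `]x, (x + h)]) (K * h).
  rewrite Rintegral_cst// expr2 mulrA; congr (_ * _); exact: (congr1 fine (esym mux)).
apply: le_Rintegral => //.
  rewrite (_ : EFin \o _ = abse \o ((EFin \o F) \- (EFin \o fun=> F x)))%E//.
  by apply: integrable_abse; exact: integrableB.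
move=> t /= xt; have tI := sub _ xt; move: xt; rewrite in_itv/= => /andP[xt tx].
apply: le_trans (hF t x tI _) _.
  by rewrite in_itv/= ax (le_trans _ xb)// lerDl.
by apply: ler_wpM2l => //; rewrite ger0_norm ?subr_ge0; [lra|exact: ltW].
Qed.

Lemma riemann_sum F : lipR F -> exists B : R, forall N, (0 < N)%N ->
  `|\sum_(j < N) F ((b - a) * j%:R / N%:R + a) * (b - a) - N%:R * \int[mu]_(t in `[a, b]) F t| <= B.
Proof.
move=> lF; have iF := lipR_integrable lF; case: lF => K K0 hF.
(* Each of N cells of width h = (b - a) / N errs by at most K h^2, and the total is multiplied by N
   once more. *)
exists (K * (b - a) ^+ 2) => N N0.
have NR : 0 < N%:R :> R by rewrite ltr0n.
pose h := (b - a) / N%:R; pose p (j : nat) : R := h * j%:R + a.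
have h0 : 0 <= h by rewrite divr_ge0// subr_ge0.
have pS j : p j.+1 = p j + h by rewrite /p -natr1; ring.
have pN : p N = b by rewrite /p /h divfK ?gt_eqF//; ring.
have ap j : a <= p j by rewrite lerDr mulr_ge0.
have pb j : (j <= N)%N -> p j <= b.
  by move=> jN; rewrite -pN lerD2r ler_wpM2l// ler_nat.
have key j : (j <= N)%N ->
    `|\sum_(i < j) h * F (p i) - \int[mu]_(t in `[a, p j]) F t| <= j%:R * (K * h ^+ 2).
  elim: j => [|j IH] jN.
    have -> : p 0%N = a by rewrite /p mulr0 add0r.
    by rewrite big_ord0 set_itv1 Rintegral_set1 subrr normr0 mul0r.
  have iFj : mu.-integrable `[a, p j.+1] (EFin \o F).
    by apply: integrableS iF => //; apply: subset_itvl; rewrite bnd_simp pb.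
  have := @Rintegral_itvB R F (BLeft a) (BRight (p j.+1)) (p j) iFj.
  rewrite !bnd_simp pS lerDl ap h0 => /(_ isT isT) E.
  have := @Rintegral_step F K (p j) h h0 K0 (ap j); rewrite -pS pb// => /(_ isT iF hF).
  rewrite -pS in E; rewrite -E big_ord_recr /= -natr1 mulrDl mul1r => st.
  have {}IH := IH (ltnW jN).
  apply: le_trans (lerD IH st); rewrite -normrN addrC -(normrN (_ - _ - _)).
  apply: le_trans (ler_normD _ _); rewrite normrN le_eqVlt; apply/orP; left; apply/eqP.
  by congr `|_|; ring.
have := key N (leqnn _); rewrite pN => {}key.
have -> : \sum_(j < N) F ((b - a) * j%:R / N%:R + a) * (b - a) = N%:R * \sum_(i < N) h * F (p i).
  rewrite mulr_sumr; apply: eq_bigr => j _.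
  by rewrite /p /h (mulrAC (b - a)); field; rewrite gt_eqF.
rewrite -mulrBr normrM ger0_norm; last exact: ltW.
apply: le_trans (ler_wpM2l (ltW NR) key) _.
rewrite le_eqVlt; apply/orP; left; apply/eqP; rewrite /h; field; rewrite gt_eqF//.
Qed.

End lipschitz_real.

Lemma normc_real (R : realType) (x : R) : (`|x%:C| = `|x|%:C)%C.
Proof. by rewrite normc_def /= expr0n addr0 sqrtr_sqr. Qed.

(** * Lipschitz calculus for complex entries, determinants and inverses *)

Section lipschitz_complex.
Context (R : realType) (a b : R).
Hypothesis ab : a <= b.
Local Open Scope complex_scope.
Local Open Scope sesquilinear_scope.
Local Notation C := R[i].
Local Notation cis := (@cis_neg R).

Definition lipC (F : R -> C) := exists2 K : R, 0 <= K &
  {in `[a, b] &, forall x y, `|F x - F y| <= (K * `|x - y|)%:C}.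

Definition bndC (F : R -> C) := exists2 B : R, 0 <= B &
  {in `[a, b], forall x, `|F x| <= B%:C}.

Lemma lipC_bnd F : lipC F -> bndC F.
Proof.
move=> [K K0 h]; have aI : a \in `[a, b] by rewrite in_itv/= lexx.
exists (complex.Re `|F a| + K * (b - a)).
  rewrite addr_ge0 ?mulr_ge0 ?subr_ge0//.
  by have := normr_ge0 (F a); rewrite lecE => /andP[].
move=> x xI; rewrite -(subrKC (F a) (F x)); apply: le_trans (ler_normD _ _) _.
rewrite rmorphD /=; apply: lerD.
  by rewrite -{1}(RRe_real (ger0_real (normr_ge0 (F a)))).
apply: le_trans (h x a xI aI) _; rewrite lecR ler_wpM2l//.
move: xI; rewrite in_itv/= => /andP[ax xb].
by rewrite ger0_norm ?subr_ge0// lerD2r.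
Qed.

Lemma lipC_cst c : lipC (fun=> c).
Proof. by exists 0 => // x y _ _; rewrite subrr normr0 mul0r. Qed.

Lemma lipCD F H : lipC F -> lipC H -> lipC (fun x => F x + H x).
Proof.
move=> [K K0 hF] [L L0 hH]; exists (K + L); first exact: addr_ge0.
move=> x y xI yI; rewrite opprD addrACA mulrDl rmorphD.
by apply: le_trans (ler_normD _ _) _; rewrite lerD ?hF ?hH.
Qed.

Lemma lipCM F H : lipC F -> lipC H -> lipC (fun x => F x * H x).
Proof.
move=> lF lH; have [A A0 bF] := lipC_bnd lF; have [B B0 bH] := lipC_bnd lH.
case: lF => K K0 hF; case: lH => L L0 hH.
exists (A * L + K * B); first by rewrite addr_ge0 ?mulr_ge0.
move=> x y xI yI.
have -> : F x * H x - F y * H y = F x * (H x - H y) + (F x - F y) * H y by ring.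
apply: le_trans (ler_normD _ _) _; rewrite !normrM.
apply: (@le_trans _ _ (A%:C * (L * `|x - y|)%:C + (K * `|x - y|)%:C * B%:C)).
  apply: lerD; apply: ler_pM => //; [exact: bF|exact: hH|exact: hF|exact: bH].
rewrite -!rmorphM -rmorphD lecR le_eqVlt; apply/orP; left; apply/eqP; ring.
Qed.

Lemma lipCconj F : lipC F -> lipC (fun x => (F x)^*)%R.
Proof.
by move=> [K K0 hF]; exists K => // x y xI yI; rewrite -rmorphB norm_conjC hF.
Qed.

Lemma lipCZ c F : lipC F -> lipC (fun x => c * F x).
Proof. exact/lipCM/lipC_cst. Qed.

Lemma lipC_sum I (r : seq I) (F : I -> R -> C) :
  (forall i, lipC (F i)) -> lipC (fun x => \sum_(i <- r) F i x).
Proof.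
move=> lF; elim: r => [|i r IH].
  by under eq_fun do rewrite big_nil; exact: lipC_cst.
by under eq_fun do rewrite big_cons; exact: lipCD.
Qed.

Lemma lipC_prod I (r : seq I) (F : I -> R -> C) :
  (forall i, lipC (F i)) -> lipC (fun x => \prod_(i <- r) F i x).
Proof.
move=> lF; elim: r => [|i r IH].
  by under eq_fun do rewrite big_nil; exact: lipC_cst.
by under eq_fun do rewrite big_cons; exact: lipCM.
Qed.

Lemma lipC_inv F (c : R) : 0 < c -> {in `[a, b], forall x, c%:C <= `|F x|} ->
  lipC F -> lipC (fun x => (F x)^-1).
Proof.
move=> c0 hc [K K0 hF]; exists (c^-1 * K * c^-1).
  by rewrite !mulr_ge0// invr_ge0 ltW.
have cC : 0 < c%:C by rewrite ltcR.
have inv_le x : x \in `[a, b] -> `|(F x)^-1| <= (c^-1)%:C.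
  by move=> xI; rewrite normfV fmorphV lef_pV2 ?posrE ?hc// (lt_le_trans cC (hc x xI)).
have n0 x : x \in `[a, b] -> F x != 0.
  by move=> xI; rewrite -normr_gt0 (lt_le_trans cC (hc x xI)).
move=> x y xI yI.
have -> : (F x)^-1 - (F y)^-1 = (F x)^-1 * (F y - F x) * (F y)^-1.
  by field; rewrite !n0.
rewrite !normrM.
have -> : c^-1 * K * c^-1 * `|x - y| = c^-1 * (K * `|x - y|) * c^-1 by ring.
rewrite 2!rmorphM; apply: ler_pM => //.
  by apply: ler_pM => //; [exact: inv_le|rewrite distrC hF].
exact: inv_le.
Qed.

Lemma lipC_det n (A : R -> 'M[C]_n) :
  (forall i j, lipC (fun x => A x i j)) -> lipC (fun x => \det (A x)).
Proof. by move=> lA; apply: lipC_sum => s; apply/lipCZ/lipC_prod. Qed.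

Lemma lipC_mulmx n p q (A : R -> 'M[C]_(n, p)) (B : R -> 'M[C]_(p, q)) :
  (forall i j, lipC (fun x => A x i j)) -> (forall i j, lipC (fun x => B x i j)) ->
  forall i j, lipC (fun x => (A x *m B x) i j).
Proof.
move=> lA lB i j; under eq_fun do rewrite mxE.
by apply: lipC_sum => k; exact: lipCM.
Qed.

Lemma lipC_trC n p (A : R -> 'M[C]_(n, p)) :
  (forall i j, lipC (fun x => A x i j)) -> forall i j, lipC (fun x => (A x)^t* i j).
Proof. by move=> lA i j; under eq_fun do rewrite trCE; exact: lipCconj. Qed.

Lemma lipC_invmx n (A : R -> 'M[C]_n) (c : R) : (0 < c) ->
  {in `[a, b], forall x, c%:C <= `|\det (A x)|} -> (forall x, A x \in unitmx) ->
  (forall i j, lipC (fun x => A x i j)) ->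
  forall i j, lipC (fun x => invmx (A x) i j).
Proof.
move=> c0 hc uA lA i j.
(* Cramer's formula reduces the inverse to determinants and one scalar inverse that stays
   bounded. *)
have -> : (fun x => invmx (A x) i j) = fun x => (\det (A x))^-1 * cofactor (A x) j i.
  by apply/funext => x; rewrite /invmx uA mxE mxE.
apply: lipCM; first exact: lipC_inv c0 hc (lipC_det lA).
apply/lipCZ/lipC_det => k l; under eq_fun do rewrite !mxE; exact: lA.
Qed.

Lemma lip_sin (x y : R) : `|sin x - sin y| <= `|x - y|.
Proof.
wlog xy : x y / y <= x => [hw|].
  by have [/hw//|/ltW/hw] := leP y x; rewrite distrC (distrC y).
have [|z _ ->] := @MVT_segment R sin cos y x xy.
  by apply: continuous_subspaceT => z; exact: continuous_sin.
by rewrite normrM ler_piMl// ler_norml cos_geN1 cos_le1.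
Qed.

Lemma lip_cos (x y : R) : `|cos x - cos y| <= `|x - y|.
Proof.
wlog xy : x y / y <= x => [hw|].
  by have [/hw//|/ltW/hw] := leP y x; rewrite distrC (distrC y).
have [|z _ ->] := @MVT_segment R cos (fun x => - sin x) y x xy.
  by apply: continuous_subspaceT => z; exact: continuous_cos.
by rewrite normrM ler_piMl// normrN ler_norml sin_geN1 sin_le1.
Qed.

Lemma lipC_cis c : lipC (fun x => cis (x * c)).
Proof.
exists (2 * `|c|); first by rewrite mulr_ge0.
move=> x y _ _; rewrite /cis_neg; set p := x * c; set q := y * c.
have -> : (cos p -i* sin p) - (cos q -i* sin q) =
    (cos p - cos q)%:C + (0 -i* 1) * (sin p - sin q)%:C.
  by apply/eqP; rewrite eq_complex /=; apply/andP; split; apply/eqP; ring.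
apply: le_trans (ler_normD _ _) _; rewrite normrM [`|0 -i* 1|]normc_def /= expr0n add0r sqrrN expr1n sqrtr1 mul1r !normc_real.
rewrite -rmorphD lecR; apply: le_trans (lerD (lip_cos _ _) (lip_sin _ _)) _.
by rewrite -mulrBl normrM; lra.
Qed.

(** The modulus attains its minimum on the compact interval. This turns pointwise invertibility of
    the noise spectrum into a uniform bound. *)
Lemma lipC_abs_bound F : lipC F -> {in `[a, b], forall x, F x != 0} ->
  exists2 c : R, 0 < c & {in `[a, b], forall x, c%:C <= `|F x|}.
Proof.
move=> [K K0 h] F0.
have absE x : `|F x| = (complex.Re `|F x|)%:C by rewrite RRe_real// ger0_real.
have lF : lipR a b (fun x => complex.Re `|F x|).
  exists K => // x y xI yI; rewrite -lecR; apply: le_trans (h x y xI yI).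
  by rewrite -normc_real rmorphB /= -!absE ler_dist_dist.
have [x0 x0I hx0] := EVT_min ab (lipR_continuous lF).
exists (complex.Re `|F x0|); first by rewrite -ltcR -absE normr_gt0 F0.
by move=> x xI; rewrite absE lecR hx0.
Qed.

End lipschitz_complex.

(** * Lipschitz dependence of eigenvalue sums *)

Section spectral_lipschitz.
Context (R : realType).
Local Open Scope complex_scope.
Local Open Scope sesquilinear_scope.
Local Notation C := R[i].

(* In the eigenbases of A on the left and of B on the right, the entries of
   g(A) - g(B) are those of A - B multiplied by difference quotients of g. *)
Lemma reig_sum_lipschitz n (A B : 'M[C]_n) (g : R -> R) (L : R) :
  0 <= L -> A^t* = A -> B^t* = B ->
  (forall i j, `|g (reig A i) - g (reig B j)| <= L * `|reig A i - reig B j|) ->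
  `|\sum_k g (reig A k) - \sum_k g (reig B k)|%:C <=
    (n ^ 3)%:R * L%:C * \sum_i \sum_j `|A i j - B i j|.
Proof.
move=> L0 hA hB hg.
set U := spectralmx A; set V := spectralmx B.
have uU : U \is unitarymx := spectral_unitarymx A.
have uV : V \is unitarymx := spectral_unitarymx B.
pose E h1 h2 : 'M[C]_n := U *m (fcal h1 A - fcal h2 B) *m V^t*.
have EE h1 h2 i j : E h1 h2 i j =
    (h1 (reig A i) - h2 (reig B j))%:C * (U *m V^t*) i j.
  rewrite /E mulmxBr mulmxBl unlock /sconj !mulmxA (unitarymxP uU) mul1mx.
  rewrite -[U *m _ *m _ *m V *m _]mulmxA (unitarymxP uV) mulmx1.
  rewrite [LHS]mxE [X in _ + X]mxE -mulmxA mul_diag_mx mul_mx_diag.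
  rewrite [X in X + _]mxE [X in X * _ - _]mxE [X in _ - X]mxE [X in _ - _ * X]mxE rmorphB/=.
  rewrite -/U -/V; ring.
set S := \sum_i \sum_j `|A i j - B i j|.
have Eid i j : `|E id id i j| <= S.
  rewrite /E !fcal_id// [X in `|X|]mxE; apply: le_trans (ler_norm_sum _ _ _) _.
  rewrite /S exchange_big; apply: ler_sum => k _.
  rewrite normrM [X in `|X| * _]mxE.
  apply: (@le_trans _ _ (`|\sum_j0 U i j0 * (A - B) j0 k| * 1)).
    by apply: ler_wpM2l => //; rewrite trCE norm_conjC unitary_entry_le1.
  rewrite mulr1; apply: le_trans (ler_norm_sum _ _ _) _; apply: ler_sum => l _.
  rewrite normrM [(A - B) l k]mxE [(- B) l k]mxE ler_piMl//.
  exact: unitary_entry_le1 uU.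
have Eg i j : `|E g g i j| <= L%:C * S.
  rewrite EE normrM; apply: (@le_trans _ _ (L%:C * `|E id id i j|)); last first.
    by rewrite ler_wpM2l// ?lecR.
  rewrite EE normrM mulrA ler_wpM2r// !normc_real -rmorphM lecR; exact: hg.
have -> : `|\sum_k g (reig A k) - \sum_k g (reig B k)|%:C = `|\tr (E g g *m (V *m U^t*))|.
  rewrite /E mxtrace_mulC -!mulmxA mxtrace_mulC.
  rewrite !mulmxA (unitary_trCmul uU) mul1mx -mulmxA (unitary_trCmul uV) mulmx1.
  by rewrite linearB/= !tr_fcal -rmorphB normc_real.
rewrite /mxtrace; apply: le_trans (ler_norm_sum _ _ _) _.
have -> : (n ^ 3)%:R * L%:C * S = \sum_(i < n) \sum_(j < n) \sum_(k < n) L%:C * S.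
  by rewrite !sumr_const !card_ord -!mulrnA -mulrA mulr_natl; congr (_ *+ _); rewrite !expnS expn0 muln1 mulnA.
apply: ler_sum => i _; rewrite [X in `|X|]mxE; apply: le_trans (ler_norm_sum _ _ _) _.
apply: ler_sum => j _; rewrite [X in _ * X]mxE mulr_sumr.
apply: le_trans (ler_norm_sum _ _ _) _; apply: ler_sum => k _.
rewrite !normrM; apply: (@le_trans _ _ (`|E g g i j| * 1)); last by rewrite mulr1.
apply: ler_wpM2l => //; rewrite trCE norm_conjC -[1]mulr1.
by apply: ler_pM => //; [exact: unitary_entry_le1 uV|exact: unitary_entry_le1 uU].
Qed.

(** [spectral_diag] follows no particular order, so a single eigenvalue need not be continuous in x;
    only the sum over all of them is controlled. *)
Lemma lipR_reig a b n (A : R -> 'M[C]_n) (g : R -> R) (L : R) :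
  0 <= L -> (forall x, (A x)^t* = A x) -> (forall x k, 0 <= reig (A x) k) ->
  (forall u v, 0 <= u -> 0 <= v -> `|g u - g v| <= L * `|u - v|) ->
  (forall i j, lipC a b (fun x => A x i j)) ->
  lipR a b (fun x => \sum_k g (reig (A x) k)).
Proof.
move=> L0 hA A0 hg lA.
have [K K0 hK] : exists2 K : R, 0 <= K & {in `[a, b] &, forall x y,
    \sum_i \sum_j `|A x i j - A y i j| <= (K * `|x - y|)%:C}.
  have step (I : finType) (F : I -> R -> R -> C) :
      (forall i, exists2 K : R, 0 <= K & {in `[a, b] &, forall x y, F i x y <= (K * `|x - y|)%:C}) ->
      exists2 K : R, 0 <= K & {in `[a, b] &, forall x y, \sum_i F i x y <= (K * `|x - y|)%:C}.
    move=> h; elim: (index_enum I) => [|i r [K K0 hK]].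
      by exists 0 => // x y _ _; rewrite big_nil mul0r.
    have [K' K0' hK'] := h i; exists (K' + K); first exact: addr_ge0.
    by move=> x y xI yI; rewrite big_cons mulrDl rmorphD lerD ?hK ?hK'.
  by apply: (@step) => i; apply: (@step) => j; exact: lA.
exists ((n ^ 3)%:R * L * K); first by rewrite !mulr_ge0.
move=> x y xI yI; rewrite -lecR.
apply: le_trans (reig_sum_lipschitz L0 (hA x) (hA y) _) _.
  by move=> i j; exact: hg.
have -> : ((n ^ 3)%:R * L * K * `|x - y|)%:C = (n ^ 3)%:R * L%:C * (K * `|x - y|)%:C.
  by rewrite -(rmorph_nat (real_complex R)) -!rmorphM mulrA.
by apply: ler_wpM2l; [rewrite mulr_ge0// lecR|exact: hK].
Qed.

End spectral_lipschitz.

Section waterfilling_lipschitz.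
Context (R : realType) (D : R).
Hypothesis D0 : 0 < D.

(** This form absorbs the case x = 0 and keeps the denominator at least 1, which makes the Lipschitz
    estimate visible despite the inverse of x. *)
Lemma wf_power_max x : 0 <= x -> wf_power D x = D - D / Num.max 1 (D * x).
Proof.
rewrite le_eqVlt /wf_power => /orP[/eqP <-|x0].
  by rewrite eqxx mulr0 max_l// divr1 subrr.
rewrite gt_eqF//; have [h|h] := leP (D * x) 1.
  by rewrite max_l ?divr1 ?subrr// subr_le0 -(ler_pM2r x0) mulVf ?gt_eqF.
rewrite max_r; last by rewrite subr_ge0 -(ler_pM2r x0) mulVf ?gt_eqF// ltW.
by field; rewrite !gt_eqF.
Qed.

Lemma wf_rate_max x : 0 <= x -> wf_rate D x = ln (Num.max 1 (D * x)).
Proof.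
rewrite le_eqVlt /wf_rate => /orP[/eqP <-|x0].
  by rewrite eqxx mulr0 max_l// ln1.
rewrite gt_eqF//; have [h|h] := leP (D * x) 1.
  by rewrite max_l ?ln1// ln_le0.
by rewrite max_r// ln_ge0// ltW.
Qed.

Lemma max1_lipschitz (u v : R) : `|Num.max 1 u - Num.max 1 v| <= `|u - v|.
Proof.
by have [h1|h1] := leP u 1; have [h2|h2] := leP v 1;
  rewrite ler_norml; case: ler0P => h3; lra.
Qed.

Lemma wf_power_lipschitz u v : 0 <= u -> 0 <= v ->
  `|wf_power D u - wf_power D v| <= D ^+ 2 * `|u - v|.
Proof.
move=> u0 v0; rewrite !wf_power_max//.
have := max1_lipschitz (D * u) (D * v); rewrite -mulrBr normrM (gtr0_norm D0).
set x := Num.max _ _; set y := Num.max _ _ => h.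
have x1 : 1 <= x by rewrite le_max lexx.
have y1 : 1 <= y by rewrite le_max lexx.
have x0 : 0 < x by exact: lt_le_trans x1.
have y0 : 0 < y by exact: lt_le_trans y1.
(* One factor [D] stands here, the other comes from the Lipschitz bound on the maxima, and the
   denominator is at least 1. *)
have -> : D - D / x - (D - D / y) = D * (x - y) / (x * y).
  by field; rewrite !gt_eqF.
rewrite !normrM (gtr0_norm D0) normfV expr2 -mulrA -mulrA ler_pM2l//.
apply: le_trans h; rewrite ler_piMr// invf_le1 ?normr_gt0 ?mulf_neq0 ?gt_eqF//.
rewrite ger0_norm ?mulr_ge0 ?(ltW x0) ?(ltW y0)//.
by rewrite -[1]mulr1 ler_pM.
Qed.

Lemma ln_lipschitz (c u v : R) : 0 < c -> c <= u -> c <= v ->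
  `|ln u - ln v| <= c^-1 * `|u - v|.
Proof.
wlog uv : u v / v <= u => [hw|] c0 cu cv.
  by have [/hw|/ltW/hw] := leP v u; [exact|rewrite distrC (distrC v); exact].
have v0 : 0 < v by exact: lt_le_trans cv.
have u0 : 0 < u by exact: lt_le_trans cu.
rewrite ger0_norm ?subr_ge0 ?ler_ln ?posrE// ger0_norm ?subr_ge0//.
rewrite -ln_div ?posrE//.
have -> : u / v = 1 + (u - v) / v by field; rewrite gt_eqF.
have uv0 : 0 <= u - v by rewrite subr_ge0.
apply: le_trans (le_ln1Dx _) _.
  by apply: lt_le_trans (_ : 0 <= _); rewrite ?ltrN10// divr_ge0// ltW.
by rewrite mulrC ler_wpM2r// lef_pV2 ?posrE.
Qed.

Lemma wf_rate_lipschitz u v : 0 <= u -> 0 <= v ->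
  `|wf_rate D u - wf_rate D v| <= D * `|u - v|.
Proof.
move=> u0 v0; rewrite !wf_rate_max//.
have := max1_lipschitz (D * u) (D * v); rewrite -mulrBr normrM (gtr0_norm D0).
apply: le_trans; have := @ln_lipschitz 1 (Num.max 1 (D * u)) (Num.max 1 (D * v)) ltr01.
by rewrite invr1 mul1r; apply; rewrite le_max lexx.
Qed.

End waterfilling_lipschitz.

(** * Spectral integrals and their Riemann sums *)

Section spectral_integrals.
Context d (Omega : measurableType d) (R : realType) (P : probability Omega R).
Context (nr nt m : nat) (W : int -> {RV P >-> vec R nr}).
Context (f : forall k, block R nr k -> R) (G : 'I_m.+1 -> 'M[R]_(nr, nt)).
Hypothesis hW : noise_process W m f.
Hypothesis hC : forall w : R, Cfreq m (autocorr W) w \in unitmx.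
Local Open Scope complex_scope.
Local Open Scope sesquilinear_scope.
Local Notation C := R[i].
Local Notation K := (Cfreq m (autocorr W)).
Local Notation mu := (@lebesgue_measure R).

Let pK w : pdmx (K w). Proof. exact: (pdmx_Cfreq hW (hC w)). Qed.
Let pi_le : - pi <= pi :> R.
Proof. by have := @pi_ge0 R; lra. Qed.

Lemma lipC_Gfreq i j : lipC (- pi) pi (fun w => Gfreq G w i j).
Proof.
under eq_fun do rewrite summxE.
apply: lipC_sum => tau.
have -> : (fun w => (cis_neg (w * tau%:R) *: map_mx (real_complex R) (G tau)) i j) =
    fun w => cis_neg (w * tau%:R) * (G tau i j)%:C.
  by apply/funext => w; rewrite !mxE.
exact: lipCM (lipC_cis _ _ _) (lipC_cst _ _ _).
Qed.

Lemma lipC_Cfreq i j : lipC (- pi) pi (fun w => K w i j).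
Proof.
under eq_fun do rewrite Cfreq_entry; apply: lipC_sum => k.
exact: lipCM (lipC_cis _ _ _) (lipC_cst _ _ _).
Qed.

Lemma det_Cfreq_bound : exists2 c : R, 0 < c &
  {in `[- pi, pi], forall w, c%:C <= `|\det (K w)|}.
Proof.
apply: lipC_abs_bound; [exact: pi_le|exact/lipC_det/lipC_Cfreq|].
by move=> w _; rewrite -unitfE -unitmxE.
Qed.

Lemma lipC_invCfreq i j : lipC (- pi) pi (fun w => invmx (K w) i j).
Proof.
have [c c0 hc] := det_Cfreq_bound.
exact: lipC_invmx c0 hc hC lipC_Cfreq i j.
Qed.

Lemma lipC_gram i j : lipC (- pi) pi (fun w => gram (K w) (Gfreq G w) i j).
Proof.
apply: lipC_mulmx => //; last exact: lipC_Gfreq.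
by apply: lipC_mulmx => //; [apply: lipC_trC; exact: lipC_Gfreq|exact: lipC_invCfreq].
Qed.

Lemma lipR_gram (g : R -> R) (L : R) : 0 <= L ->
  (forall u v, 0 <= u -> 0 <= v -> `|g u - g v| <= L * `|u - v|) ->
  lipR (- pi) pi (fun w => \sum_k g (reig (gram (K w) (Gfreq G w)) k)).
Proof.
move=> L0 hg; apply: lipR_reig L0 _ _ hg lipC_gram => w.
  exact: gram_trC.
exact: gram_eig_ge0.
Qed.

Lemma lipR_lndet : lipR (- pi) pi (fun w => ln (complex.Re (\det (K w)))).
Proof.
have [c c0 hc] := det_Cfreq_bound.
have [L L0 hL] : lipC (- pi) pi (fun w => \det (K w)) by exact/lipC_det/lipC_Cfreq.
have dE w : \det (K w) = (complex.Re (\det (K w)))%:C.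
  by rewrite RRe_real//; exact/gtr0_real/pdmx_det_gt0.
have hc' w : w \in `[- pi, pi] -> c <= complex.Re (\det (K w)).
  move=> wI; have := hc w wI; rewrite dE normc_real lecR ger0_norm//.
  by rewrite -lecR -dE ltW// pdmx_det_gt0.
exists (c^-1 * L); first by rewrite mulr_ge0// invr_ge0 ltW.
move=> x y xI yI; apply: le_trans (ln_lipschitz c0 (hc' x xI) (hc' y yI)) _.
rewrite -mulrA; apply: ler_wpM2l; first by rewrite invr_ge0 ltW.
by rewrite -lecR -normc_real rmorphB /= -!dE; exact: hL.
Qed.

Lemma riemann_dft (F : R -> R) : lipR (- pi) pi F ->
  exists B : R, forall N, (0 < N)%N ->
  `|\sum_(j < N) F (dft_freq R N j) - N%:R * ((2 * pi)^-1 * \int[mu]_(w in `[- pi, pi]) F w)| <= B.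
Proof.
move=> lF; have [B hB] := riemann_sum pi_le lF.
have p0 : 0 < 2 * pi :> R by rewrite mulr_gt0 ?pi_gt0.
exists ((2 * pi)^-1 * B) => N N0; have := hB N N0.
rewrite -(ler_pM2l (x := (2 * pi)^-1)) ?invr_gt0//; apply: le_trans.
rewrite -[(2 * pi)^-1 in leRHS]gtr0_norm ?invr_gt0// -normrM.
rewrite le_eqVlt; apply/orP; left; apply/eqP; congr `|_|.
rewrite mulrBr mulrCA; congr (_ - _); rewrite mulr_sumr; apply: eq_bigr => j _.
rewrite /dft_freq; have -> : pi - - pi = 2 * pi :> R by ring.
by rewrite mulrCA mulVf ?gt_eqF// mulr1.
Qed.

Lemma waterfill_powerE D : waterfill_power G (autocorr W) D =
  (2 * pi)^-1 * \int[mu]_(w in `[- pi, pi])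
    \sum_k wf_power D (reig (gram (K w) (Gfreq G w)) k).
Proof. by []. Qed.

(** Of the factor 1/(4 pi), the part 1/(2 pi) stays with the integral to form a mean over
    frequencies; the remaining 1/2 joins 1/ln 2 from base 2. *)
Lemma waterfill_rateE D : 0 < D -> waterfill_rate G (autocorr W) D =
  (2 * ln 2)^-1 * ((2 * pi)^-1 * \int[mu]_(w in `[- pi, pi])
    \sum_k wf_rate D (reig (gram (K w) (Gfreq G w)) k)).
Proof.
move=> D0; have l2 : 0 < ln 2 :> R by rewrite ln_gt0// ltr1n.
have lr := lipR_gram (ltW D0) (wf_rate_lipschitz D0).
have -> : waterfill_rate G (autocorr W) D = (4 * pi)^-1 * \int[mu]_(w in `[- pi, pi])
    ((ln 2)^-1 * \sum_k wf_rate D (reig (gram (K w) (Gfreq G w)) k)).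
  congr (_ * _); apply: eq_Rintegral => w _; rewrite mulr_sumr; apply: eq_bigr => k _.
  rewrite -/(reig (gram (K w) (Gfreq G w)) k) /lambda -/(gram _ _) /wf_rate.
  rewrite -/(reig _ k); case: eqP => _; first by rewrite mulr0.
  by rewrite /log2 mulrC maxr_pMr ?invr_ge0 ?ltW// mulr0 [_^-1 * _]mulrC.
rewrite RintegralZl//; last exact: lipR_integrable lr.
have := pi_gt0 R; move: (\int[_]_(_ in _) _) => I p0.
by move: (pi : R) p0 (ln 2) l2 => p p0 l l0; field; rewrite !gt_eqF.
Qed.

Lemma gauss_entropy_rateE : gauss_entropy_rate m (autocorr W) =
  (2 * ln 2)^-1 * (nr%:R * ln (2 * pi * expR 1) +
    (2 * pi)^-1 * \int[mu]_(w in `[- pi, pi]) ln (complex.Re (\det (K w)))).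
Proof.
have l2 : 0 < ln 2 :> R by rewrite ln_gt0// ltr1n.
have p0 := pi_gt0 R; set c : R := 2 * pi * expR 1.
have c0 : 0 < c by rewrite !mulr_gt0 ?expR_gt0.
have icst x : mu.-integrable `[- pi, pi] (EFin \o fun=> x : R).
  exact: lipR_integrable (lipR_cst _ _ x).
have -> : gauss_entropy_rate m (autocorr W) = (4 * pi)^-1 * \int[mu]_(w in `[- pi, pi])
    ((ln 2)^-1 * (nr%:R * ln c + ln (complex.Re (\det (K w))))).
  congr (_ * _); apply: eq_Rintegral => w _; rewrite /log2 mulrC -/c; congr (_ * _).
  rewrite detZ -rmorphXn ReZ.
  have d0 : 0 < complex.Re (\det (K w)) by have := pdmx_det_gt0 (pK w); rewrite ltcE => /andP[].
  by rewrite lnM ?posrE ?exprn_gt0// lnXn// mulr_natl.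
rewrite RintegralZl//; last by exact: lipR_integrable (lipRD (lipR_cst _ _ _) lipR_lndet).
rewrite RintegralD//; last exact: lipR_integrable lipR_lndet.
rewrite Rintegral_cst//; move: (\int[_]_(_ in _) _) => I.
have -> : fine (mu `[- pi, pi]) = 2 * pi.
  by have := lebesgue_measure_itv `[- pi, pi : R]; rewrite /= lte_fin gtrN ?p0// => -> /=; ring.
by move: (pi : R) p0 (ln c) (ln 2) l2 => p p0 l' l l0; field; rewrite !gt_eqF.
Qed.

End spectral_integrals.

(** * The asymptotic bound *)

Section circulant_bounds.
Context (R : realType).
Local Open Scope complex_scope.
Local Open Scope sesquilinear_scope.
Local Notation C := R[i].

Lemma ln_gauss_const K (Q : 'M[C]_K) : pdmx Q ->
  - ln (gauss_const Q) = 2^-1 * (K%:R * ln (2 * pi) - ln (complex.Re (\det Q))).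
Proof.
move=> pQ; have p0 := pi_gt0 R.
have d0 : 0 < complex.Re (\det Q) by have := pdmx_det_gt0 pQ; rewrite ltcE => /andP[].
have t0 : 0 < 2 * pi :> R by rewrite mulr_gt0.
have q0 : 0 < (2 * pi) ^+ K / complex.Re (\det Q) by rewrite divr_gt0// exprn_gt0.
rewrite /gauss_const lnV ?posrE ?sqrtr_gt0// opprK.
have -> : K%:R * ln (2 * pi) - ln (complex.Re (\det Q)) =
    ln ((2 * pi) ^+ K / complex.Re (\det Q)).
  by rewrite ln_div ?posrE ?exprn_gt0// lnXn// mulr_natl.
rewrite -{2}(sqr_sqrtr (ltW q0)) lnXn ?sqrtr_gt0//.
by rewrite -[X in _ = _ * X]mulr_natl mulrA mulVf ?mul1r.
Qed.

Lemma ln_det_prod n (I : finType) (Q : I -> 'M[C]_n) : (forall j, pdmx (Q j)) ->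
  ln (complex.Re (\prod_j \det (Q j))) = \sum_j ln (complex.Re (\det (Q j))).
Proof.
move=> pQ.
have dE j : \det (Q j) = (complex.Re (\det (Q j)))%:C.
  by rewrite RRe_real//; exact/gtr0_real/pdmx_det_gt0.
have d0 j : 0 < complex.Re (\det (Q j)).
  by have := pdmx_det_gt0 (pQ j); rewrite ltcE => /andP[].
under eq_bigr do rewrite dE.
rewrite -rmorph_prod /=; elim: (index_enum I) => [|i r IH].
  by rewrite !big_nil ln1.
by rewrite !big_cons lnM ?posrE ?IH// prodr_gt0.
Qed.

Section quadratic.
Context (N nr nt m : nat) (G : 'I_m.+1 -> 'M[R]_(nr, nt)) (z : 'I_N -> 'I_nt -> R).
Context (K : R -> 'M[C]_nr) (D : R).
Hypothesis pK : forall w, pdmx (K w).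
Hypothesis D0 : 0 < D.
Hypothesis N0 : (0 < N)%N.
Hypothesis evN : ~~ odd N.
Local Notation om := (dft_freq R N).
Local Notation Q := (fun j : 'I_N => wf_prec (K (om j)) (Gfreq G (om j)) D).

Lemma qr_circ : qr (circ_mx Q) (\row_p circ_conv G z (block_of p) (offset_of p)) =
  N%:R^-1 * complex.Re (\sum_j
    hform (Q j) (xhat z j *m (Gfreq G (om j))^t*)).
Proof.
have pQ j : pdmx (Q j) by exact: pdmx_wf_prec.
rewrite /qr hform_circ//.
have -> : (N%:R^-1 : C) = (N%:R^-1 : R)%:C by rewrite fmorphV rmorph_nat.
rewrite ReZ; congr (_ * complex.Re _); apply: eq_bigr => j _.
rewrite -dft_circ_conv//; congr (hform _ (dft _ _)).
by apply/rowP => p; rewrite !mxE.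
Qed.

(** At each frequency the cost is at most 1/D per unit of energy; the factor N of Parseval's
    identity cancels the 1/N of [hform_circ]. *)
Lemma qr_circ_le :
  qr (circ_mx Q) (\row_p circ_conv G z (block_of p) (offset_of p)) <=
  D^-1 * \sum_(t < N) \sum_k z t k ^+ 2.
Proof.
rewrite qr_circ; have NR : 0 < N%:R :> R by rewrite ltr0n.
rewrite ler_pdivrMl//.
have : \sum_j hform (Q j) (xhat z j *m (Gfreq G (om j))^t*) <=
    (N%:R * (D^-1 * \sum_(t < N) \sum_k z t k ^+ 2))%:C.
  apply: (@le_trans _ _ (\sum_(j < N) D^-1%:C * \sum_k `|xhat z j 0 k| ^+ 2)).
    by apply: ler_sum => j _; exact: hform_wf_prec_le.
  rewrite -mulr_sumr exchange_big; under eq_bigr do rewrite parseval//.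
  rewrite -rmorph_sum -rmorphM lecR -mulr_sumr mulrCA.
  by rewrite exchange_big.
by rewrite lecE => /andP[].
Qed.

Lemma qr_circ_eq0 : (forall w k, reig (gram (K w) (Gfreq G w)) k = 0) ->
  qr (circ_mx Q) (\row_p circ_conv G z (block_of p) (offset_of p)) = 0.
Proof.
move=> e0; rewrite qr_circ big1 ?mulr0// => j _.
exact: hform_wf_prec_eq0.
Qed.

End quadratic.

End circulant_bounds.

Section prefixed_input.
Context (R : realType) (nr nt m l : nat) (G : 'I_m.+1 -> 'M[R]_(nr, nt)).
Context (x : l.-tuple 'cV[R]_nt).

Definition zero_state : m.-tuple 'cV[R]_nt := [tuple of nseq m 0].

Definition padded (t : 'I_(m + l)) (k : 'I_nt) : R := (nth 0 (zero_state ++ x) t) k 0.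

(** After the prefix the index m + i - tau is nonnegative, since tau <= m, so the circular
    convolution does not wrap and equals the channel. *)
Lemma circ_conv_padded i r : circ_conv G padded (rshift m i) r = signal G zero_state x i r.
Proof.
rewrite /circ_conv /signal summxE; apply: eq_bigr => tau _.
rewrite mxE; apply: eq_bigr => k _; congr (_ * _).
rewrite /padded /= (_ : (_ %% _)%N = m + i - tau)%N//.
have ht := ltn_ord tau; have hi := ltn_ord i.
have tN : (tau <= (m + l) * tau)%N by rewrite leq_pmull// (leq_ltn_trans _ (ltn_ord (rshift m i))).
have -> : (m + i + ((m + l) * tau - tau) = tau * (m + l) + (m + i - tau))%N.
  by rewrite (mulnC tau); lia.
by rewrite modnMDl modn_small; lia.
Qed.

Lemma padded_norm2 : \sum_(t < m + l) \sum_k padded t k ^+ 2 =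
  \sum_(i < l) \sum_(k < nt) (tnth x i) k 0 ^+ 2.
Proof.
rewrite big_split_ord /= big1 ?add0r => [|t _].
  apply: eq_bigr => i _; apply: eq_bigr => k _.
  rewrite /padded nth_cat /= size_nseq ltnNge leq_addr /= addKn.
  by rewrite (tnth_nth 0).
apply: big1 => k _; rewrite /padded nth_cat size_nseq /= ltn_ord nth_nseq ltn_ord.
by rewrite mxE expr0n.
Qed.

End prefixed_input.

Section converse.
Context d (Omega : measurableType d) (R : realType) (Pr : probability Omega R).
Context (nr nt m : nat) (W : int -> {RV Pr >-> vec R nr}).
Context (f : forall k, block R nr k -> R) (G : 'I_m.+1 -> 'M[R]_(nr, nt)).
Hypothesis hW : noise_process W m f.
Hypothesis hC : forall w : R, Cfreq m (autocorr W) w \in unitmx.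
Local Open Scope complex_scope.
Local Notation C := R[i].
Local Notation K := (Cfreq m (autocorr W)).
Local Notation mu := (@lebesgue_measure R).

Let pK w : pdmx (K w). Proof. exact: (pdmx_Cfreq hW (hC w)). Qed.
Let pi_le : - pi <= pi :> R.
Proof. by have := @pi_ge0 R; lra. Qed.
Let l2 : 0 < ln 2 :> R. Proof. by rewrite ln_gt0// ltr1n. Qed.

Lemma power_ge0 l (c : Defs.code R nr nt l) : 0 <= power c.
Proof.
rewrite mulr_ge0// sumr_ge0// => i _; rewrite mulr_ge0// sumr_ge0// => u _.
by rewrite sumr_ge0// => j _; rewrite sqr_ge0.
Qed.

Lemma dft_freq_itv N (j : 'I_N) : dft_freq R N j \in `[- pi, pi].
Proof.
have p0 := pi_gt0 R.
have N0 : 0 < N%:R :> R by rewrite ltr0n (leq_ltn_trans _ (ltn_ord j)).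
have h0 : 0 <= j%:R / N%:R :> R by rewrite divr_ge0.
have h1 : j%:R / N%:R <= 1 :> R by rewrite ler_pdivrMr// mul1r ler_nat ltnW.
by rewrite in_itv/= /dft_freq -mulrA; apply/andP; split; nra.
Qed.

Lemma lipC_entry_bound n p (A : R -> 'M[C]_(n, p)) :
  (forall i j, lipC (- pi) pi (fun x => A x i j)) ->
  exists B : R, {in `[- pi, pi], forall x i j, `|A x i j| <= B%:C}.
Proof.
move=> lA; have /choice[b hb] i : exists B : R, forall j,
    {in `[- pi, pi], forall x, `|A x i j| <= B%:C}.
  have /choice[b hb] j : exists B : R, {in `[- pi, pi], forall x, `|A x i j| <= B%:C}.
    by have [B _ hB] := lipC_bnd pi_le (lA i j); exists B.
  exists (\sum_j `|b j|) => j x xI; apply: le_trans (hb j x xI) _.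
  rewrite lecR (bigD1 j)//= (le_trans (ler_norm _))// lerDl; exact: sumr_ge0.
exists (\sum_i `|b i|) => x xI i j; apply: le_trans (hb i j x xI) _.
rewrite lecR (bigD1 i)//= (le_trans (ler_norm _))// lerDl; exact: sumr_ge0.
Qed.

Section positive_level.
Context (D P : R).
Hypothesis D0 : 0 < D.
Hypothesis hD : water_level G (autocorr W) P D.

Let prec N (j : 'I_N) := wf_prec (K (dft_freq R N j)) (Gfreq G (dft_freq R N j)) D.

Lemma wf_prec_bound : exists B : R, forall N (j : 'I_N) r s, `|prec j r s| <= B%:C.
Proof.
have [B1 h1] := lipC_entry_bound (lipC_invCfreq hC).
have [B2 h2] := lipC_entry_bound (lipC_Gfreq G).
eexists => N j r s; have jI := dft_freq_itv j.
by apply: wf_prec_entry_le => // r' s'; [exact: h1|exact: h2].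
Qed.

Local Notation IP := (waterfill_power G (autocorr W) D).
Local Notation h k := (- \int[leb_block R nr k]_w (f w * ln (f w))).

Lemma input_energy l (c : Defs.code R nr nt l) : (0 < l)%N ->
  (nmsg c)%:R^-1 * \sum_u \sum_(t < m + l) \sum_k padded (enc c u) t k ^+ 2 =
  l%:R * power c.
Proof.
move=> l0; rewrite /power mulrA mulfV ?pnatr_eq0 -?lt0n// mul1r -mulr_sumr.
congr (_ * _); under eq_bigr do rewrite padded_norm2.
by rewrite exchange_big.
Qed.

(** The order of quantifiers is the point: [B] depends on neither the code, nor its length, nor the
    error, so it disappears from the rate as l grows. *)
Lemma code_bound : exists B : R, forall l (c : Defs.code R nr nt l) (e1 : R),
  (0 < l)%N -> ~~ odd (m + l) -> power c <= P ->
  (ereal_sup [set err_prob G f c s | s in states f] < e1%:E)%E ->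
  (1 - e1) * ln (nmsg c)%:R <=
  - h (m + l)%N + (m + l)%:R * (ln 2 * (waterfill_rate G (autocorr W) D +
      gauss_entropy_rate m (autocorr W))) + B.
Proof.
have [B hB] := wf_prec_bound.
have lr := lipR_gram G hW hC (ltW D0) (wf_rate_lipschitz D0).
have lp := lipR_gram G hW hC (sqr_ge0 D) (wf_power_lipschitz D0).
have [B1 h1] := riemann_dft (lipR_lndet hW hC).
have [B2 h2] := riemann_dft lr.
have [B3 h3] := riemann_dft lp.
pose T := (m.*2)%:R * \sum_(k < m.*2.+1) \sum_r \sum_s B * `|autocorr W (k%:Z - m%:Z) r s|.
(* 1 is from Fano; [B1] and [B2] are the Riemann errors of the log-determinant and of the rate; [B3]
   is that of the power, and [T] is the border error of the trace. *)
exists (1 + 2^-1 * (B1 + B2) + 2^-1 * (D^-1 * B3 + T)) => l c e1 l0 ev cP ce.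
set N := (m + l)%N.
have N0 : (0 < N)%N by rewrite addn_gt0 l0 orbT.
have NR : 0 < N%:R :> R by rewrite ltr0n.
pose Q := circ_mx (@prec N).
have pQj j : pdmx (@prec N j) by exact: pdmx_wf_prec.
have pQ : pdmx Q by exact: pdmx_circ.
have := @code_converse _ _ _ _ _ _ _ G W f hW l c (zero_state R nt m)
  (fun u => circ_conv G (padded (enc c u))) Q e1 _ ce pQ.
move=> /(_ (fun u i r => circ_conv_padded G (enc c u) i r)).
rewrite ln_gauss_const// /Q det_circ// ln_det_prod//.
under eq_bigr do rewrite det_wf_prec//.
have hT := circ_trace hW N0 (hB N).
have trE : \sum_(j < N) complex.Re (\tr (prec j *m K (dft_freq R N j))) = N%:R * nr%:R - D^-1 *
    \sum_(j < N) \sum_k wf_power D (reig (gram (K (dft_freq R N j)) (Gfreq G (dft_freq R N j))) k).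
  under eq_bigr do rewrite tr_wf_prec//.
  by rewrite sumrB sumr_const card_ord -mulr_sumr -[X in X - _]mulr_natl.
rewrite trE in hT.
rewrite sumrN big_split /=.
have := h1 N N0; have := h2 N N0; have := h3 N N0.
rewrite -waterfill_powerE (waterfill_rateE G hW hC D0) (gauss_entropy_rateE hW hC).
(* ln (2 pi) matches the normalising constant of the Gaussian, and the summand 1 matches the term N
   nr of the trace. *)
have -> : ln (2 * pi * expR 1) = ln (2 * pi) + 1 :> R.
  by rewrite lnM ?posrE ?expR_gt0 ?mulr_gt0 ?pi_gt0// expRK.
set Sp := \sum_(j < N) _; set Sr := \sum_(j < N) _; set Sd := \sum_(j < N) _.
rewrite -/Sp in hT.
set IR := (2 * pi)^-1 * _; set IL := (2 * pi)^-1 * _.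
have quad : (nmsg c)%:R^-1 * \sum_u qr (circ_mx (@prec N)) (\row_p circ_conv G
    (padded (enc c u)) (block_of p) (offset_of p)) <= D^-1 * (N%:R * IP).
  have M0 : 0 <= (nmsg c)%:R^-1 :> R by rewrite invr_ge0.
  case: hD => [IPE|e0].
    rewrite IPE mulrCA; apply: (@le_trans _ _ (D^-1 * (l%:R * power c))).
      rewrite -input_energy// mulrCA; apply: ler_wpM2l => //; rewrite mulr_sumr.
      by apply: ler_sum => u _; exact: qr_circ_le.
    rewrite mulrCA; apply: ler_wpM2l; first by rewrite invr_ge0 ltW.
    (* The energy is spent over l samples but charged over N = m + l; nonnegative power makes the
       comparison go the right way. *)
    by apply: ler_pM => //; [exact: power_ge0|rewrite ler_nat leq_addl].
  rewrite big1 ?mulr0 => [|u _]; last exact: qr_circ_eq0.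
  rewrite mulr_ge0 ?invr_ge0 ?(ltW D0)// mulr_ge0// mulr_ge0 ?invr_ge0 ?mulr_ge0 ?pi_ge0//.
  apply: Rintegral_ge0 => w _; apply: sumr_ge0 => k _.
  by rewrite e0 eqxx.
set q := (nmsg c)%:R^-1 * _ in quad *.
set tr := \sum_q _ in hT *.
rewrite !ler_norml => /andP[a1 a2] /andP[a3 a4] /andP[a5 a6] key.
apply: le_trans key _.
have a7 : D^-1 * (N%:R * IP - Sp) <= D^-1 * B3 by rewrite ler_wpM2l ?invr_ge0 ?(ltW D0)//; lra.
have -> : N%:R * (ln 2 * ((2 * ln 2)^-1 * IR + (2 * ln 2)^-1 *
    (nr%:R * (ln (2 * pi) + 1) + IL))) =
    2^-1 * (N%:R * IR + N%:R * nr%:R * ln (2 * pi) + N%:R * nr%:R + N%:R * IL).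
  by move: (ln 2) l2 => l' l'0; field; rewrite gt_eqF.
rewrite mulrBr in a7; rewrite natrM -/N; rewrite -/T in hT.
move: (\int[_]_(_ in _) _) (waterfill_power _ _ _) (D^-1 * Sp) T tr quad hT a7 => X IP' DS T' tr'.
move: (ln (2 * pi)) => L quad hT a7.
lra.
Qed.

Lemma achievable_le Rc : achievable G f P Rc ->
  (Rc%:E <= (waterfill_rate G (autocorr W) D)%:E +
     (gauss_entropy_rate m (autocorr W))%:E - entropy_rate f)%E.
Proof.
move=> ach; set wr := waterfill_rate _ _ _; set gr := gauss_entropy_rate _ _.
have [B hB] := code_bound.
(* The rate +oo is excluded by the finite entropy of one sample; for -oo the right-hand side is
   +oo. *)
case E : (entropy_rate f) => [rho| |].
- rewrite -EFinN -!EFinD lee_fin leNgt; apply/negP => lt.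
  pose V := wr + gr - rho; pose dl := Rc - V.
  have dl0 : 0 < dl by rewrite subr_gt0.
  have s0 : 0 < 4 * (`|Rc| + dl) by rewrite mulr_gt0// ltr_wpDl.
  (* Chosen so that the error and the slack [dl / 4] in the rate together consume at most half of
     the excess [dl]. *)
  pose e1 := dl / (4 * (`|Rc| + dl)).
  have e10 : 0 < e1 by rewrite divr_gt0.
  have e1s : e1 * (`|Rc| + dl) = dl / 4.
    by rewrite /e1; field; rewrite gt_eqF// -(pmulr_rgt0 _ (ltr0n _ 4)).
  have e1le : e1 <= 4^-1.
    rewrite /e1 ler_pdivrMr// mulrA mulVf// mul1r lerDr; exact: normr_ge0.
  have e20 : 0 < dl / 4 by rewrite divr_gt0.
  have [l0 l00 hl] := ach e1 (dl / 4) e10 e20.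
  (* The length l = 2 (k + 1) + m makes m + l even, exceeds [l0], and lets the remaining excess l dl
     / 2 beat the constant terms. *)
  pose k := (l0 + Num.bound `|(m%:R * V + B / ln 2) / (dl / 2)|)%N.
  pose l := (k.+1.*2 + m)%N.
  have ll0 : (l0 < l)%N by rewrite /l /k; lia.
  have [c [r [hr cP ce rle]]] := hl l ll0.
  have lp : (0 < l)%N by exact: leq_ltn_trans ll0.
  have ev : ~~ odd (m + l) by rewrite /l addnC -addnA addnn -doubleD odd_double.
  have := hB l c e1 lp ev cP ce.
  have -> : ln (nmsg c)%:R = l%:R * r * ln 2 by rewrite hr ln_powR.
  have := entropy_rate_le hW (ltn_addl m lp); rewrite E lee_fin.
  set H := - \int[_]_(_ in _) _ => hH.
  have NR : 0 < (m + l)%:R :> R by rewrite ltr0n ltn_addl.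
  have {}hH : (m + l)%:R * ln 2 * rho <= H.
    by move: hH; rewrite ler_pdivlMl// ler_pdivlMr// mulrAC.
  have big : m%:R * V + B / ln 2 < l%:R * (dl / 2).
    rewrite -ltr_pdivrMr ?divr_gt0//.
    apply: le_lt_trans (ler_norm _) _.
    apply: lt_le_trans (archi_boundP (normr_ge0 _)) _.
    by rewrite ler_nat /l /k; move: (Num.bound _) => b; clear; lia.
  have m1 : (1 - e1) * (Rc - dl / 4) >= V + dl / 2.
    have : e1 * (Rc - dl / 4) <= dl / 4.
      by rewrite -e1s ler_wpM2l ?(ltW e10)//; have := ler_norm Rc; lra.
    by rewrite /dl; lra.
  have L0 : 0 < l%:R :> R by rewrite ltr0n.
  have m2 : l%:R * (V + dl / 2) <= l%:R * ((1 - e1) * r).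
    rewrite ler_pM2l//; apply: le_trans m1 _; rewrite ler_wpM2l//; lra.
  move=> key.
  have k2 : (1 - e1) * (l%:R * r) <= (m + l)%:R * V + B / ln 2.
    rewrite -(ler_pM2r l2); move: hH key; rewrite /V -/wr -/gr.
    have -> : ((m + l)%:R * (wr + gr - rho) + B / ln 2) * ln 2 =
      (m + l)%:R * (ln 2 * (wr + gr)) + B - (m + l)%:R * ln 2 * rho.
      by field; rewrite gt_eqF.
    by rewrite -!mulrA; lra.
  move: k2 m2 big; rewrite natrD mulrDl mulrCA; lra.
- have := entropy_rate_le hW (ltn0Sn 0); by rewrite E leNgt ltry.
- by rewrite addeC /= leey.
Qed.

End positive_level.

(** Nonnegative eigenvalues are bounded by their sum, which is Lipschitz in the frequency. *)
Lemma reig_gram_bound : exists2 B : R, 0 < B &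
  {in `[- pi, pi], forall w k, reig (gram (K w) (Gfreq G w)) k <= B}.
Proof.
have [L L0 hL] := @lipR_gram _ _ _ _ _ _ _ _ _ G hW hC id 1 ler01 (fun u v _ _ => ltac:(by rewrite mul1r)).
pose S w := \sum_k reig (gram (K w) (Gfreq G w)) k.
have piI : - pi \in `[- pi, pi : R] by rewrite in_itv/= lexx.
have ge0 w k : 0 <= reig (gram (K w) (Gfreq G w)) k by exact: gram_eig_ge0.
exists (1 + S (- pi) + L * (2 * pi)).
  rewrite ltr_pwDl ?mulr_ge0 ?pi_ge0// ltr_pwDl// sumr_ge0//.
move=> w wI k; apply: (@le_trans _ _ (S w)).
  by rewrite /S (bigD1 k)//= lerDl sumr_ge0.
have := hL w _ wI piI; rewrite -/(S _) -/(S (- pi)) ler_norml => /andP[_ h].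
have : L * `|w - - pi| <= L * (2 * pi).
  rewrite ler_wpM2l//; move: wI; rewrite in_itv/= => /andP[w1 w2].
  by rewrite ger0_norm; lra.
by move: h; lra.
Qed.

(* A level D <= 0 forces P = 0 and is equivalent to any small positive level. *)
Lemma positive_level P D : water_level G (autocorr W) P D ->
  exists2 D', 0 < D' & water_level G (autocorr W) P D' /\
    waterfill_rate G (autocorr W) D' = waterfill_rate G (autocorr W) D.
Proof.
have [D0|D0] := ltP 0 D; first by exists D.
have [B B0 hB] := reig_gram_bound.
have p0 := pi_gt0 R.
have ge0 w k : 0 <= lambda G (autocorr W) w k by exact: gram_eig_ge0.
have rate0 : waterfill_rate G (autocorr W) D = 0.
  rewrite /waterfill_rate (_ : \int[_]_(_ in _) _ = 0) ?mulr0//.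
  rewrite (@eq_Rintegral _ _ _ mu _ (fun=> 0)) ?Rintegral_cst ?mul0r// => w _.
  rewrite big1// => k _; case: eqP => // _.
  by rewrite /log2 ln0 ?mul0r ?maxxx// mulr_le0_ge0.
have rate0' : waterfill_rate G (autocorr W) B^-1 = 0.
  rewrite /waterfill_rate (_ : \int[_]_(_ in _) _ = 0) ?mulr0//.
  rewrite (@eq_Rintegral _ _ _ mu _ (fun=> 0)) ?Rintegral_cst ?mul0r// => w.
  rewrite inE/= => wI; rewrite big1// => k _; case: eqP => // _.
  rewrite max_l// /log2 pmulr_lle0 ?invr_gt0// ln_le0//.
  by rewrite ler_pdivrMl// mulr1; exact: hB.
have pow0' : waterfill_power G (autocorr W) B^-1 = 0.
  rewrite /waterfill_power (_ : \int[_]_(_ in _) _ = 0) ?mulr0//.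
  rewrite (@eq_Rintegral _ _ _ mu _ (fun=> 0)) ?Rintegral_cst ?mul0r// => w.
  rewrite inE/= => wI; rewrite big1// => k _; case: eqP => // /eqP n0.
  have l0 : 0 < lambda G (autocorr W) w k by rewrite lt0r n0 ge0.
  by rewrite max_l// subr_le0 lef_pV2 ?posrE//; exact: hB.
have pow0 : waterfill_power G (autocorr W) D = 0.
  rewrite /waterfill_power (_ : \int[_]_(_ in _) _ = 0) ?mulr0//.
  rewrite (@eq_Rintegral _ _ _ mu _ (fun=> 0)) ?Rintegral_cst ?mul0r// => w _.
  rewrite big1// => k _; case: eqP => // _.
  by rewrite max_l// subr_le0 (le_trans D0)// invr_ge0.
move=> hD; exists B^-1; first by rewrite invr_gt0.
split; last by rewrite rate0 rate0'.
by case: hD => [<-|]; [left; rewrite pow0 pow0'|right].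
Qed.

End converse.

Theorem proposition2 (R : realType) (nr nt m : nat)
    (G : 'I_m.+1 -> 'M[R]_(nr, nt))
    (d : measure_display) (Omega : measurableType d) (Pr : probability Omega R)
    (W : int -> {RV Pr >-> vec R nr}) (f : forall k : nat, block R nr k -> R)
    (hW : noise_process W m f)
    (hC : forall w : R, Cfreq m (autocorr W) w \in unitmx)
    (P D : R) (hD : water_level G (autocorr W) P D) :
  (capacity G f P <=
     (waterfill_rate G (autocorr W) D)%:E
     + (gauss_entropy_rate m (autocorr W))%:E - entropy_rate f)%E.
Proof.
have [D' D'0 [hD' <-]] := positive_level hW hC hD.
apply: ge_ereal_sup => _ [Rc hRc <-].
exact: (achievable_le hW hC D'0 hD' hRc).
Qed.
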